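(* Let $t>0$, $\nu,\rho\in\mathbb Z_+^N$, and let $p$ be a polynomial on $\mathbb R^N$ of degree less than $|\nu|$. Then (1) $\int_{\mathbb R^N}R_\nu(t,y)S_\rho(t,y)\,dP_t^\Gamma(0,\cdot)(y)=\nu!\,\delta_{\nu,\rho}$; (2) $\int_{\mathbb R^N}p(y)S_\nu(t,y)\,dP_t^\Gamma(0,\cdot)(y)=\int_{\mathbb R^N}p(y)R_\nu(t,y)\,dP_t^\Gamma(0,\cdot)(y)=0$.
   Context: Setting: $R\subset\mathbb R^N$ a root system normalized by $|\alpha|^2=2$, reflection group $W$, positive subsystem $R_+$, $W$-invariant multiplicity $k\ge0$; Dunkl operators $T_if(x)=\partial_if(x)+\sum_{\alpha\in R_+}k(\alpha)\alpha_i\frac{f(x)-f(\sigma_\alpha x)}{\langle\alpha,x\rangle}$; $V$ the unique linear isomorphism of polynomials with $V\mathcal P_n=\mathcal P_n$, $V1=1$, $T_iV=V\partial_i$; moment functions $m_\nu=V(x^\nu)$; Dunkl kernel $K(x,y)=\sum_\nu\frac{m_\nu(x)}{\nu!}y^\nu$. With $\gamma=\sum_{\alpha\in R_+}k(\alpha)$, $w_k(x)=\prod_{\alpha\in R_+}|\langle\alpha,x\rangle|^{2k(\alpha)}$, $c_k=(\int e^{-|x|^2}w_k)^{-1}$, the centered $k$-Gaussian is $dP_t^\Gamma(0,\cdot)(y)=\frac{c_k}{(4t)^{\gamma+N/2}}e^{-|y|^2/4t}w_k(y)dy$. Let $a_\lambda(t)=\frac{(2\mu)!}{\mu!}(-t)^{|\mu|}$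 if $\lambda=2\mu$, $\mu\in\mathbb Z_+^N$, and $0$ otherwise. Appell characters: $R_\nu(t,x)=\sum_{\rho\le\nu}\binom{\nu}{\rho}a_{\nu-\rho}(t)m_\rho(x)$ (equivalently $K(x,-iy)e^{t|y|^2}=\sum_\nu\frac{(-iy)^\nu}{\nu!}R_\nu(t,x)$). Appell cocharacters ($t>0$): $S_\nu(t,y)$ defined by $e^{-|x|^2/4t}K(x,y/2t)=\sum_\nu\frac{m_\nu(x)}{\nu!}S_\nu(t,y)$, i.e. $S_\nu(t,y)=T_x^\nu\big(e^{-|x|^2/4t}K(x,y/2t)\big)|_{x=0}$. *)

(* Defs.v *)
From HB Require Import structures.
From mathcomp Require Import all_boot all_order all_algebra.
From mathcomp Require Import all_classical all_reals all_analysis.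
Set Implicit Arguments. Unset Strict Implicit. Unset Printing Implicit Defensive.
Import Order.TTheory GRing.Theory Num.Theory.
Import numFieldNormedType.Exports.
Local Open Scope classical_set_scope.
Local Open Scope ring_scope.

Definition dot (R : realType) (N : nat) (a x : 'rV[R]_N) : R :=
  \sum_(i < N) a 0 i * x 0 i.
Definition sqn (R : realType) (N : nat) (x : 'rV[R]_N) : R := dot x x.
Definition refl (R : realType) (N : nat) (a x : 'rV[R]_N) : 'rV[R]_N :=
  x - (2 * dot a x / dot a a) *: a.
Definition ebasis (R : realType) (N : nat) (i : 'I_N) : 'rV[R]_N := delta_mx 0 i.

Definition root_system (R : realType) (N : nat) (Rs : seq 'rV[R]_N) : Prop :=
  [/\ uniq Rs,
      forall a, a \in Rs -> a != 0,
      forall a, a \in Rs -> dot a a = 2,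
      forall a b, a \in Rs -> b \in Rs -> refl a b \in Rs &
      forall a (c : R), a \in Rs -> c *: a \in Rs -> c = 1 \/ c = -1].

Inductive in_W (R : realType) (N : nat) (Rs : seq 'rV[R]_N) :
    ('rV[R]_N -> 'rV[R]_N) -> Prop :=
| W_id : in_W Rs id
| W_step a w : a \in Rs -> in_W Rs w -> in_W Rs (refl a \o w).

Definition regular_for (R : realType) (N : nat) (Rs : seq 'rV[R]_N) (b : 'rV[R]_N) :=
  forall a, a \in Rs -> dot a b != 0.
Definition pos_sub (R : realType) (N : nat) (Rs : seq 'rV[R]_N) (b : 'rV[R]_N) :=
  [seq a <- Rs | 0 < dot a b].

Definition multiplicity (R : realType) (N : nat) (Rs : seq 'rV[R]_N)
    (k : 'rV[R]_N -> R) : Prop :=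
  (forall a, a \in Rs -> 0 <= k a) /\
  (forall w a, in_W Rs w -> a \in Rs -> k (w a) = k a).

Definition mi (N : nat) := {ffun 'I_N -> nat}.
Definition mabs (N : nat) (nu : mi N) : nat := \sum_(i < N) nu i.
Definition mfact (N : nat) (nu : mi N) : nat := \prod_(i < N) (nu i)`!.
Definition mi_of (N d : nat) (m : {ffun 'I_N -> 'I_d}) : mi N :=
  [ffun i => nat_of_ord (m i)].
Definition mono (R : realType) (N : nat) (nu : mi N) (x : 'rV[R]_N) : R :=
  \prod_(i < N) x 0 i ^+ nu i.

Definition poly_lt (R : realType) (N d : nat) (p : 'rV[R]_N -> R) : Prop :=
  exists c : mi N -> R, p = fun x =>
    \sum_(m : {ffun 'I_N -> 'I_d} | (mabs (mi_of m) < d)%N)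
       c (mi_of m) * mono (mi_of m) x.
Definition is_poly (R : realType) (N : nat) (p : 'rV[R]_N -> R) : Prop :=
  exists d, poly_lt d p.
Definition homog (R : realType) (N n : nat) (p : 'rV[R]_N -> R) : Prop :=
  exists c : mi N -> R, p = fun x =>
    \sum_(m : {ffun 'I_N -> 'I_n.+1} | mabs (mi_of m) == n)
       c (mi_of m) * mono (mi_of m) x.

Definition dunkl (R : realType) (N : nat) (Rp : seq 'rV[R]_N) (k : 'rV[R]_N -> R)
    (i : 'I_N) (f : 'rV[R]_N -> R) (x : 'rV[R]_N) : R :=
  'D_(ebasis R i) f x +
  \sum_(a <- Rp) k a * a 0 i * ((f x - f (refl a x)) / dot a x).

Definition regular_pt (R : realType) (N : nat) (Rs : seq 'rV[R]_N) (x : 'rV[R]_N) :=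
  forall a, a \in Rs -> dot a x != 0.

Definition intertwiner (R : realType) (N : nat) (Rs Rp : seq 'rV[R]_N)
    (k : 'rV[R]_N -> R) (V : ('rV[R]_N -> R) -> ('rV[R]_N -> R)) : Prop :=
  [/\ (forall (c : R) p q, is_poly p -> is_poly q ->
        V (fun x => c * p x + q x) = (fun x => c * V p x + V q x)) /\
      (forall p q, is_poly p -> is_poly q -> V p = V q -> p = q),
      forall n p, homog n p -> homog n (V p),
      forall n q, homog n q -> (exists p, homog n p /\ V p = q),
      V (fun _ => 1) = (fun _ => 1) &
      forall i p, is_poly p -> forall x, regular_pt Rs x ->
        dunkl Rp k i (V p) x = V (fun y => 'D_(ebasis R i) p y) x].

Definition moment (R : realType) (N : nat) (V : ('rV[R]_N -> R) -> ('rV[R]_N -> R))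
    (nu : mi N) : 'rV[R]_N -> R := V (mono nu).

Definition kernel_term (R : realType) (N : nat) (V : ('rV[R]_N -> R) -> ('rV[R]_N -> R))
    (x y : 'rV[R]_N) (n : nat) : R :=
  \sum_(m : {ffun 'I_N -> 'I_n.+1} | mabs (mi_of m) == n)
     moment V (mi_of m) x * mono (mi_of m) y / (mfact (mi_of m))%:R.
Definition dkernel (R : realType) (N : nat) (V : ('rV[R]_N -> R) -> ('rV[R]_N -> R))
    (x y : 'rV[R]_N) : R :=
  limn (series (kernel_term V x y)).

Definition acoef (R : realType) (N : nat) (lam : mi N) (t : R) : R :=
  if [forall i, ~~ odd (lam i)] then
    ((\prod_(i < N) (lam i)`!)%:R / (\prod_(i < N) ((lam i)./2)`!)%:R)
      * (- t) ^+ (mabs lam)./2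
  else 0.

Definition appell (R : realType) (N : nat) (V : ('rV[R]_N -> R) -> ('rV[R]_N -> R))
    (nu : mi N) (t : R) (x : 'rV[R]_N) : R :=
  \sum_(m : {ffun 'I_N -> 'I_(mabs nu).+1} | [forall i, (m i <= nu i)%N])
     (\prod_(i < N) 'C(nu i, m i))%:R
       * acoef [ffun i => (nu i - m i)%N] t * moment V (mi_of m) x.

Definition cochar_spec (R : realType) (N : nat) (V : ('rV[R]_N -> R) -> ('rV[R]_N -> R))
    (t : R) (S : mi N -> 'rV[R]_N -> R) : Prop :=
  forall x y : 'rV[R]_N,
    [series \sum_(m : {ffun 'I_N -> 'I_n.+1} | mabs (mi_of m) == n)
        moment V (mi_of m) x / (mfact (mi_of m))%:R * S (mi_of m) y]_n @ \oo
    --> expR (- sqn x / (4 * t)) * dkernel V x ((2 * t)^-1 *: y).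

Definition rcons_row (R : realType) (n : nat) (x : R) (v : 'rV[R]_n) : 'rV[R]_n.+1 :=
  \row_(i < n.+1) (if unlift ord0 i is Some j then v 0 j else x).

Fixpoint iint (R : realType) (n : nat) : ('rV[R]_n -> R) -> R :=
  match n return ('rV[R]_n -> R) -> R with
  | 0 => fun f => f 0
  | n'.+1 => fun f =>
      Rintegral (@lebesgue_measure R) setT (fun x => iint (fun v => f (rcons_row x v)))
  end.

Definition wk (R : realType) (N : nat) (Rp : seq 'rV[R]_N) (k : 'rV[R]_N -> R)
    (x : 'rV[R]_N) : R :=
  \prod_(a <- Rp) (`|dot a x| `^ (2 * k a)).
Definition ck (R : realType) (N : nat) (Rp : seq 'rV[R]_N) (k : 'rV[R]_N -> R) : R :=
  (iint (fun x => expR (- sqn x) * wk Rp k x))^-1.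
Definition gam (R : realType) (N : nat) (Rp : seq 'rV[R]_N) (k : 'rV[R]_N -> R) : R :=
  \sum_(a <- Rp) k a.

Definition gauss_int (R : realType) (N : nat) (Rp : seq 'rV[R]_N) (k : 'rV[R]_N -> R)
    (t : R) (f : 'rV[R]_N -> R) : R :=
  ck Rp k / ((4 * t) `^ (gam Rp k + N%:R / 2)) *
  iint (fun y => f y * expR (- sqn y / (4 * t)) * wk Rp k y).

(* Main.v *)
Require Import Defs.
From HB Require Import structures.
From mathcomp Require Import all_boot all_order all_algebra.
From mathcomp Require Import all_classical all_reals all_analysis.
From mathcomp Require Import measurable_realfun ring lra.
Import Order.TTheory GRing.Theory Num.Theory.
Import numFieldNormedType.Exports.
Set Implicit Arguments. Unset Strict Implicit. Unset Printing Implicit Defensive.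
Local Open Scope classical_set_scope.
Local Open Scope ring_scope.

(**
  The functional [L p := gauss_int p] is linear on polynomials and satisfies
  [L 1 = 1] (scaling) and [L (T_i p) = L (y_i p) / (2 t)].  For the latter the
  weight is replaced by the smooth reflection-invariant product of the
  [(<a,y>^2 + e)^(k a)]; one integrates by parts, uses the invariance of the
  integral under the reflections to turn [<a,y>^-1] into divided differences,
  and lets [e] tend to 0.

  Put [A := exp (- t Delta_k)], a finite sum on polynomials.  Then
  [R_nu = A m_nu], and the commutator [[Delta_k, y_i]] being [2 T_i] gives
  [y_i A q = A (y_i q) + 2 t A (T_i q)], whence [L (A q) = q 0].

  Replacing [x] by [s x] in the expansion defining the cocharacters and
  comparing coefficients of powers of [s] shows that [S_m] is a polynomial and
  that [sum_(|m| = n) m_m(x) / m! S_m(y)] is the component [G_n] of degree [n]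
  in [x] of [exp (- |x|^2 / 4 t) K(x, y / 2 t)].  Since
  [T_i^x G_n = (y_i G_(n-1) - x_i G_(n-2)) / (2 t)] and only the constants are
  killed by all [T_i], induction on [n] yields
  [L (A q . G_n(x, .)) = q(x)] if [q] is homogeneous of degree [n], and [0] for
  homogeneous [q] of any other degree.  Linear independence of the moment functions gives biorthogonality;
  the vanishing statements follow by pushing a monomial through [A].
*)

(** Integrating the generating functions of characters and cocharacters termwise would require
    growth estimates for the Dunkl kernel. Working one degree at a time keeps every sum finite: all
    integrands are polynomials times the Gaussian weight, and no such estimate enters. The weight is
    smoothed because for small k the function |<a,x>|^(2k) is not differentiable where <a,x> = 0,
    and its logarithmic derivative has a pole there. Only after symmetrization does the factor <a,x>
    of a divided difference cancel this pole, so the singular terms cannot be separated before the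
    limit. Integrals over R^N are iterated one-dimensional ones, so invariance under a reflection is
    not built in; it is derived from Fubini and one-dimensional affine substitutions, within the
    class of continuous functions having a Gaussian bound. The expansion defining the cocharacters
    says nothing on the regularity of S_nu, nor on the convergence of the kernel series, whose
    [limn] has a default value where it diverges. Both are extracted from the expansion itself. *)

(** * One-dimensional integrals of functions with Gaussian bounds *)

Section RealLine.
Context {R : realType}.
Implicit Types (f g : R -> R) (a b c d x : R).
Local Notation mu := (@lebesgue_measure R).
Local Notation meas f := (measurable_fun [set: measurableTypeR R] (f : measurableTypeR R -> R)).

Definition int1 f : R := Rintegral mu setT f.

(** Continuity is expressed through sequences because it is mostly obtained from dominated
    convergence, which is sequential. *)
Definition seqcont1 f := forall (u : nat -> R) x,
  u n @[n --> \oo] --> x -> f (u n) @[n --> \oo] --> f x.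

Lemma seqcont1_continuous f : seqcont1 f -> continuous f.
Proof.
move=> cf x; apply/continuous_withinNx; apply/cvgr_dnbhsP => u [_ ux].
exact: cf.
Qed.

Lemma seqcont1_measurable f : seqcont1 f -> meas f.
Proof. by move=> /seqcont1_continuous; exact: continuous_measurable_fun. Qed.

Definition gauss1 c d x := c * expR (- (d * x ^+ 2)).

Lemma measurable_gauss1 c d : meas (gauss1 c d).
Proof.
apply: measurable_funM => //; apply: measurableT_comp => //.
apply: measurableT_comp => //; apply: measurable_funM => //.
Qed.

(** [gauss1 c d] is a multiple of the normal density of variance 1/(2d), whose standard deviation is
    [s]. *)
Lemma integrable_gauss1 c d : 0 < d -> mu.-integrable setT (EFin \o gauss1 c d).
Proof.
move=> d0; set s := Num.sqrt (d *+ 2)^-1.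
have s0 : s != 0 by rewrite gt_eqF // sqrtr_gt0 invr_gt0 pmulrn_lgt0.
have sE : s ^+ 2 *+ 2 = d^-1.
  rewrite /s sqr_sqrtr; last by rewrite invr_ge0 mulrn_wge0 // ltW.
  by rewrite -[X in X *+ 2]mulr1 -mulr_natr -mulrA mul1r -(mulr_natr d) invfM -mulrA mulVf ?mulr1 // pnatr_eq0.
have -> : EFin \o gauss1 c d =
    (fun x => (c / normal_peak s)%:E * (normal_pdf 0 s x)%:E)%E.
  apply/funext => x /=; rewrite -EFinM normal_pdfE // /normal_fun.
  rewrite mulrA divfK; last by rewrite gt_eqF // normal_peak_gt0.
  by rewrite sE invrK subr0 /gauss1 [d * _]mulrC mulNr.
by apply: integrableZl => //; exact: integrable_normal_pdf.
Qed.

Lemma gauss1_integrable c d f : 0 < d -> meas f ->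
  (forall x, `|f x| <= gauss1 c d x) -> mu.-integrable setT (EFin \o f).
Proof.
move=> d0 mf fb; apply: le_integrable (integrable_gauss1 c d0) => //.
  exact/measurable_EFinP.
by move=> x _ /=; rewrite lee_fin (le_trans (fb x)) // ler_norm.
Qed.

Lemma int1_gauss1_ge0 c d : 0 <= c -> 0 <= int1 (gauss1 c d).
Proof.
by move=> c0; apply: Rintegral_ge0 => x _; rewrite mulr_ge0 // expR_ge0.
Qed.

Lemma le_int1_gauss1 c d f : 0 < d -> meas f ->
  (forall x, `|f x| <= gauss1 c d x) -> `|int1 f| <= c * int1 (gauss1 1 d).
Proof.
move=> d0 mf fb.
have ig := integrable_gauss1 1 d0.
rewrite -RintegralZl //; apply: le_trans (le_normr_Rintegral _ _) _ => //.
  exact: gauss1_integrable fb.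
apply: le_Rintegral => //.
- apply: gauss1_integrable d0 _ _ => //; last by move=> x; rewrite normr_id; exact: fb.
  exact: measurableT_comp.
- have := integrable_gauss1 c d0; apply: eq_integrable => // x _ /=.
  by rewrite /gauss1 mul1r.
- by move=> x _; rewrite /gauss1 mul1r; exact: fb.
Qed.

Lemma int1_dominated c d (h : nat -> R -> R) f : 0 < d ->
  (forall n, meas (h n)) ->
  (forall n x, `|h n x| <= gauss1 c d x) ->
  (forall x, h n x @[n --> \oo] --> f x) ->
  int1 (h n) @[n --> \oo] --> int1 f.
Proof.
move=> d0 mh hb hf.
have mf : meas f.
  by apply: (measurable_fun_cvg mh) => x _; exact: hf.
have fb x : `|f x| <= gauss1 c d x.
  apply: (ler_cvg_to (cvg_norm (hf x)) (cvg_cst (gauss1 c d x))).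
  by apply: nearW => n; exact: hb.
have if_ := gauss1_integrable d0 mf fb.
apply: fine_cvg; rewrite fineK; last exact: integrable_fin_num.
have mhE n : measurable_fun [set: measurableTypeR R] (EFin \o h n) by exact/measurable_EFinP.
have hfE x : setT x -> (EFin \o h n) x @[n --> \oo] --> (EFin \o f) x.
  by move=> _; apply: cvg_EFin; [exact: nearW|exact: hf].
have hbE n x : setT x -> (`|(EFin \o h n) x| <= (EFin \o gauss1 c d) x)%E.
  by move=> _ /=; rewrite lee_fin.
have D := dominated_cvg measurableT mhE hfE _ (integrable_gauss1 c d0) hbE.
exact: D.
Qed.

Lemma measurable_affine a b : meas (fun x => a * x + b).
Proof. by apply: measurable_funD => //; exact: measurable_funM. Qed.

(** The pushforward of Lebesgue measure under the affine map, scaled by [a], gives each half-open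
    interval its length, and this property characterizes Lebesgue measure. *)
Lemma lebesgue_measure_affine a b (A : set R) : 0 < a -> measurable A ->
  (a%:E * mu ((fun x => (a * x + b)%R) @^-1` A))%E = mu A.
Proof.
move=> a0 mA; apply/esym.
pose phi := (fun x : R => a * x + b).
have mphi : measurable_fun [set: measurableTypeR R]
    (phi : measurableTypeR R -> measurableTypeR R).
  exact: measurable_affine.
pose m1 := measure_function_pushforward__canonical__measure_function_Measure mu mphi.
pose m' := mscale (NngNum (ltW a0)) m1.
have := @lebesgue_measure_unique R m'.
move/(_ _ A mA) => -> //= _ [[x y]] _ <- /=.
rewrite /m' /mscale /= /pushforward /=.
have -> : phi @^-1` `]x, y]%classic = `](x - b) / a, (y - b) / a]%classic.
  apply/seteqP; split => z /=; rewrite !in_itv /= /phi;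
  by rewrite ltr_pdivrMr // ler_pdivlMr // ltrBlDr lerBrDr [z * a]mulrC.
rewrite !lebesgue_measure_itv /= !lte_fin.
have -> : ((x - b) / a < (y - b) / a) = (x < y).
  by rewrite ltr_pM2r ?invr_gt0 // ltrD2r.
case: ifP => _; last by rewrite mule0.
rewrite -!EFinB -EFinM; congr (_%:E).
by field; rewrite gt_eqF.
Qed.

Lemma ge0_integral_affine a b (g : R -> \bar R) : 0 < a ->
  measurable_fun [set: measurableTypeR R] g -> (forall x, 0 <= g x)%E ->
  (a%:E * \int[mu]_x g (a * x + b)%R = \int[mu]_x g x)%E.
Proof.
move=> a0 mg g0.
pose phi := (fun x : R => a * x + b).
have mphi : measurable_fun [set: measurableTypeR R]
    (phi : measurableTypeR R -> measurableTypeR R).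
  exact: measurable_affine.
pose m1 := measure_function_pushforward__canonical__measure_function_Measure mu mphi.
have -> : (\int[mu]_x g x = \int[mscale (NngNum (ltW a0)) m1]_x g x)%E.
  apply: eq_measure_integral => A mA _.
  exact/esym/(lebesgue_measure_affine b a0 mA).
rewrite ge0_integral_mscale //=; congr (_ * _)%E.
by rewrite (ge0_integral_pushforward mphi) ?preimage_setT.
Qed.

Lemma int1_pos_affine a b f : 0 < a -> mu.-integrable setT (EFin \o f) ->
  mu.-integrable setT (EFin \o (fun x => f (a * x + b))) ->
  a * int1 (fun x => f (a * x + b)) = int1 f.
Proof.
move=> a0 if_ ifa.
have mf : measurable_fun [set: measurableTypeR R] (EFin \o f).
  by case/integrableP: if_.
rewrite /int1 /Rintegral -[X in X * _]/(fine a%:E) -fineM //; last first.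
  exact: integrable_fin_num.
congr fine.
rewrite integralE [RHS]integralE muleBr //; last first.
  by rewrite fin_num_adde_defl // fin_numN integrable_neg_fin_num.
congr (_ - _)%E.
  have <- // := ge0_integral_affine b a0 (measurable_funepos mf).
  by congr (_ * _)%E; apply: eq_integral => x _; rewrite !funeposE.
have <- // := ge0_integral_affine b a0 (measurable_funeneg mf).
by congr (_ * _)%E; apply: eq_integral => x _; rewrite !funenegE.
Qed.

Lemma int1_opp f : mu.-integrable setT (EFin \o f) ->
  mu.-integrable setT (EFin \o (fun x => f (- x))) ->
  int1 (fun x => f (- x)) = int1 f.
Proof.
move=> if_ ifa.
have mphi : measurable_fun [set: measurableTypeR R]
    (-%R : measurableTypeR R -> measurableTypeR R).
  exact: oppr_measurable.
have mf : measurable_fun [set: measurableTypeR R] (EFin \o f).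
  by case/integrableP: if_.
pose m1 := measure_function_pushforward__canonical__measure_function_Measure mu mphi.
rewrite /int1 /Rintegral.
have -> : (\int[mu]_x (f x)%:E = \int[m1]_x (EFin \o f) x)%E.
  by apply: eq_measure_integral => A mA _; rewrite /m1 /= lebesgue_measureN.
by rewrite (integral_pushforward mphi) ?preimage_setT.
Qed.

Lemma meas_affine a b f : meas f -> meas (fun x => f (a * x + b)).
Proof.
move=> mf; apply: (measurableT_comp (f := f)) => //; exact: measurable_affine.
Qed.

(** Since (a x + b)^2 >= a^2 x^2 / 2 - b^2, half of the decay rate survives and the shift goes into
    the constant. *)
Lemma le_gauss1_affine a b c d : a != 0 -> 0 <= c -> 0 < d -> exists c' d',
  [/\ 0 <= c', 0 < d' & forall x, gauss1 c d (a * x + b) <= gauss1 c' d' x].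
Proof.
move=> a0 c0 d0; exists (c * expR (d * b ^+ 2)), (d * a ^+ 2 / 2).
have a20 : 0 < a ^+ 2 by rewrite exprn_even_gt0.
split; first by rewrite mulr_ge0 // expR_ge0.
  by rewrite divr_gt0 // mulr_gt0.
move=> x; rewrite /gauss1 -mulrA ler_wpM2l // -expRD ler_expR.
have : 0 <= d * (a * x + 2 * b) ^+ 2 by rewrite mulr_ge0 ?sqr_ge0 // ltW.
nra.
Qed.

Lemma int1_affine a b c d f : a != 0 -> 0 < d -> meas f ->
  (forall x, `|f x| <= gauss1 c d x) ->
  `|a| * int1 (fun x => f (a * x + b)) = int1 f.
Proof.
move=> a0 d0 mf fb.
have c0 : 0 <= c.
  have := fb 0; rewrite /gauss1 expr0n /= mulr0 oppr0 expR0 mulr1.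
  exact: le_trans.
have aff a' b' : a' != 0 -> mu.-integrable setT (EFin \o (fun x => f (a' * x + b'))).
  move=> a'0; have [c' [d' [c'0 d'0 h]]] := le_gauss1_affine b' a'0 c0 d0.
  apply: (gauss1_integrable d'0 (meas_affine _ _ mf)) => x.
  exact: le_trans (fb _) (h x).
have if_ := gauss1_integrable d0 mf fb.
have [a1|a1|a1] := ltgtP a 0; last by rewrite a1 eqxx in a0.
- have na : 0 < - a by rewrite oppr_gt0.
  rewrite ltr0_norm // -(int1_pos_affine (b := b) na if_); last first.
    by apply: aff; rewrite oppr_eq0.
  congr (_ * _).
  rewrite -(int1_opp (f := fun x => f (- a * x + b))); first last.
  - have := aff a b a0; apply: eq_integrable => // x _ /=.
    by rewrite mulrNN.
  - by apply: aff; rewrite oppr_eq0.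
  by apply: eq_Rintegral => x _ /=; rewrite mulrNN.
- by rewrite gtr0_norm // (int1_pos_affine (b := b)) //; exact: aff.
Qed.

Definition seqcont2 (F : R -> R -> R) := forall (u v : nat -> R) x y,
  u n @[n --> \oo] --> x -> v n @[n --> \oo] --> y ->
  F (u n) (v n) @[n --> \oo] --> F x y.

Lemma floor_div_cvg x :
  (Num.floor (n.+1%:R * x))%:~R / n.+1%:R @[n --> \oo] --> x.
Proof.
apply/cvgrPdist_le => e e0; near=> n.
have n0 : 0 < n.+1%:R :> R by rewrite ltr0n.
have /andP[h1 h2] := floor_itv (n.+1%:R * x).
have -> : x - (Num.floor (n.+1%:R * x))%:~R / n.+1%:R =
    (n.+1%:R * x - (Num.floor (n.+1%:R * x))%:~R) / n.+1%:R.
  by field; rewrite gt_eqF.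
rewrite ger0_norm; last by rewrite divr_ge0 ?subr_ge0 // ltW.
apply: ltW; apply: (@le_lt_trans _ _ n.+1%:R^-1).
  rewrite ler_pdivrMr // mulVf ?gt_eqF // lerBlDl.
  by rewrite intrD in h2; exact: ltW.
by near: n; exact: (near_infty_natSinv_lt (PosNum e0)).
Unshelve. all: by end_near. Qed.

(** Rounding the first variable down to a multiple of 1/(m+1) gives functions whose preimages are
    countable unions of measurable rectangles; joint continuity makes them converge pointwise to
    [F]. *)
Lemma seqcont2_measurable (F : R -> R -> R) : seqcont2 F ->
  measurable_fun [set: measurableTypeR R * measurableTypeR R]
    (fun z => F z.1 z.2).
Proof.
move=> cF.
pose h m (z : measurableTypeR R * measurableTypeR R) : R :=
  F ((Num.floor (m.+1%:R * z.1))%:~R / m.+1%:R) z.2.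
suff mh m : measurable_fun setT (h m).
  apply: (measurable_fun_cvg mh) => z _; apply: cF; first exact: floor_div_cvg.
  exact: cvg_cst.
move=> _ B mB; rewrite setTI.
have m0 : 0 < m.+1%:R :> R by rewrite ltr0n.
have -> : h m @^-1` B
  = \bigcup_(j : int) (`[j%:~R / m.+1%:R, (j + 1)%:~R / m.+1%:R[%classic `*`
       (F (j%:~R / m.+1%:R) @^-1` B)).
  apply/seteqP; split; case=> x y /=.
    move=> Bxy; exists (Num.floor (m.+1%:R * x)) => //; split => //=.
    rewrite in_itv /= ler_pdivrMr // ltr_pdivlMr // [x * _]mulrC.
    exact: floor_itv.
  move=> [j _ [/=]]; rewrite in_itv /= ler_pdivrMr // ltr_pdivlMr // [x * _]mulrC.
  by move=> /floor_def fE; rewrite /h /= fE.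
apply: countable_bigcupT_measurable; first exact: countableP.
move=> j; apply: measurableX; first exact: measurable_itv.
rewrite -[X in measurable X]setTI.
have : meas (F (j%:~R / m.+1%:R)).
  by apply: seqcont1_measurable => u x ux; apply: cF => //; exact: cvg_cst.
by apply.
Qed.

Lemma int1_fubini c d (F : R -> R -> R) : 0 < d -> seqcont2 F ->
  (forall x y, `|F x y| <= gauss1 (gauss1 c d x) d y) ->
  int1 (fun x => int1 (F x)) = int1 (fun y => int1 (F ^~ y)).
Proof.
move=> d0 cF Fb.
have mF := seqcont2_measurable cF.
have mFx x : meas (F x).
  by apply: seqcont1_measurable => u z uz; apply: cF => //; exact: cvg_cst.
have mFy y : meas (F ^~ y).
  by apply: seqcont1_measurable => u z uz; apply: cF => //; exact: cvg_cst.
have Fb' x y : `|F x y| <= gauss1 (gauss1 c d y) d x.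
  by rewrite (le_trans (Fb x y)) // /gauss1 -!mulrA [X in c * X]mulrC.
have iFx x : mu.-integrable setT (EFin \o F x) by exact: gauss1_integrable (Fb x).
have iFy y : mu.-integrable setT (EFin \o F ^~ y).
  exact: gauss1_integrable (Fb' ^~ y).
pose f := fun z : measurableTypeR R * measurableTypeR R => (F z.1 z.2)%:E.
have mf : measurable_fun setT f by exact/measurable_EFinP.
have if_ : (mu \x mu)%E.-integrable setT f.
  apply/(integrable12ltyP _ _ mf).
  apply: (@le_lt_trans _ _ (\int[mu]_x (gauss1 (c * int1 (gauss1 1 d)) d x)%:E)%E).
    apply: ge0_le_integral => //.
    - by move=> x _; exact: integral_ge0.
    - have ma : measurable_fun setT (fun z => `|f z|%E) by exact: measurableT_comp.
      exact: (measurable_fun_fubini_tonelli_F (m2 := mu) _ ma).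
    - by apply/measurable_EFinP; exact: measurable_gauss1.
    - move=> x _.
      apply: (@le_trans _ _ (\int[mu]_y ((gauss1 c d x)%:E * (gauss1 1 d y)%:E))%E).
        apply: ge0_le_integral => //.
        - by apply: measurableT_comp => //; apply/measurable_EFinP; exact: mFx.
        - apply/measurable_EFinP; apply: measurable_funM => //.
          exact: measurable_gauss1.
        - by move=> y _; rewrite /f /= -EFinM lee_fin (le_trans (Fb x y)) // /gauss1 mul1r.
      rewrite integralZl //; last exact: integrable_gauss1.
      have -> : (\int[mu]_y (gauss1 1 d y)%:E = (int1 (gauss1 1 d))%:E)%E.
        by rewrite fineK //; apply: integrable_fin_num => //; exact: integrable_gauss1.
      by rewrite -EFinM lee_fin /gauss1 mulrAC.
  have /integrableP[_] := integrable_gauss1 (c * int1 (gauss1 1 d)) d0.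
  apply: le_lt_trans; apply: ge0_le_integral => //.
  - move=> x _; rewrite lee_fin mulr_ge0 ?expR_ge0 // mulr_ge0 //; last first.
      exact: int1_gauss1_ge0.
    have := Fb 0 0; rewrite /gauss1 expr0n /= mulr0 oppr0 expR0 !mulr1.
    exact: le_trans.
  - by apply/measurable_EFinP; exact: measurable_gauss1.
  - apply: measurableT_comp => //; apply/measurable_EFinP; exact: measurable_gauss1.
  - by move=> x _; rewrite lee_fin ler_norm.
have E := Fubini if_; rewrite /int1 /Rintegral; congr fine.
(* The inner [int1] takes the finite part of an extended integral; undoing this uses that every
   slice is integrable, not just almost every one. *)
transitivity (\int[mu]_x \int[mu]_y f (x, y))%E.
  apply: eq_integral => x _; rewrite fineK //.
  exact: (integrable_fin_num measurableT (iFx x)).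
rewrite E; apply: eq_integral => y _; rewrite fineK //.
exact: (integrable_fin_num measurableT (iFy y)).
Qed.

Lemma int1_gt0 c d f x : 0 < d -> seqcont1 f -> (forall y, `|f y| <= gauss1 c d y) ->
  (forall y, 0 <= f y) -> 0 < f x -> 0 < int1 f.
Proof.
move=> d0 cf fb f0 fx0.
have mf := seqcont1_measurable cf.
have if_ := gauss1_integrable d0 mf fb.
have /cvgrPdist_lt /(_ (f x / 2)) := seqcont1_continuous cf (x := x).
rewrite divr_gt0 // => /(_ isT) [e /= e0 he].
pose A := `](x - e), (x + e)[%classic : set R.
have fA y : A y -> f x / 2 <= f y.
  rewrite /A /= in_itv /= => /andP[h1 h2].
  have : `|f x - f y| < f x / 2.
    by apply: he => /=; rewrite distrC ltr_distl h1 h2.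
  rewrite ltr_norml => /andP[_]; lra.
rewrite -lte_fin fineK; last exact: integrable_fin_num.
apply: (@lt_le_trans _ _ (\int[mu]_(y in A) (f x / 2)%:E)%E).
  rewrite integral_cst /=; last exact: measurable_itv.
  rewrite lebesgue_measure_itv /= lte_fin ifT; last lra.
  by rewrite -EFinB -EFinM lte_fin mulr_gt0 ?divr_gt0 //; lra.
apply: (@le_trans _ _ (\int[mu]_(y in A) (f y)%:E)%E).
  apply: ge0_le_integral => //.
  - exact: measurable_itv.
  - by move=> y _; rewrite lee_fin ltW // divr_gt0.
  - apply: measurable_funTS; exact/measurable_EFinP.
apply: ge0_subset_integral => //; first exact: measurable_itv.
  exact/measurable_EFinP.
by move=> y _; rewrite lee_fin.
Qed.

End RealLine.

(** * Rows with a distinguished coordinate, inner products, sequential continuity *)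

Section Rows.
Context {R : realType}.

(** [rcons_row] at an arbitrary position; at [ord0] the two are convertible, so [iint] unfolds
    directly in terms of [ins]. *)
Definition ins (n : nat) (j : 'I_n.+1) (x : R) (v : 'rV[R]_n) : 'rV[R]_n.+1 :=
  \row_i (if unlift j i is Some i' then v 0 i' else x).

Lemma ins_eq n (j : 'I_n.+1) x (v : 'rV[R]_n) : ins j x v 0 j = x.
Proof. by rewrite mxE unlift_none. Qed.

Lemma ins_lift n (j : 'I_n.+1) x (v : 'rV[R]_n) i : ins j x v 0 (lift j i) = v 0 i.
Proof. by rewrite mxE liftK. Qed.

Lemma ins_surj n (j : 'I_n.+1) (y : 'rV[R]_n.+1) :
  y = ins j (y 0 j) (\row_i y 0 (lift j i)).
Proof.
apply/rowP => i; have [i' ->|->] := unliftP j i; last by rewrite ins_eq.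
by rewrite ins_lift mxE.
Qed.

Lemma insD n (j : 'I_n.+1) x x' (v v' : 'rV[R]_n) :
  ins j x v + ins j x' v' = ins j (x + x') (v + v').
Proof.
apply/rowP => i; rewrite mxE; have [i' ->|->] := unliftP j i.
  by rewrite !ins_lift mxE.
by rewrite !ins_eq.
Qed.

Lemma insZ n (j : 'I_n.+1) a x (v : 'rV[R]_n) :
  a *: ins j x v = ins j (a * x) (a *: v).
Proof.
apply/rowP => i; rewrite mxE; have [i' ->|->] := unliftP j i.
  by rewrite !ins_lift mxE.
by rewrite !ins_eq.
Qed.

Lemma ins_insC n (j : 'I_n.+1) x z (v : 'rV[R]_n) :
  ins (lift ord0 j) x (ins ord0 z v) = ins ord0 z (ins j x v).
Proof.
apply/rowP => i; have [i' ->|->] := unliftP (lift ord0 j) i; last first.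
  by rewrite ins_eq ins_lift ins_eq.
rewrite ins_lift; have [i'' ->|->] := unliftP ord0 i'.
  have -> : lift (lift ord0 j) (lift ord0 i'') = lift ord0 (lift j i'').
    apply/val_inj; rewrite /= /bump /=.
    by rewrite !add1n ltnS; case: (j <= i'')%N.
  by rewrite !ins_lift.
have -> : lift (lift ord0 j) ord0 = ord0 :> 'I_n.+2 by apply/val_inj.
by rewrite !ins_eq.
Qed.

Lemma dot_ins n (j : 'I_n.+1) x x' (v v' : 'rV[R]_n) :
  dot (ins j x v) (ins j x' v') = x * x' + dot v v'.
Proof.
rewrite /dot (bigD1_ord j) //= !ins_eq; congr (_ + _).
by apply: eq_bigr => i _; rewrite !ins_lift.
Qed.

Lemma sqn_ins n (j : 'I_n.+1) x (v : 'rV[R]_n) :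
  sqn (ins j x v) = x ^+ 2 + sqn v.
Proof. by rewrite /sqn dot_ins expr2. Qed.

Lemma dotC n (x y : 'rV[R]_n) : dot x y = dot y x.
Proof. by apply: eq_bigr => i _; rewrite mulrC. Qed.

Lemma dotDl n (x y z : 'rV[R]_n) : dot (x + y) z = dot x z + dot y z.
Proof. by rewrite -big_split /=; apply: eq_bigr => i _; rewrite mxE mulrDl. Qed.

Lemma dotZl n a (x z : 'rV[R]_n) : dot (a *: x) z = a * dot x z.
Proof. by rewrite mulr_sumr; apply: eq_bigr => i _; rewrite mxE mulrA. Qed.

Lemma dotDr n (x y z : 'rV[R]_n) : dot z (x + y) = dot z x + dot z y.
Proof. by rewrite dotC dotDl !(dotC z). Qed.

Lemma dotZr n a (x z : 'rV[R]_n) : dot z (a *: x) = a * dot z x.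
Proof. by rewrite dotC dotZl (dotC z). Qed.

Lemma dotNl n (x z : 'rV[R]_n) : dot (- x) z = - dot x z.
Proof. by rewrite -scaleN1r dotZl mulN1r. Qed.

Lemma dotNr n (x z : 'rV[R]_n) : dot z (- x) = - dot z x.
Proof. by rewrite dotC dotNl dotC. Qed.

Lemma sqn_ge0 n (x : 'rV[R]_n) : 0 <= sqn x.
Proof. by apply: sumr_ge0 => i _; rewrite -expr2 sqr_ge0. Qed.

Lemma sqnZ n a (x : 'rV[R]_n) : sqn (a *: x) = a ^+ 2 * sqn x.
Proof. by rewrite /sqn dotZl dotZr mulrA expr2. Qed.

(** This is |x + 2y|^2 >= 0 rearranged. It shows that translating a Gaussian bound costs at most
    half of its rate. *)
Lemma sqnD_ge n (x y : 'rV[R]_n) : sqn x / 2 - sqn y <= sqn (x + y).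
Proof.
have : 0 <= sqn (x + 2 *: y) by exact: sqn_ge0.
rewrite /sqn !(dotDl, dotDr, dotZl, dotZr) (dotC y x); lra.
Qed.

Lemma sqn_ebasis n (j : 'I_n) : sqn (ebasis R j) = 1.
Proof.
rewrite /sqn /dot (bigD1 j) //= !mxE !eqxx mulr1 big1 ?addr0 // => i ij.
by rewrite mxE (negbTE ij) andbF mulr0.
Qed.

Definition cvgrow n (u : nat -> 'rV[R]_n) (x : 'rV[R]_n) :=
  forall i, u m 0 i @[m --> \oo] --> x 0 i.

Definition seqcont n (f : 'rV[R]_n -> R) := forall (u : nat -> 'rV[R]_n) x,
  cvgrow u x -> f (u m) @[m --> \oo] --> f x.

Lemma cvgrow_cst n (x : 'rV[R]_n) : cvgrow (fun=> x) x.
Proof. by move=> i; exact: cvg_cst. Qed.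

Lemma cvgrow_ins n (j : 'I_n.+1) (u : nat -> R) (x : R) v (w : 'rV[R]_n) :
  u m @[m --> \oo] --> x -> cvgrow v w -> cvgrow (fun m => ins j (u m) (v m)) (ins j x w).
Proof.
move=> ux vw i; have [i' ->|->] := unliftP j i.
  by under eq_fun do rewrite ins_lift; rewrite ins_lift; exact: vw.
by under eq_fun do rewrite ins_eq; rewrite ins_eq.
Qed.

Lemma cvgrowD n u (x : 'rV[R]_n) v y : cvgrow u x -> cvgrow v y ->
  cvgrow (fun m => u m + v m) (x + y).
Proof.
by move=> ux vy i; under eq_fun do rewrite mxE; rewrite mxE; exact: cvgD.
Qed.

Lemma cvgrowZ n (a : nat -> R) (b : R) u (x : 'rV[R]_n) : a m @[m --> \oo] --> b -> cvgrow u x ->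
  cvgrow (fun m => a m *: u m) (b *: x).
Proof.
by move=> ab ux i; under eq_fun do rewrite mxE; rewrite mxE; exact: cvgM.
Qed.

Lemma cvg_sum_seq (J : Type) (r : seq J) (f : J -> nat -> R) (l : J -> R) :
  (forall i, f i m @[m --> \oo] --> l i) ->
  \sum_(i <- r) f i m @[m --> \oo] --> \sum_(i <- r) l i.
Proof.
move=> fl; elim: r => [|i r IH].
  by under eq_fun do rewrite big_nil; rewrite big_nil; exact: cvg_cst.
under eq_fun do rewrite big_cons; rewrite big_cons.
exact: cvgD.
Qed.

Lemma cvg_dot n u (x : 'rV[R]_n) v y : cvgrow u x -> cvgrow v y ->
  dot (u m) (v m) @[m --> \oo] --> dot x y.
Proof.
move=> ux vy; rewrite /dot.
apply: cvg_sum_seq => i; exact: cvgM.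
Qed.

Lemma seqcont_sqn n : seqcont (@sqn R n).
Proof. by move=> u x ux; exact: cvg_dot. Qed.

Lemma seqcont_coord n i : seqcont (fun x : 'rV[R]_n => x 0 i).
Proof. by move=> u x; exact. Qed.

Lemma seqcont_dot n a : seqcont (@dot R n a).
Proof. by move=> u x ux; apply: cvg_dot => //; exact: cvgrow_cst. Qed.

Lemma seqcont_cst n c : seqcont (fun _ : 'rV[R]_n => c).
Proof. by move=> u x ux; exact: cvg_cst. Qed.

Lemma seqcontD n (f g : 'rV[R]_n -> R) : seqcont f -> seqcont g ->
  seqcont (fun x => f x + g x).
Proof. by move=> cf cg u x ux; apply: cvgD; [exact: cf|exact: cg]. Qed.

Lemma seqcontM n (f g : 'rV[R]_n -> R) : seqcont f -> seqcont g ->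
  seqcont (fun x => f x * g x).
Proof. by move=> cf cg u x ux; apply: cvgM; [exact: cf|exact: cg]. Qed.

Lemma seqcont_comp1 n (g : R -> R) (f : 'rV[R]_n -> R) : continuous g ->
  seqcont f -> seqcont (fun x => g (f x)).
Proof. by move=> cg cf u x ux; apply: continuous_cvg; [exact: cg|exact: cf]. Qed.

End Rows.

(** * Iterated integrals of continuous functions with Gaussian bounds *)

Section IteratedIntegral.
Context {R : realType}.

Definition gb n (c d : R) (f : 'rV[R]_n -> R) :=
  forall x, `|f x| <= c * expR (- (d * sqn x)).

(** The class of admissible integrands. Slices of a member belong to the class one dimension lower,
    so that statements about [iint] go by induction on the dimension; sums, translations, dilations
    and reflections preserve it. *)
Definition nice n (f : 'rV[R]_n -> R) :=
  seqcont f /\ exists c d, 0 < d /\ gb c d f.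

Lemma gb_ge0 n c d (f : 'rV[R]_n -> R) : gb c d f -> 0 <= c.
Proof.
move=> /(_ 0) h; have := le_trans (normr_ge0 _) h.
by rewrite pmulr_lge0 // expR_gt0.
Qed.

Lemma gb_slice n (j : 'I_n.+1) c d (f : 'rV[R]_n.+1 -> R) x : gb c d f ->
  gb (gauss1 c d x) d (fun v => f (ins j x v)).
Proof.
move=> fb v; apply: le_trans (fb _) _.
by rewrite sqn_ins /gauss1 -mulrA -expRD mulrDr opprD.
Qed.

Lemma seqcont_slice n (j : 'I_n.+1) (f : 'rV[R]_n.+1 -> R) x : seqcont f ->
  seqcont (fun v => f (ins j x v)).
Proof. by move=> cf u w uw; apply: cf; apply: cvgrow_ins => //; exact: cvg_cst. Qed.

Lemma nice_slice n (j : 'I_n.+1) (f : 'rV[R]_n.+1 -> R) x : nice f ->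
  nice (fun v => f (ins j x v)).
Proof.
move=> [cf [c [d [d0 fb]]]]; split; first exact: seqcont_slice.
by exists (gauss1 c d x), d; split => //; exact: gb_slice.
Qed.

Let I d := int1 (@gauss1 R 1 d).

Lemma iintS n (f : 'rV[R]_n.+1 -> R) :
  iint f = int1 (fun x => iint (fun v => f (ins ord0 x v))).
Proof. by []. Qed.

(** The two halves need a joint induction: in dimension n+1 the estimate requires measurability of
    the inner integral, which comes from dominated convergence in dimension n, and dominated
    convergence takes its dominating function from the estimate in dimension n. *)
Lemma iint_le_dominated n :
  (forall c d (f : 'rV[R]_n -> R), 0 < d -> seqcont f -> gb c d f ->
     `|iint f| <= c * I d ^+ n) /\
  (forall c d (h : nat -> 'rV[R]_n -> R) f, 0 < d ->
     (forall m, seqcont (h m)) -> (forall m, gb c d (h m)) ->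
     (forall x, h m x @[m --> \oo] --> f x) ->
     iint (h m) @[m --> \oo] --> iint f).
Proof.
elim: n => [|n [IHb IHd]].
  split=> [c d f d0 cf fb|c d h f d0 ch hb hf /=]; last exact: hf.
  rewrite expr0 mulr1 (le_trans (fb 0)) // ler_piMr ?(gb_ge0 fb) //.
  by rewrite -expR0 ler_expR oppr_le0 mulr_ge0 ?sqn_ge0 // ltW.
have mF c d f : 0 < d -> seqcont f -> gb c d f ->
    seqcont1 (fun x => iint (fun v : 'rV[R]_n => f (ins ord0 x v))).
  move=> d0 cf fb u x ux; apply: (IHd c d) => //.
  - by move=> m; exact: seqcont_slice.
  - move=> m v; apply: le_trans (gb_slice ord0 (u m) fb v) _.
    rewrite ler_wpM2r ?expR_ge0 // /gauss1 ler_piMr ?(gb_ge0 fb) //.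
    by rewrite -expR0 ler_expR oppr_le0 mulr_ge0 ?sqr_ge0 // ltW.
  - by move=> v; apply: cf; apply: cvgrow_ins => //; exact: cvgrow_cst.
have bF c d f : 0 < d -> seqcont f -> gb c d f -> forall x,
    `|iint (fun v : 'rV[R]_n => f (ins ord0 x v))| <= gauss1 (c * I d ^+ n) d x.
  move=> d0 cf fb x; rewrite /gauss1 mulrAC.
  by apply: IHb => //; [exact: seqcont_slice|exact: gb_slice].
split=> [c d f d0 cf fb|c d h f d0 ch hb hf].
  rewrite iintS exprSr mulrA; apply: le_int1_gauss1 => //; last exact: bF.
  by apply: seqcont1_measurable; exact: mF fb.
apply: (int1_dominated (c := c * I d ^+ n) (d := d)) => //.
- by move=> m; apply: seqcont1_measurable; exact: mF (hb m).
- by move=> m; exact: bF.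
- move=> x; apply: (IHd (gauss1 c d x) d) => //.
  + by move=> m; exact: seqcont_slice.
  + by move=> m; exact: gb_slice.
Qed.

Lemma iint_le n c d (f : 'rV[R]_n -> R) : 0 < d -> seqcont f -> gb c d f ->
  `|iint f| <= c * I d ^+ n.
Proof. exact: (iint_le_dominated n).1. Qed.

Lemma iint_dominated n c d (h : nat -> 'rV[R]_n -> R) f : 0 < d ->
  (forall m, seqcont (h m)) -> (forall m, gb c d (h m)) ->
  (forall x, h m x @[m --> \oo] --> f x) ->
  iint (h m) @[m --> \oo] --> iint f.
Proof. exact: (iint_le_dominated n).2. Qed.

Lemma iint_slice_seqcont n (j : 'I_n.+1) (f : 'rV[R]_n.+1 -> R) : nice f ->
  seqcont1 (fun x => iint (fun v => f (ins j x v))).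
Proof.
move=> [cf [c [d [d0 fb]]]] u x ux; apply: (iint_dominated (c := c) d0).
- by move=> m; exact: seqcont_slice.
- move=> m v; apply: le_trans (gb_slice j (u m) fb v) _.
  rewrite ler_wpM2r ?expR_ge0 // /gauss1 ler_piMr ?(gb_ge0 fb) //.
  by rewrite -expR0 ler_expR oppr_le0 mulr_ge0 ?sqr_ge0 // ltW.
- by move=> v; apply: cf; apply: cvgrow_ins => //; exact: cvgrow_cst.
Qed.

Lemma iint_slice_gauss1 n (j : 'I_n.+1) (f : 'rV[R]_n.+1 -> R) : nice f ->
  exists c d, 0 < d /\
    forall x, `|iint (fun v => f (ins j x v))| <= gauss1 c d x.
Proof.
move=> [cf [c [d [d0 fb]]]]; exists (c * I d ^+ n), d; split => // x.
rewrite /gauss1 mulrAC; apply: iint_le => //; first exact: seqcont_slice.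
exact: gb_slice.
Qed.

Lemma iint_slice_integrable n (j : 'I_n.+1) (f : 'rV[R]_n.+1 -> R) : nice f ->
  lebesgue_measure.-integrable setT (EFin \o (fun x => iint (fun v => f (ins j x v)))).
Proof.
move=> nf; have [c [d [d0 fb]]] := iint_slice_gauss1 j nf.
apply: gauss1_integrable d0 _ fb; apply: seqcont1_measurable.
exact: iint_slice_seqcont.
Qed.

Lemma niceD n (f g : 'rV[R]_n -> R) : nice f -> nice g -> nice (fun x => f x + g x).
Proof.
move=> [cf [c [d [d0 fb]]]] [cg [c' [d' [d0' gb']]]]; split; first exact: seqcontD.
exists (c + c'), (Num.min d d'); split; first by rewrite lt_min d0.
move=> x; rewrite (le_trans (ler_normD _ _)) // mulrDl lerD //.
  apply: le_trans (fb x) _; rewrite ler_wpM2l ?(gb_ge0 fb) // ler_expR lerN2.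
  by rewrite ler_wpM2r ?sqn_ge0 // ge_min lexx.
apply: le_trans (gb' x) _; rewrite ler_wpM2l ?(gb_ge0 gb') // ler_expR lerN2.
by rewrite ler_wpM2r ?sqn_ge0 // ge_min lexx orbT.
Qed.

Lemma niceZ n a (f : 'rV[R]_n -> R) : nice f -> nice (fun x => a * f x).
Proof.
move=> [cf [c [d [d0 fb]]]]; split; first by apply: seqcontM => //; exact: seqcont_cst.
exists (`|a| * c), d; split => // x.
by rewrite normrM -mulrA ler_wpM2l.
Qed.

Lemma nice0 n : nice (fun _ : 'rV[R]_n => 0).
Proof.
split; first exact: seqcont_cst.
by exists 0, 1; split => // x; rewrite normr0 mul0r.
Qed.

Lemma nice_sum n (J : Type) (r : seq J) (f : J -> 'rV[R]_n -> R) :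
  (forall i, nice (f i)) -> nice (fun x => \sum_(i <- r) f i x).
Proof.
move=> nf; elim: r => [|i r IH].
  by under eq_fun do rewrite big_nil; exact: nice0.
by under eq_fun do rewrite big_cons; exact: niceD.
Qed.

Lemma iintD n (f g : 'rV[R]_n -> R) : nice f -> nice g ->
  iint (fun x => f x + g x) = iint f + iint g.
Proof.
elim: n f g => [//|n IH] f g nf ng; rewrite !iintS.
rewrite -[RHS]RintegralD //; try exact: iint_slice_integrable.
apply: eq_Rintegral => x _; apply: IH; exact: nice_slice.
Qed.

Lemma iintZ n a (f : 'rV[R]_n -> R) : nice f ->
  iint (fun x => a * f x) = a * iint f.
Proof.
elim: n f => [//|n IH] f nf; rewrite !iintS.
rewrite -[RHS]RintegralZl //; try exact: iint_slice_integrable.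
apply: eq_Rintegral => x _; apply: IH; exact: nice_slice.
Qed.

Lemma iint0 n : iint (fun _ : 'rV[R]_n => 0) = 0.
Proof.
rewrite -[RHS](mul0r (iint (fun _ : 'rV[R]_n => 0))) -iintZ; last exact: nice0.
by under [in RHS]eq_fun do rewrite mul0r.
Qed.

Lemma iint_sum n (J : Type) (r : seq J) (f : J -> 'rV[R]_n -> R) :
  (forall i, nice (f i)) ->
  iint (fun x => \sum_(i <- r) f i x) = \sum_(i <- r) iint (f i).
Proof.
move=> nf; elim: r => [|i r IH].
  by under eq_fun do rewrite big_nil; rewrite iint0 big_nil.
under eq_fun do rewrite big_cons.
by rewrite iintD ?IH ?big_cons //; exact: nice_sum.
Qed.

End IteratedIntegral.

(** * Fubini, changes of variable and integrals of derivatives *)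

Section Symmetries.
Context {R : realType}.

(** The extra variable moves from the outermost to the innermost place by one two-dimensional Fubini
    per coordinate. *)
Lemma int1_iint n c d (G : R -> 'rV[R]_n -> R) : 0 < d ->
  (forall (u : nat -> R) x v w, u m @[m --> \oo] --> x -> cvgrow v w ->
     G (u m) (v m) @[m --> \oo] --> G x w) ->
  (forall x v, `|G x v| <= gauss1 c d x * expR (- (d * sqn v))) ->
  int1 (fun x => iint (G x)) = iint (fun v => int1 (G ^~ v)).
Proof.
elim: n c G => [//|n IH] c G d0 cG Gb; rewrite iintS.
have c0 : 0 <= c.
  have := le_trans (normr_ge0 _) (Gb 0 0).
  by rewrite pmulr_lge0 ?expR_gt0 // /gauss1 pmulr_lge0 // expR_gt0.
have g0 x : 0 <= gauss1 c d x by rewrite mulr_ge0 ?expR_ge0.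
have Gbx x : gb (gauss1 c d x) d (G x) by move=> v; exact: Gb.
have cGx x : seqcont (G x) by move=> u w uw; apply: cG => //; exact: cvg_cst.
have le1 x : expR (- (d * x ^+ 2)) <= 1.
  by rewrite -expR0 ler_expR oppr_le0 mulr_ge0 ?sqr_ge0 // ltW.
transitivity (int1 (fun x => int1 (fun z => iint (fun v => G x (ins ord0 z v))))).
  by [].
(* Each of the n coordinates still integrated inside contributes one Gaussian integral to the bound
   in the two outer variables. *)
rewrite (int1_fubini (c := c * int1 (gauss1 1 d) ^+ n) d0).
- apply: eq_Rintegral => z _.
  apply: (IH (gauss1 c d z)) => //.
  + by move=> u x v w ux vw; apply: cG => //; apply: cvgrow_ins => //; exact: cvg_cst.
  + move=> x v; apply: le_trans (Gb _ _) _.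
    by rewrite sqn_ins mulrDr opprD expRD mulrA /gauss1 [c * _ * _]mulrAC.
- move=> u v x z ux vz; apply: (iint_dominated (c := c) d0).
  + by move=> m; exact: seqcont_slice.
  + move=> m w; apply: le_trans (gb_slice ord0 (v m) (Gbx (u m)) w) _.
    rewrite ler_wpM2r ?expR_ge0 // /gauss1.
    by rewrite -mulrA ler_piMr // mulr_ile1 ?expR_ge0.
  + by move=> w; apply: cG => //; apply: cvgrow_ins => //; exact: cvgrow_cst.
- move=> x z; have := iint_le d0 (seqcont_slice (j := ord0) (x := z) (cGx x))
    (gb_slice ord0 z (Gbx x)).
  by move=> /le_trans; apply; rewrite /gauss1 !(mulrAC _ _ (_ ^+ n)).
Qed.

(** Lets a one-dimensional substitution act on any chosen coordinate while the others are frozen. *)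
Lemma iint_innermost n (j : 'I_n.+1) (f : 'rV[R]_n.+1 -> R) : nice f ->
  iint f = iint (fun v => int1 (fun x => f (ins j x v))).
Proof.
elim: n j f => [|n IH] j f nf; have [cf [c [d [d0 fb]]]] := nf.
  by rewrite (ord1 j).
have [j' ->|->] := unliftP ord0 j; last first.
  rewrite [LHS]iintS; apply: (int1_iint (c := c) d0).
  - by move=> u x v w ux vw; apply: cf; exact: cvgrow_ins.
  - move=> x v; apply: le_trans (fb _) _.
    by rewrite sqn_ins /gauss1 mulrDr opprD expRD mulrA.
rewrite [LHS]iintS [RHS]iintS; apply: eq_Rintegral => z _.
rewrite (IH j'); last exact: nice_slice.
by congr iint; apply/funext => v; congr int1; apply/funext => x; rewrite ins_insC.
Qed.

Lemma iint_outermost n (j : 'I_n.+1) (f : 'rV[R]_n.+1 -> R) : nice f ->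
  iint f = int1 (fun x => iint (fun v => f (ins j x v))).
Proof.
move=> nf; have [cf [c [d [d0 fb]]]] := nf.
rewrite (iint_innermost j nf); apply/esym/(int1_iint (c := c) d0).
- by move=> u x v w ux vw; apply: cf; exact: cvgrow_ins.
- move=> x v; apply: le_trans (fb _) _.
  by rewrite sqn_ins /gauss1 mulrDr opprD expRD mulrA.
Qed.

Lemma nice_translate n w (f : 'rV[R]_n -> R) : nice f -> nice (fun x => f (x + w)).
Proof.
move=> [cf [c [d [d0 fb]]]]; split.
  by move=> u x ux; apply: cf; apply: cvgrowD => //; exact: cvgrow_cst.
exists (c * expR (d * sqn w)), (d / 2); split; first by rewrite divr_gt0.
move=> x; apply: le_trans (fb _) _.
rewrite -mulrA ler_wpM2l ?(gb_ge0 fb) // -expRD ler_expR.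
have := ler_wpM2l (ltW d0) (sqnD_ge x w).
lra.
Qed.

Lemma iint_translate n w (f : 'rV[R]_n -> R) : nice f ->
  iint (fun x => f (x + w)) = iint f.
Proof.
elim: n w f => [|n IH] w f nf.
  by rewrite /=; congr f; rewrite [LHS]thinmx0.
rewrite (ins_surj ord0 w) !iintS.
have [c [d [d0 fb]]] := iint_slice_gauss1 ord0 nf.
have := int1_affine (w 0 ord0) (oner_neq0 _) d0
  (seqcont1_measurable (iint_slice_seqcont (j := ord0) nf)) fb.
rewrite normr1 mul1r => <-; apply: eq_Rintegral => x _.
under eq_fun do rewrite insD.
rewrite (IH _ (fun v => f (ins ord0 (x + w 0 ord0) v))); last exact: nice_slice.
by rewrite mul1r.
Qed.

Lemma nice_scale n (s : R) (f : 'rV[R]_n -> R) : 0 < s -> nice f ->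
  nice (fun x => f (s *: x)).
Proof.
move=> s0 [cf [c [d [d0 fb]]]]; split.
  by move=> u x ux; apply: cf; apply: cvgrowZ => //; exact: cvg_cst.
exists c, (d * s ^+ 2); split; first by rewrite mulr_gt0 // exprn_gt0.
by move=> x; rewrite -mulrA -sqnZ; exact: fb.
Qed.

Lemma iint_scale n (s : R) (f : 'rV[R]_n -> R) : 0 < s -> nice f ->
  s ^+ n * iint (fun x => f (s *: x)) = iint f.
Proof.
move=> s0; elim: n f => [|n IH] f nf.
  by rewrite expr0 mul1r /=; congr f; rewrite [LHS]thinmx0.
rewrite !iintS.
have [c [d [d0 fb]]] := iint_slice_gauss1 ord0 nf.
have := int1_affine (0) (lt0r_neq0 s0) d0
  (seqcont1_measurable (iint_slice_seqcont (j := ord0) nf)) fb.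
rewrite gtr0_norm // => <-; rewrite exprS -mulrA; congr (_ * _).
have nfs := nice_scale s0 nf.
rewrite -[LHS]RintegralZl //; last exact: (iint_slice_integrable ord0 nfs).
apply: eq_Rintegral => x _.
under eq_fun do rewrite insZ.
by rewrite (IH (fun v => f (ins ord0 (s * x) v))) ?addr0 //; exact: nice_slice.
Qed.

Lemma iint_ge0 n (f : 'rV[R]_n -> R) : (forall x, 0 <= f x) -> 0 <= iint f.
Proof.
elim: n f => [|n IH] f f0; first exact: f0.
by apply: Rintegral_ge0 => x _; apply: IH.
Qed.

Lemma iint_gt0 n (f : 'rV[R]_n -> R) x : nice f -> (forall y, 0 <= f y) ->
  0 < f x -> 0 < iint f.
Proof.
elim: n f x => [|n IH] f x nf f0 fx.
  by move: fx; rewrite [x]thinmx0.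
have [c [d [d0 fb]]] := iint_slice_gauss1 ord0 nf.
apply: (int1_gt0 d0 (iint_slice_seqcont (j := ord0) nf) fb (x := x 0 ord0)).
  by move=> y; exact: iint_ge0.
apply: (IH _ (\row_i x 0 (lift ord0 i))) => //; first exact: nice_slice.
by rewrite -ins_surj.
Qed.

(** The difference quotients of [f] integrate to 0 by translation invariance. The mean value theorem
    writes them as values of [f'] at nearby points, which gives both a common Gaussian bound and the
    pointwise limit [f']. *)
Lemma iint_derive n (j : 'I_n) (f f' : 'rV[R]_n -> R) : nice f -> nice f' ->
  (forall x (s : R), is_derive s 1 (fun s => f (x + s *: ebasis R j))
     (f' (x + s *: ebasis R j))) ->
  iint f' = 0.
Proof.
move=> nf [cf' [c [d [d0 fb']]]] df.
pose e := ebasis R j; pose s (m : nat) : R := m.+1%:R^-1.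
have s0 m : 0 < s m by rewrite invr_gt0.
have s1 m : s m <= 1 by rewrite invf_le1 ?ler1n // ltr0n.
pose h m x := (s m)^-1 * (f (x + s m *: e) - f x).
have hE m x : exists xi : R, 0 < xi < s m /\ h m x = f' (x + xi *: e).
  have dr (r : R) : r \in `]0, s m[ -> is_derive r 1 (fun s => f (x + s *: e)) (f' (x + r *: e)).
    by move=> _; exact: df.
  have cr : {within `[0, s m], continuous (fun s => f (x + s *: e))}.
    apply: derivable_within_continuous => r _.
    by have := df x r; case.
  have [xi xis E] := MVT (s0 m) dr cr.
  exists xi; split; first by move: xis; rewrite in_itv.
  rewrite /h; move: E; rewrite scale0r addr0 subr0 => ->.
  by rewrite mulrC mulfK // gt_eqF.
(* As 0 < xi < 1 and [e] is a unit vector, |x + xi e|^2 >= |x|^2 / 2 - 1. *)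
have hb m : gb (c * expR d) (d / 2) (h m).
  move=> x; have [xi [/andP[xi0 xis] ->]] := hE m x.
  apply: le_trans (fb' _) _.
  rewrite -mulrA ler_wpM2l ?(gb_ge0 fb') // -expRD ler_expR.
  have := ler_wpM2l (ltW d0) (sqnD_ge x (xi *: e)).
  rewrite sqnZ sqn_ebasis mulr1 => h1.
  have xi1 : xi ^+ 2 <= 1.
    by rewrite expr_le1 // ?ltW // (lt_le_trans xis).
  have := ler_wpM2l (ltW d0) xi1.
  lra.
have nfm m : nice (fun x => f (x + s m *: e)) by exact: nice_translate.
have nNf : nice (fun x => -1 * f x) by exact: niceZ.
have nh m : nice (h m).
  rewrite (_ : h m = fun x => (s m)^-1 * (f (x + s m *: e) + -1 * f x)).
    by apply: niceZ; exact: niceD.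
  by apply/funext => x; rewrite /h mulN1r.
have h0 m : iint (h m) = 0.
  rewrite (_ : h m = fun x => (s m)^-1 * (f (x + s m *: e) + -1 * f x)).
    rewrite iintZ; last exact: niceD.
    by rewrite iintD // iintZ // iint_translate // mulN1r subrr mulr0.
  by apply/funext => x; rewrite /h mulN1r.
have hf' x : h m x @[m --> \oo] --> f' x.
  have /(_ _) /cid - /all_sig [xi xiP] := hE ^~ x.
  have -> : (fun m => h m x) = (fun m => f' (x + xi m *: e)).
    by apply/funext => m; case: (xiP m).
  apply: cf'; rewrite -[X in cvgrow _ X]addr0; apply: cvgrowD; first exact: cvgrow_cst.
  rewrite -[0](scale0r e); apply: cvgrowZ; last exact: cvgrow_cst.
  apply: (@squeeze_cvgr _ _ _ _ (fun=> 0) s).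
  - by apply: nearW => m; case: (xiP m) => /andP[/ltW -> /ltW ->].
  - exact: cvg_cst.
  - exact: cvg_harmonic.
have := iint_dominated (divr_gt0 d0 (ltr0Sn _ 1)) (fun m => (nh m).1) hb hf'.
under eq_fun do rewrite h0.
move=> /cvg_lim <- //; by rewrite lim_cst.
Qed.

Lemma dot_refl n (a x y : 'rV[R]_n) : dot a a = 2 ->
  dot (refl a x) (refl a y) = dot x y.
Proof.
move=> a2; rewrite /refl a2 !(dotDl, dotDr, dotNl, dotNr, dotZl, dotZr) a2 (dotC x a).
by field.
Qed.

Lemma sqn_refl n (a x : 'rV[R]_n) : dot a a = 2 -> sqn (refl a x) = sqn x.
Proof. exact: dot_refl. Qed.

Lemma seqcont_refl n (a : 'rV[R]_n) u x : cvgrow u x ->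
  cvgrow (fun m => refl a (u m)) (refl a x).
Proof.
move=> ux; rewrite /refl; apply: cvgrowD => //.
have -> : (fun m => - ((2 * dot a (u m) / dot a a) *: a)) =
    (fun m => - (2 * dot a (u m) / dot a a) *: a) by apply/funext => m; rewrite scaleNr.
rewrite -scaleNr; apply: cvgrowZ; last exact: cvgrow_cst.
apply: cvgN; apply: cvgMl; apply: cvgMr; exact: seqcont_dot.
Qed.

Lemma nice_refl n (a : 'rV[R]_n) f : dot a a = 2 -> nice f ->
  nice (fun x => f (refl a x)).
Proof.
move=> a2 [cf [c [d [d0 fb]]]]; split.
  by move=> u x ux; apply: cf; exact: seqcont_refl.
by exists c, d; split => // x; rewrite -(sqn_refl x a2); exact: fb.
Qed.

Lemma CauchySchwarz2 n (a x : 'rV[R]_n) : dot a a = 2 -> dot a x ^+ 2 <= 2 * sqn x.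
Proof.
move=> a2; have := sqn_ge0 (2 *: x - dot a x *: a).
rewrite /sqn !(dotDl, dotDr, dotNl, dotNr, dotZl, dotZr) a2 (dotC x a); lra.
Qed.

(* In the coordinates (<a,x>, x_i for i != j), the reflection is the flip of the
   first coordinate followed by translations of the others. *)
Lemma iint_refl n (a : 'rV[R]_n) f : dot a a = 2 -> nice f ->
  iint (fun x => f (refl a x)) = iint f.
Proof.
case: n a f => [|n] a f a2 nf.
  by move: a2; rewrite /dot big_ord0 => /eqP; rewrite eq_sym pnatr_eq0.
have [j aj] : exists j, a 0 j != 0.
  apply/existsP; rewrite -[X in is_true X]negbK negb_exists; apply/negP => /forallP h.
  move: a2; rewrite /dot big1 => [/eqP|i _]; first by rewrite eq_sym pnatr_eq0.
  by have := h i; rewrite negbK => /eqP ->; rewrite mul0r.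
pose a' := \row_i a 0 (lift j i).
have aE : a = ins j (a 0 j) a' by exact: ins_surj.
(* The inverse change of coordinates: [Si (ins j u v)] is the point x with <a,x> = u whose
   coordinates other than [j] are v. *)
pose Si (y : 'rV[R]_n.+1) : 'rV[R]_n.+1 :=
  ins j ((y 0 j - dot a' (\row_i y 0 (lift j i))) / a 0 j) (\row_i y 0 (lift j i)).
have SiE u v : Si (ins j u v) = ins j ((u - dot a' v) / a 0 j) v.
  have vE : \row_i ins j u v 0 (lift j i) = v.
    by apply/rowP => i; rewrite mxE ins_lift.
  by rewrite /Si ins_eq vE.
have nSi g : nice g -> nice (fun y => g (Si y)).
  move=> [cg [c [d [d0 gb']]]]; split.
    move=> u x ux; apply: cg; apply: cvgrow_ins; last first.
      by move=> i; under eq_fun do rewrite mxE; rewrite mxE; exact: ux.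
    apply: cvgMl; apply: cvgB; first exact: ux.
    apply: seqcont_dot => i; under eq_fun do rewrite mxE; rewrite mxE; exact: ux.
  (* For x = Si y one has |y|^2 = <a,x>^2 + |v|^2 <= 2 |x|^2 + |x|^2, hence the 3. *)
  exists c, (d / 3); split; first by rewrite divr_gt0.
  move=> y; apply: le_trans (gb' _) _; rewrite ler_wpM2l ?(gb_ge0 gb') // ler_expR lerN2.
  rewrite -mulrA ler_wpM2l ?(ltW d0) // mulrC ler_pdivrMr //.
  rewrite (ins_surj j y) SiE; set u := y 0 j; set v := \row_i _.
  set x := ins j (_ / _) v.
  have uE : u = dot a x.
    by rewrite [X in dot X _]aE /x dot_ins mulrCA divff // mulr1 subrK.
  have := CauchySchwarz2 x a2; rewrite -uE.
  have : sqn v <= sqn x by rewrite [sqn x]sqn_ins lerDr sqr_ge0.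
  rewrite [sqn (ins j u v)]sqn_ins; lra.
(* Only coordinate [j] is changed, affinely for fixed v, so a one-dimensional substitution produces
   the Jacobian factor. *)
have key g : nice g -> `|a 0 j| * iint g = iint (fun y => g (Si y)).
  move=> ng; rewrite (iint_innermost j ng) (iint_innermost j (nSi _ ng)).
  rewrite -iintZ; last first.
    have [cg [c [d [d0 gb']]]] := ng; split.
      move=> u x ux; apply: (int1_dominated (c := c) d0).
      - move=> m; apply: seqcont1_measurable => v z vz; apply: cg.
        by apply: cvgrow_ins => //; exact: cvgrow_cst.
      - move=> m z; apply: le_trans (gb' _) _; rewrite sqn_ins mulrDr opprD expRD mulrA.
        rewrite /gauss1 ler_piMr ?mulr_ge0 ?(gb_ge0 gb') ?expR_ge0 //.
        by rewrite -expR0 ler_expR oppr_le0 mulr_ge0 ?sqn_ge0 // ltW.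
      - by move=> z; apply: cg; apply: cvgrow_ins => //; exact: cvg_cst.
    exists (c * int1 (gauss1 1 d)), d; split => // v.
    rewrite mulrAC; apply: le_int1_gauss1 => //.
      apply: seqcont1_measurable => u z uz; apply: cg.
      by apply: cvgrow_ins => //; exact: cvgrow_cst.
    move=> z; apply: le_trans (gb' _) _.
    by rewrite sqn_ins /gauss1 mulrDr opprD expRD mulrA mulrAC.
  congr iint; apply/funext => v.
  have ngv : nice (fun x => g (Si x)) by exact: nSi.
  have [cs [c [d [d0 gbs]]]] := ngv.
  have sb x : `|g (Si (ins j x v))| <= gauss1 c d x.
    apply: le_trans (gbs _) _; rewrite sqn_ins mulrDr opprD expRD mulrA.
    rewrite /gauss1 ler_piMr ?mulr_ge0 ?(gb_ge0 gbs) ?expR_ge0 //.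
    by rewrite -expR0 ler_expR oppr_le0 mulr_ge0 ?sqn_ge0 // ltW.
  rewrite -(int1_affine (dot a' v) aj d0 _ sb); last first.
    apply: seqcont1_measurable => u z uz; apply: cs.
    by apply: cvgrow_ins => //; exact: cvgrow_cst.
  congr (_ * _); congr int1; apply/funext => x.
  by rewrite SiE addrK mulrC mulKf.
have nfs := nice_refl a2 nf.
apply: (@mulfI _ `|a 0 j|); first by rewrite normr_eq0.
rewrite (key _ nf) (key _ nfs).
rewrite (iint_outermost j (nSi _ nf)) (iint_outermost j (nSi _ nfs)).
have [c [d [d0 gb']]] := iint_slice_gauss1 j (nSi _ nf).
have := int1_affine (0) (_ : -1 != 0) d0
  (seqcont1_measurable (iint_slice_seqcont (j := j) (nSi _ nf))) gb'.
rewrite oppr_eq0 oner_eq0 normrN1 mul1r => <- //; congr int1; apply/funext => u.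
rewrite addr0 mulN1r.
(* Where <a,x> = u the reflection subtracts u a, which shifts the remaining coordinates by - u
   a'. *)
rewrite -[RHS](iint_translate (- (u *: a'))); last first.
  exact: (nice_slice j (- u) (nSi _ nf)).
congr iint; apply/funext => v; congr f; rewrite !SiE.
rewrite [in LHS]/refl a2; set x := ins j (_ / _) v.
have uE : dot a x = u.
  by rewrite [X in dot X _]aE /x dot_ins mulrCA divff // mulr1 subrK.
rewrite uE mulrC mulKf ?pnatr_eq0 //.
have a'2 : dot a' a' = 2 - a 0 j ^+ 2.
  by have := a2; rewrite [X in dot X X]aE dot_ins -expr2 => <-; rewrite [a 0 j ^+ 2 + _]addrC addrK.
rewrite /x [X in _ - _ *: X]aE -scaleN1r scalerA insZ insD mulN1r scaleNr.
congr ins; rewrite dotDr dotNr dotZr a'2; field.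
by [].
Qed.

End Symmetries.

(** * Derivatives along coordinate lines *)

Section PartialDerivatives.
Context {R : realType} {N : nat}.
Implicit Types (p q f g : 'rV[R]_N -> R) (i j : 'I_N) (x : 'rV[R]_N).

Definition pd i p : 'rV[R]_N -> R := fun x => 'D_(ebasis R i) p x.

(** Derivability at every parameter of every coordinate line: one-variable calculus suffices, and
    [iint_derive] takes its hypothesis in this form. *)
Definition dirder i f g := forall x (s : R),
  is_derive s 1 (fun s => f (x + s *: ebasis R i)) (g (x + s *: ebasis R i)).

Lemma dirder_pd i f g : dirder i f g -> pd i f = g.
Proof.
move=> df; apply/funext => x; rewrite /pd.
have [_] := df x 0; rewrite scale0r addr0 => <-.
have E : (fun h : R => h^-1 *: ((f \o shift x) (h *: ebasis R i) - f x)) =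
    (fun h : R => h^-1 *: (((fun s => f (x + s *: ebasis R i)) \o shift 0) (h *: 1)
       - f (x + 0 *: ebasis R i))).
  apply/funext => h /=; rewrite scale0r !addr0.
  by rewrite [x + _]addrC /GRing.scale /= mulr1.
by rewrite /derive E.
Qed.

Lemma dirder_cst i c : dirder i (fun=> c) (fun=> 0).
Proof. by move=> x s; exact: is_derive_cst. Qed.

Lemma dirder_inv i f : (forall x s, f (x + s *: ebasis R i) = f x) ->
  dirder i f (fun=> 0).
Proof. by move=> fi x s; under eq_fun do rewrite fi; exact: is_derive_cst. Qed.

Lemma dirder_coord i j : dirder i (fun x => x 0 j) (fun=> (j == i)%:R).
Proof.
move=> x s.
have -> : (fun s => (x + s *: ebasis R i) 0 j) =
    (fun=> x 0 j) + (fun s : R => s) * (fun=> (j == i)%:R).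
  by apply/funext => r; rewrite !mxE /=.
have h1 : is_derive s 1 (fun=> x 0 j : R) 0 by exact: is_derive_cst.
have h2 : is_derive s 1 (fun r : R => r) 1 by exact: is_derive_id.
have h3 : is_derive s 1 (fun=> (j == i)%:R : R) 0 by exact: is_derive_cst.
apply: (is_derive_eq (is_deriveD h1 (is_deriveM h2 h3))).
by rewrite /GRing.scale /= mulr0 !add0r mulr1.
Qed.

Lemma dirderD i f g f' g' : dirder i f f' -> dirder i g g' ->
  dirder i (fun x => f x + g x) (fun x => f' x + g' x).
Proof. by move=> df dg x s; exact: is_deriveD (df x s) (dg x s). Qed.

Lemma dirderM i f g f' g' : dirder i f f' -> dirder i g g' ->
  dirder i (fun x => f x * g x) (fun x => f' x * g x + f x * g' x).
Proof.
move=> df dg x s; apply: is_derive_eq; first exact: is_deriveM (df x s) (dg x s).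
by rewrite addrC /GRing.scale /= [X in X + _]mulrC.
Qed.

Lemma dirderZ i c f f' : dirder i f f' ->
  dirder i (fun x => c * f x) (fun x => c * f' x).
Proof.
move=> df; have := dirderM (dirder_cst i c) df.
by congr dirder; apply/funext => x; rewrite mul0r add0r.
Qed.

Lemma dirder_sum i (J : Type) (r : seq J) (f f' : J -> 'rV[R]_N -> R) :
  (forall a, dirder i (f a) (f' a)) ->
  dirder i (fun x => \sum_(a <- r) f a x) (fun x => \sum_(a <- r) f' a x).
Proof.
move=> df; elim: r => [|a r IH].
  rewrite (_ : (fun x => _) = fun=> 0); last by apply/funext => x; rewrite big_nil.
  rewrite (_ : (fun x => \sum_(a <- [::]) f' a x) = fun=> 0); first exact: dirder_cst.
  by apply/funext => x; rewrite big_nil.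
rewrite (_ : (fun x => _) = fun x => f a x + \sum_(b <- r) f b x); last first.
  by apply/funext => x; rewrite big_cons.
rewrite (_ : (fun x => \sum_(b <- a :: r) f' b x) = fun x => f' a x + \sum_(b <- r) f' b x).
  exact: dirderD.
by apply/funext => x; rewrite big_cons.
Qed.

Lemma dirder_comp i (phi phi' : R -> R) f f' :
  (forall x, is_derive (f x) 1 phi (phi' (f x))) -> dirder i f f' ->
  dirder i (fun x => phi (f x)) (fun x => phi' (f x) * f' x).
Proof.
move=> dphi df x s.
exact: (@is_derive1_comp _ phi _ s _ _ (dphi (x + s *: ebasis R i)) (df x s)).
Qed.

Lemma dirder_expR i f f' : dirder i f f' ->
  dirder i (fun x => expR (f x)) (fun x => expR (f x) * f' x).
Proof. by apply: dirder_comp => x; exact: is_derive_expR. Qed.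

Lemma dirder_X i n f f' : dirder i f f' ->
  dirder i (fun x => f x ^+ n) (fun x => n%:R * f x ^+ n.-1 * f' x).
Proof.
move=> df; elim: n => [|n IH].
  rewrite (_ : (fun x => _) = fun=> 1) // (_ : (fun x => _ * f' x) = fun=> 0).
    exact: dirder_cst.
  by apply/funext => x; rewrite !mul0r.
have := dirderM df IH.
rewrite (_ : (fun x => f x * f x ^+ n) = fun x => f x ^+ n.+1); last first.
  by apply/funext => x; rewrite exprS.
congr dirder; apply/funext => x /=.
case: n {IH} => [|n] /=; first by rewrite expr0; ring.
by rewrite !exprS -!natr1; ring.
Qed.

Lemma dirder_dot i a : dirder i (dot a) (fun=> a 0 i).
Proof.
rewrite /dot.
have := dirder_sum (index_enum 'I_N) (fun j => dirderZ (a 0 j) (dirder_coord i j)).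
congr dirder; apply/funext => x.
by rewrite (bigD1 i) //= eqxx mulr1 big1 ?addr0 // => j /negbTE ->; rewrite mulr0.
Qed.

Lemma dirder_sqn i : dirder i (@sqn R N) (fun x => 2 * x 0 i).
Proof.
rewrite /sqn /dot.
have := dirder_sum (index_enum 'I_N)
  (fun j => dirderM (dirder_coord i j) (dirder_coord i j)).
congr dirder; apply/funext => x.
rewrite (bigD1 i) //= eqxx mulr1 mul1r big1; first by ring.
by move=> j /negbTE ->; rewrite mul0r mulr0 addr0.
Qed.

End PartialDerivatives.

(** * Polynomial functions, homogeneity, independence of monomials *)

Section PolynomialFunctions.
Context {R : realType} {N : nat}.
Implicit Types (p q f g : 'rV[R]_N -> R) (i j : 'I_N) (x : 'rV[R]_N) (m : mi N).

(** Generation by constants and coordinates turns closure properties and identities into structural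
    inductions; [polyf_is_poly] leads back to the coefficient form in which the intertwiner is
    specified. *)
Inductive polyf : ('rV[R]_N -> R) -> Prop :=
| polyf_cst c : polyf (fun=> c)
| polyf_coord i : polyf (fun x => x 0 i)
| polyfD p q : polyf p -> polyf q -> polyf (fun x => p x + q x)
| polyfM p q : polyf p -> polyf q -> polyf (fun x => p x * q x).

Lemma polyf_eq p q : polyf p -> p = q -> polyf q.
Proof. by move=> ? <-. Qed.

Lemma polyfZ c p : polyf p -> polyf (fun x => c * p x).
Proof. by move=> ?; apply: polyfM => //; exact: polyf_cst. Qed.

Lemma polyfB p q : polyf p -> polyf q -> polyf (fun x => p x - q x).
Proof.
move=> pp pq; apply: (polyf_eq (polyfD pp (polyfZ (-1) pq))).
by apply/funext => x; rewrite mulN1r.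
Qed.

Lemma polyf_sum (J : Type) (r : seq J) (P : pred J) (f : J -> 'rV[R]_N -> R) :
  (forall a, polyf (f a)) -> polyf (fun x => \sum_(a <- r | P a) f a x).
Proof.
move=> pf; elim: r => [|a r IH].
  by apply: (polyf_eq (polyf_cst 0)); apply/funext => x; rewrite big_nil.
apply: (polyf_eq (polyfD (polyfZ (P a)%:R (pf a)) IH)).
by apply/funext => x; rewrite big_cons; case: (P a); rewrite ?mul1r ?mul0r ?add0r.
Qed.

Lemma polyf_prod (J : Type) (r : seq J) (f : J -> 'rV[R]_N -> R) :
  (forall a, polyf (f a)) -> polyf (fun x => \prod_(a <- r) f a x).
Proof.
move=> pf; elim: r => [|a r IH].
  by apply: (polyf_eq (polyf_cst 1)); apply/funext => x; rewrite big_nil.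
by apply: (polyf_eq (polyfM (pf a) IH)); apply/funext => x; rewrite big_cons.
Qed.

Lemma polyfX n p : polyf p -> polyf (fun x => p x ^+ n).
Proof.
move=> pp; elim: n => [|n IH]; first exact: polyf_cst.
by apply: (polyf_eq (polyfM pp IH)); apply/funext => x; rewrite exprS.
Qed.

Lemma polyf_mono m : polyf (mono m).
Proof. by apply: polyf_prod => i; exact/polyfX/polyf_coord. Qed.

Lemma polyf_dot a : polyf (dot a).
Proof. by apply: polyf_sum => i; exact/polyfZ/polyf_coord. Qed.

Lemma polyf_sqn : polyf (@sqn R N).
Proof. by apply: polyf_sum => i; apply: polyfM; exact: polyf_coord. Qed.

Lemma polyf_subst (phi : 'rV[R]_N -> 'rV[R]_N) p :
  (forall i, polyf (fun x => phi x 0 i)) -> polyf p -> polyf (fun x => p (phi x)).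
Proof.
move=> pphi; elim=> [c|i|{}p q _ IHp _ IHq|{}p q _ IHp _ IHq].
- exact: polyf_cst.
- exact: pphi.
- exact: polyfD.
- exact: polyfM.
Qed.

Lemma polyf_refl a p : polyf p -> polyf (fun x => p (refl a x)).
Proof.
apply: polyf_subst => i.
apply: (polyf_eq (polyfB (polyf_coord i) (polyfZ (2 / dot a a * a 0 i) (polyf_dot a)))).
by apply/funext => x; rewrite !mxE; ring.
Qed.

Lemma polyf_scale c p : polyf p -> polyf (fun x => p (c *: x)).
Proof.
apply: polyf_subst => i; apply: (polyf_eq (polyfZ c (polyf_coord i))).
by apply/funext => x; rewrite mxE.
Qed.

Lemma polyf_seqcont p : polyf p -> seqcont p.
Proof.
elim=> [c|i|{}p q _ IHp _ IHq|{}p q _ IHp _ IHq].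
- exact: seqcont_cst.
- exact: seqcont_coord.
- exact: seqcontD.
- exact: seqcontM.
Qed.

Lemma polyf_dirder i p : polyf p -> polyf (pd i p) /\ dirder i p (pd i p).
Proof.
move=> pp; suff [q [pq dq]] : exists q, polyf q /\ dirder i p q.
  by rewrite (dirder_pd dq).
elim: pp => [c|j|{}p q pp [p' [pp' dp]] pq [q' [pq' dq]]|{}p q pp [p' [pp' dp]] pq [q' [pq' dq]]].
- by exists (fun=> 0); split; [exact: polyf_cst|exact: dirder_cst].
- by exists (fun=> (j == i)%:R); split; [exact: polyf_cst|exact: dirder_coord].
- by exists (fun x => p' x + q' x); split; [exact: polyfD|exact: dirderD].
- exists (fun x => p' x * q x + p x * q' x); split; last exact: dirderM.
  by apply: polyfD; apply: polyfM.
Qed.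

Lemma polyf_pd i p : polyf p -> polyf (pd i p).
Proof. by move=> /(polyf_dirder i)[]. Qed.

Lemma dirder_poly i p : polyf p -> dirder i p (pd i p).
Proof. by move=> /(polyf_dirder i)[]. Qed.

Lemma pd_lin i c p q : polyf p -> polyf q ->
  pd i (fun x => c * p x + q x) = fun x => c * pd i p x + pd i q x.
Proof.
move=> pp pq; apply: dirder_pd; apply: dirderD; last exact: dirder_poly.
by apply: dirderZ; exact: dirder_poly.
Qed.

Lemma pd_sum i (J : Type) (r : seq J) (f : J -> 'rV[R]_N -> R) :
  (forall a, polyf (f a)) ->
  pd i (fun x => \sum_(a <- r) f a x) = fun x => \sum_(a <- r) pd i (f a) x.
Proof.
by move=> pf; apply: dirder_pd; apply: dirder_sum => a; exact: dirder_poly.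
Qed.

Lemma pdZ i c p : polyf p -> pd i (fun x => c * p x) = fun x => c * pd i p x.
Proof. by move=> pp; apply: dirder_pd; apply: dirderZ; exact: dirder_poly. Qed.

Lemma pd_coordM i j p : polyf p ->
  pd i (fun x => x 0 j * p x) = fun x => (j == i)%:R * p x + x 0 j * pd i p x.
Proof.
move=> pp; apply: dirder_pd; apply: dirderM; first exact: dirder_coord.
exact: dirder_poly.
Qed.

Definition mincr i m : mi N := [ffun j => (m j + (j == i))%N].
Definition mdecr i m : mi N := [ffun j => (m j - (j == i))%N].

Lemma mono_incr i m x : mono (mincr i m) x = x 0 i * mono m x.
Proof.
rewrite /mono (bigD1 i) //= [in RHS](bigD1 i) //= ffunE eqxx addn1 exprS -mulrA.
by congr (_ * (_ * _)); apply: eq_bigr => j /negbTE ji; rewrite ffunE ji addn0.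
Qed.

Lemma mincrK i m : mdecr i (mincr i m) = m.
Proof. by apply/ffunP => j; rewrite !ffunE addnK. Qed.

Lemma mdecrK i m : (0 < m i)%N -> mincr i (mdecr i m) = m.
Proof.
move=> mi0; apply/ffunP => j; rewrite !ffunE; have [->|_] := eqVneq j i.
  by rewrite subnK.
by rewrite subn0 addn0.
Qed.

Lemma mabs_incr i m : mabs (mincr i m) = (mabs m).+1.
Proof.
rewrite /mabs (bigD1 i) //= [in RHS](bigD1 i) //= ffunE eqxx addn1 addSn.
by congr (_ + _).+1%N; apply: eq_bigr => j /negbTE ji; rewrite ffunE ji addn0.
Qed.

Lemma mfact_incr i m : mfact (mincr i m) = ((m i).+1 * mfact m)%N.
Proof.
rewrite /mfact (bigD1 i) //= [in RHS](bigD1 i) //= ffunE eqxx addn1 factS mulnA.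
by congr (_ * _)%N; apply: eq_bigr => j /negbTE ji; rewrite ffunE ji addn0.
Qed.

Lemma dirder_mono i m : dirder i (mono m) (fun x => (m i)%:R * mono (mdecr i m) x).
Proof.
pose r x := \prod_(j < N | j != i) (x : 'rV[R]_N) 0 j ^+ m j.
have dr : dirder i r (fun=> 0).
  apply: dirder_inv => x s; apply: eq_bigr => j ji.
  by rewrite !mxE /= (negbTE ji) mulr0 addr0.
have := dirderM (dirder_X (m i) (dirder_coord i i)) dr.
have -> : mono m = fun x => x 0 i ^+ m i * r x.
  by apply/funext => x; rewrite /mono (bigD1 i).
congr dirder; apply/funext => x; rewrite mulr0 addr0 eqxx mulr1 -mulrA.
congr (_ * _); rewrite /mono [in RHS](bigD1 i) //= ffunE eqxx subn1; congr (_ * _).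
by apply: eq_bigr => j /negbTE ji; rewrite ffunE ji subn0.
Qed.

Lemma pd_mono i m : pd i (mono m) = fun x => (m i)%:R * mono (mdecr i m) x.
Proof. exact/dirder_pd/dirder_mono. Qed.

Lemma mono0 : @mono R N [ffun=> 0%N] = fun=> 1.
Proof. by apply/funext => x; rewrite /mono big1 // => i _; rewrite ffunE. Qed.

Lemma mabs0 : mabs ([ffun=> 0%N] : mi N) = 0%N.
Proof. by rewrite /mabs big1 // => i _; rewrite ffunE. Qed.

Lemma mabs_eq0 m : mabs m = 0%N -> m = [ffun=> 0%N].
Proof.
move=> /eqP; rewrite sum_nat_eq0 => /forallP h.
by apply/ffunP => i; rewrite ffunE; exact/eqP/h.
Qed.

Lemma mabs_ge m i : (m i <= mabs m)%N.
Proof. by rewrite /mabs (bigD1 i) //= leq_addr. Qed.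

Lemma mi_ind (P : mi N -> Prop) : P [ffun=> 0%N] ->
  (forall i m, P m -> P (mincr i m)) -> forall m, P m.
Proof.
move=> P0 PS m; move: {2}(mabs m) (erefl (mabs m)) => n; elim: n m => [|n IH] m mn.
  by rewrite (mabs_eq0 mn).
have [i mi0] : exists i, (0 < m i)%N.
  apply/existsP; rewrite -[X in is_true X]negbK negb_exists; apply/negP => /forallP h.
  move: mn; rewrite /mabs big1 // => i _.
  by have := h i; rewrite -eqn0Ngt => /eqP.
rewrite -(mdecrK mi0); apply: PS; apply: IH; apply: succn_inj.
by rewrite -(mabs_incr i) mdecrK.
Qed.

Lemma pd_comm i j p : polyf p -> pd i (pd j p) = pd j (pd i p).
Proof.
elim=> [c|l|{}p q pp IHp pq IHq|{}p q pp IHp pq IHq].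
- by rewrite !(dirder_pd (dirder_cst _ _)).
- by rewrite !(dirder_pd (dirder_coord _ _)) !(dirder_pd (dirder_cst _ _)).
- have E k : pd k (fun x => p x + q x) = fun x => pd k p x + pd k q x.
    by apply: dirder_pd; apply: dirderD; exact: dirder_poly.
  rewrite !E; have E' k l : pd k (fun x => pd l p x + pd l q x) =
      fun x => pd k (pd l p) x + pd k (pd l q) x.
    by apply: dirder_pd; apply: dirderD; apply: dirder_poly; exact: polyf_pd.
  by rewrite (E' i j) (E' j i) IHp IHq.
- have E k : pd k (fun x => p x * q x) = fun x => pd k p x * q x + p x * pd k q x.
    by apply: dirder_pd; apply: dirderM; exact: dirder_poly.
  rewrite !E; have E' k l : pd k (fun x => pd l p x * q x + p x * pd l q x) =
      fun x => (pd k (pd l p) x * q x + pd l p x * pd k q x) +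
               (pd k p x * pd l q x + p x * pd k (pd l q) x).
    apply: dirder_pd; exact: (dirderD
      (dirderM (dirder_poly k (polyf_pd l pp)) (dirder_poly k pq))
      (dirderM (dirder_poly k pp) (dirder_poly k (polyf_pd l pq)))).
  rewrite (E' i j) (E' j i) IHp IHq; apply/funext => x.
  move: (pd j (pd i p) x) (pd j (pd i q) x) (pd i p x) (pd i q x) (pd j p x) (pd j q x).
  by move=> *; ring.
Qed.

Definition madd m m' : mi N := [ffun i => (m i + m' i)%N].

Lemma polyf_monos p : polyf p -> exists s : seq (R * mi N),
  p = fun x => \sum_(z <- s) z.1 * mono z.2 x.
Proof.
elim=> [c|i|{}p q _ [s ->] _ [s' ->]|{}p q _ [s ->] _ [s' ->]].
- exists [:: (c, [ffun=> 0%N])]; apply/funext => x.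
  by rewrite big_seq1 /= mono0 mulr1.
- exists [:: (1, mincr i [ffun=> 0%N])]; apply/funext => x.
  by rewrite big_seq1 /= mono_incr mono0 mulr1 mul1r.
- by exists (s ++ s'); apply/funext => x; rewrite big_cat.
- exists [seq (z.1 * z'.1, madd z.2 z'.2) | z <- s, z' <- s'].
  apply/funext => x; rewrite big_allpairs_dep /= mulr_suml; apply: eq_bigr => z _.
  rewrite mulr_sumr; apply: eq_bigr => z' _ /=.
  rewrite mulrACA; congr (_ * _); rewrite /mono -big_split /=.
  by apply: eq_bigr => i _; rewrite ffunE exprD.
Qed.

(** A duplicate-free list of multi-indices, so that sums over a fixed degree no longer carry the
    bounded codomain ['I_n.+1]. *)
Definition mis n : seq (mi N) :=
  [seq mi_of z | z <- enum {: {ffun 'I_N -> 'I_n.+1}} & mabs (mi_of z) == n].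

Lemma big_mis n (G : mi N -> R) :
  \sum_(z : {ffun 'I_N -> 'I_n.+1} | mabs (mi_of z) == n) G (mi_of z) =
  \sum_(m <- mis n) G m.
Proof. by rewrite big_map big_filter big_enum_cond /=; apply: eq_bigl. Qed.

Lemma mi_of_inj d : injective (@mi_of N d).
Proof.
move=> z z' /ffunP e; apply/ffunP => i; apply/val_inj.
by have := e i; rewrite !ffunE.
Qed.

Lemma mi_of_surj d m : (forall i, m i < d)%N -> exists z, m = @mi_of N d z.
Proof.
move=> md; exists [ffun i => Ordinal (md i)].
by apply/ffunP => i; rewrite !ffunE.
Qed.

Lemma mis_uniq n : uniq (mis n).
Proof. 
rewrite map_inj_uniq; first by rewrite filter_uniq // enum_uniq.
move=> z z'; exact: mi_of_inj.
 Qed.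

Lemma mem_mis n m : (m \in mis n) = (mabs m == n).
Proof.
apply/mapP/eqP => [[z]|mn]; first by rewrite mem_filter => /andP[/eqP zn _] ->.
have [|z mz] := @mi_of_surj n.+1 m; first by move=> i; rewrite ltnS -mn mabs_ge.
by exists z => //; rewrite mem_filter -mz mn eqxx mem_enum.
Qed.

Lemma polyf_is_poly p : polyf p -> is_poly p.
Proof.
move=> /polyf_monos[s ->]; pose d := (\max_(z <- s) mabs z.2).+1.
exists d, (fun m => \sum_(z <- s | z.2 == m) z.1); apply/funext => x.
have sd z : z \in s -> (mabs z.2 < d)%N.
  by move=> zs; rewrite ltnS (big_rem z) //= leq_maxl.
have E z : z \in s -> z.1 * mono z.2 x =
    \sum_(w : {ffun 'I_N -> 'I_d} | (mabs (mi_of w) < d)%N)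
      (z.2 == mi_of w)%:R * (z.1 * mono (mi_of w) x).
  move=> zs; have [|w zw] := @mi_of_surj d z.2.
    by move=> i; exact: leq_ltn_trans (mabs_ge _ _) (sd _ zs).
  rewrite (bigD1 w) /=; last by rewrite -zw sd.
  rewrite -zw eqxx mul1r big1 ?addr0 // => w' /andP[_ ww'].
  rewrite zw (_ : (_ == _) = false) ?mul0r //.
  by apply/negbTE; apply: contra ww' => /eqP/mi_of_inj ->.
rewrite big_seq (eq_bigr _ E) -big_seq exchange_big /=; apply: eq_bigr => w _.
rewrite mulr_suml [RHS]big_mkcond /=; apply: eq_bigr => z _.
by case: ifP; rewrite ?mul1r ?mul0r.
Qed.

Lemma homogE n p : homog n p <->
  exists c : mi N -> R, p = fun x => \sum_(m <- mis n) c m * mono m x.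
Proof.
split=> -[c ->]; exists c; apply/funext => x.
  exact: (big_mis n (fun m => c m * mono m x)).
exact/esym/(big_mis n (fun m => c m * mono m x)).
Qed.

Lemma homog_polyf n p : homog n p -> polyf p.
Proof. by move=> [c ->]; apply: polyf_sum => z; exact/polyfZ/polyf_mono. Qed.

Lemma homog_lin n c p q : homog n p -> homog n q -> homog n (fun x => c * p x + q x).
Proof.
move=> /homogE[cp ->] /homogE[cq ->]; apply/homogE.
exists (fun m => c * cp m + cq m); apply/funext => x.
rewrite mulr_sumr -big_split /=; apply: eq_bigr => m _.
by rewrite mulrDl mulrA.
Qed.

Lemma homog0 n : homog n (fun _ : 'rV[R]_N => 0).
Proof.
apply/homogE; exists (fun=> 0); apply/funext => x.
by rewrite big1 // => m _; rewrite mul0r.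
Qed.

Lemma homog_eq n p q : homog n p -> p = q -> homog n q.
Proof. by move=> ? <-. Qed.

Lemma homogD n p q : homog n p -> homog n q -> homog n (fun x => p x + q x).
Proof.
move=> hp hq; apply: (homog_eq (homog_lin 1 hp hq)).
by apply/funext => x; rewrite mul1r.
Qed.

Lemma homogZ n c p : homog n p -> homog n (fun x => c * p x).
Proof.
move=> hp; apply: (homog_eq (homog_lin c hp (homog0 n))).
by apply/funext => x; rewrite addr0.
Qed.

Lemma homog_sum n (J : Type) (r : seq J) (f : J -> 'rV[R]_N -> R) :
  (forall a, homog n (f a)) -> homog n (fun x => \sum_(a <- r) f a x).
Proof.
move=> hf; elim: r => [|a r IH].
  by apply: (homog_eq (homog0 n)); apply/funext => x; rewrite big_nil.
by apply: (homog_eq (homogD (hf a) IH)); apply/funext => x; rewrite big_cons.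
Qed.

Lemma homog_sum_in n (J : eqType) (r : seq J) (f : J -> 'rV[R]_N -> R) :
  (forall a, a \in r -> homog n (f a)) -> homog n (fun x => \sum_(a <- r) f a x).
Proof.
elim: r => [|a r IH] hf.
  by apply: (homog_eq (homog0 n)); apply/funext => x; rewrite big_nil.
have ha : homog n (f a) by apply: hf; rewrite mem_head.
have {}IH := IH (fun b br => hf b (mem_behead (s := a :: r) br)).
by apply: (homog_eq (homogD ha IH)); apply/funext => x; rewrite big_cons.
Qed.

Lemma homog_mono m : homog (mabs m) (@mono R N m).
Proof.
apply/homogE; exists (fun m' => (m' == m)%:R); apply/funext => x.
rewrite (bigD1_seq m) ?mis_uniq ?mem_mis //= eqxx mul1r big1 ?addr0 //.
by move=> m' /negbTE ->; rewrite mul0r.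
Qed.

Lemma homog_monoP n m : m \in mis n -> homog n (@mono R N m).
Proof. by rewrite mem_mis => /eqP <-; exact: homog_mono. Qed.

Lemma homog_coordM n i p : homog n p -> homog n.+1 (fun x => x 0 i * p x).
Proof.
move=> /homogE[c ->].
apply: (@homog_eq _ (fun x => \sum_(m <- mis n) c m * mono (mincr i m) x)); last first.
  apply/funext => x; rewrite mulr_sumr; apply: eq_bigr => m _.
  by rewrite mono_incr mulrCA.
apply: homog_sum_in => m; rewrite mem_mis => /eqP <-.
by apply: homogZ; rewrite -(mabs_incr i); exact: homog_mono.
Qed.

Lemma homog_sqnM n p : homog n p -> homog n.+2 (fun x => sqn x * p x).
Proof.
move=> hp; apply: (@homog_eq _ (fun x => \sum_(i < N) x 0 i * (x 0 i * p x))).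
  by apply: homog_sum => i; do 2! apply: homog_coordM.
by apply/funext => x; rewrite mulr_suml; apply: eq_bigr => i _; rewrite mulrA.
Qed.

Lemma homog_pd n i p : homog n.+1 p -> homog n (pd i p).
Proof.
move=> /homogE[c ->]; rewrite pd_sum; last by move=> m; exact/polyfZ/polyf_mono.
apply: homog_sum_in => m; rewrite mem_mis => /eqP mn.
rewrite pdZ; last exact: polyf_mono.
rewrite pd_mono; apply: homogZ.
have [->|mi0] := eqVneq (m i) 0%N.
  by apply: (homog_eq (homog0 n)); apply/funext => x; rewrite mul0r.
apply: homogZ; suff -> : n = mabs (mdecr i m) by exact: homog_mono.
by apply: succn_inj; rewrite -(mabs_incr i) mdecrK ?lt0n.
Qed.

Lemma homog0_cst p : homog 0 p -> p = fun=> p 0.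
Proof.
move=> /homogE[c ->]; apply/funext => x.
rewrite big_seq [RHS]big_seq; apply: eq_bigr => m; rewrite mem_mis => /eqP/mabs_eq0 ->.
by rewrite mono0.
Qed.

Lemma homog_pd0 i p : homog 0 p -> pd i p = fun=> 0.
Proof. by move=> /homog0_cst ->; exact/dirder_pd/dirder_cst. Qed.

Lemma homogZs n p s x : homog n p -> p (s *: x) = s ^+ n * p x.
Proof.
move=> /homogE[c ->]; rewrite mulr_sumr big_seq [RHS]big_seq.
apply: eq_bigr => m; rewrite mem_mis => /eqP <-.
rewrite mulrCA; congr (_ * _); rewrite /mono /mabs.
rewrite -prodrXr -big_split /=; apply: eq_bigr => i _.
by rewrite mxE exprMn.
Qed.

Lemma homog_euler n p x : homog n p -> \sum_(i < N) x 0 i * pd i p x = n%:R * p x.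
Proof.
move=> /homogE[c ->].
have pm m : polyf (fun x => c m * mono m x) by exact/polyfZ/polyf_mono.
transitivity (\sum_(i < N) \sum_(m <- mis n) x 0 i * (c m * ((m i)%:R * mono (mdecr i m) x))).
  apply: eq_bigr => i _; rewrite (pd_sum i _ pm) mulr_sumr.
  by apply: eq_bigr => m _; rewrite (pdZ _ _ (polyf_mono m)) pd_mono.
rewrite exchange_big mulr_sumr /= big_seq [RHS]big_seq; apply: eq_bigr => m.
rewrite mem_mis => /eqP <-.
transitivity (\sum_(i < N) (m i)%:R * (c m * mono m x)).
  apply: eq_bigr => i _.
  have [->|mi0] := eqVneq (m i) 0%N; first by rewrite !mul0r !mulr0.
  have -> : mono m x = x 0 i * mono (mdecr i m) x by rewrite -mono_incr mdecrK ?lt0n.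
  by ring.
by rewrite -mulr_suml -natr_sum.
Qed.

Lemma mis_incr n i (G : mi N -> R) :
  \sum_(m <- mis n.+1 | (0 < m i)%N) G m = \sum_(m <- mis n) G (mincr i m).
Proof.
rewrite -big_filter -(big_map (mincr i) predT G); apply: perm_big; apply: uniq_perm.
- by rewrite filter_uniq ?mis_uniq.
- by rewrite map_inj_uniq ?mis_uniq //; exact: can_inj (mincrK i).
move=> m; rewrite mem_filter mem_mis; apply/andP/mapP => [[mi0 /eqP mn]|[m' m'n ->]].
  exists (mdecr i m); last by rewrite mdecrK.
  by rewrite mem_mis; apply/eqP/succn_inj; rewrite -(mabs_incr i) mdecrK.
by rewrite ffunE eqxx addn1 mabs_incr eqSS -mem_mis m'n.
Qed.

(** Inverting the Vandermonde matrix at the nodes 0, ..., n gives weights that read off the r-th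
    coefficient of a polynomial of degree at most n from its values at the nodes. *)
Lemma dual_nodes n : exists lam : 'I_n.+1 -> 'I_n.+1 -> R,
  forall r l : 'I_n.+1, \sum_j lam r j * j%:R ^+ l = (l == r)%:R.
Proof.
pose a : 'rV[R]_n.+1 := \row_j j%:R.
have Mu : Vandermonde n.+1 a \in unitmx.
  rewrite unitmxE det_Vandermonde unitfE; apply/prodf_neq0 => i _.
  apply/prodf_neq0 => j ij; rewrite !mxE subr_eq0 eqr_nat.
  by rewrite neq_ltn ij orbT.
exists (fun (r j : 'I_n.+1) => invmx (Vandermonde n.+1 a) j r) => r l.
have := mulmxV Mu; move/matrixP/(_ l r); rewrite !mxE => <-.
by apply: eq_bigr => j _; rewrite !mxE mulrC.
Qed.

(** Products of the one-variable weights define a functional supported on the grid {0, ..., n}^N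
    that is 1 on the monomial [r] and 0 on every other monomial of degree n. *)
Lemma mono_free n (c : mi N -> R) :
  (forall x, \sum_(m <- mis n) c m * mono m x = 0) ->
  forall m, m \in mis n -> c m = 0.
Proof.
move=> c0 r rn; have [lam lamP] := dual_nodes n.
have mord m : m \in mis n -> forall i, (m i < n.+1)%N.
  by rewrite mem_mis => /eqP <- i; rewrite ltnS mabs_ge.
pose ord (m : mi N) i : 'I_n.+1 := inord (m i).
pose node (J : {ffun 'I_N -> 'I_n.+1}) : 'rV[R]_N := \row_i (J i)%:R.
have key m : m \in mis n ->
    \sum_(J : {ffun 'I_N -> 'I_n.+1}) (\prod_i lam (ord r i) (J i)) * mono m (node J)
    = (m == r)%:R.
  move=> mn; under eq_bigr => J _.
    rewrite /mono -big_split /=.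
    under eq_bigr do rewrite mxE.
    over.
  rewrite -(bigA_distr_bigA (fun i (j : 'I_n.+1) => lam (ord r i) j * j%:R ^+ m i)) /=.
  under eq_bigr => i _.
    rewrite (_ : m i = ord m i); last by rewrite inordK // mord.
    rewrite lamP; over.
  have [->|mr] := eqVneq m r; first by rewrite big1 // => i _; rewrite eqxx.
  have [i mri] : exists i, m i != r i.
    apply/existsP; rewrite -negb_forall; apply: contra mr => /forallP h.
    by apply/eqP/ffunP => i; exact/eqP/h.
  rewrite (bigD1 i) //= (_ : _ == _ = false) ?mul0r //.
  apply/negbTE; apply: contra mri => /eqP /(congr1 val).
  by rewrite /= !inordK ?mord // => ->.
have : \sum_(J : {ffun 'I_N -> 'I_n.+1}) (\prod_i lam (ord r i) (J i)) *
    (\sum_(m <- mis n) c m * mono m (node J)) = c r.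
  under eq_bigr do rewrite mulr_sumr.
  rewrite exchange_big /= (bigD1_seq r) ?mis_uniq //=.
  under eq_bigr do rewrite mulrCA.
  rewrite -mulr_sumr key // eqxx mulr1 big1_seq ?addr0 // => m /andP[mr mn].
  under eq_bigr do rewrite mulrCA.
  by rewrite -mulr_sumr key // (negbTE mr) mulr0.
by move=> <-; rewrite big1 // => J _; rewrite c0 mulr0.
Qed.

End PolynomialFunctions.

(** * Reflections permuting roots, and density of regular points *)

Section RootSystem.
Context {R : realType} {N : nat} (Rs : seq 'rV[R]_N) (b : 'rV[R]_N).
Context (rootRs : root_system Rs) (regb : regular_for Rs b).
Local Notation Rp := (pos_sub Rs b).

Lemma root_norm a : a \in Rs -> dot a a = 2.
Proof. by case: rootRs => _ _ h _ _; exact: h. Qed.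

Lemma reflN (a : 'rV[R]_N) : dot a a = 2 -> refl a a = - a.
Proof.
move=> a2; rewrite /refl a2 -mulrA divff ?pnatr_eq0 // mulr1 scaler_nat mulr2n.
by rewrite opprD addrA subrr add0r.
Qed.

Lemma refl_linear (a : 'rV[R]_N) c x y : refl a (c *: x + y) = c *: refl a x + refl a y.
Proof.
rewrite /refl dotDr dotZr; apply/rowP => i; rewrite !mxE.
by ring.
Qed.

Lemma reflNr (a x : 'rV[R]_N) : refl a (- x) = - refl a x.
Proof.
by rewrite /refl dotNr; apply/rowP => i; rewrite !mxE; ring.
Qed.

Lemma reflK (a : 'rV[R]_N) : dot a a = 2 -> involutive (refl a).
Proof.
move=> a2 x; rewrite /refl a2 dotDr dotNr dotZr a2; apply/rowP => i; rewrite !mxE.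
by field.
Qed.

Lemma root_refl a c : a \in Rs -> c \in Rs -> refl a c \in Rs.
Proof. by case: rootRs => _ _ _ h _; exact: h. Qed.

Lemma root_opp a : a \in Rs -> - a \in Rs.
Proof. by move=> aR; rewrite -(reflN (root_norm aR)) root_refl. Qed.

Lemma root_uniq : uniq Rs. Proof. by case: rootRs. Qed.

Lemma pos_root a : a \in Rp -> a \in Rs.
Proof. by rewrite mem_filter => /andP[]. Qed.

Lemma pos_norm a : a \in Rp -> dot a a = 2.
Proof. by move/pos_root/root_norm. Qed.

Lemma sum_roots (g : 'rV[R]_N -> R) : (forall a, a \in Rs -> g (- a) = g a) ->
  \sum_(a <- Rs) g a = 2 * \sum_(a <- Rp) g a.
Proof.
move=> geven; rewrite (bigID (fun a => 0 < dot a b)) /= big_filter.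
suff -> : \sum_(a <- Rs | ~~ (0 < dot a b)) g a = \sum_(a <- Rs | 0 < dot a b) g a.
  by rewrite mulr_natl mulr2n.
have pR : perm_eq Rs (map -%R Rs).
  apply: uniq_perm; [exact: root_uniq|by rewrite map_inj_uniq ?root_uniq //; exact: oppr_inj|].
  move=> a; apply/idP/mapP => [aR|[c cR ->]]; last exact: root_opp.
  by exists (- a); rewrite ?opprK ?root_opp.
rewrite (perm_big _ pR) /= big_map.
rewrite big_seq_cond [RHS]big_seq_cond; apply: eq_big => [a|a /andP[aR _]]; last exact: geven.
have [aR /=|//] := boolP (a \in Rs); rewrite dotNl oppr_gt0 -leNgt le_eqVlt.
by rewrite eq_sym (negbTE (regb aR)).
Qed.

(** A reflection does not preserve the positive roots, but for even [g] the sum over them is half of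
    the sum over all roots, which the reflection permutes. *)
Lemma sum_pos_refl a (g : 'rV[R]_N -> R) : a \in Rs ->
  (forall c, c \in Rs -> g (- c) = g c) ->
  \sum_(c <- Rp) g (refl a c) = \sum_(c <- Rp) g c.
Proof.
move=> aR geven; apply: (@mulfI _ 2); first by rewrite pnatr_eq0.
rewrite -(sum_roots geven) -(sum_roots (g := fun c => g (refl a c))); last first.
  by move=> c cR; rewrite reflNr geven // root_refl.
have pR : perm_eq Rs (map (refl a) Rs).
  have aK := reflK (root_norm aR).
  apply: uniq_perm; [exact: root_uniq|rewrite map_inj_uniq ?root_uniq //; exact: inv_inj|].
  move=> c; apply/idP/mapP => [cR|[c' cR ->]]; last exact: root_refl.
  by exists (refl a c); rewrite ?aK ?root_refl.
by rewrite [RHS](perm_big _ pR) /= big_map.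
Qed.

Lemma regular_pt_refl a x : a \in Rs -> regular_pt Rs x -> regular_pt Rs (refl a x).
Proof.
move=> aR rx c cR; have a2 := root_norm aR.
rewrite -[c](reflK a2) dot_refl //; apply: rx; exact: root_refl.
Qed.

(** On the line through x in the direction [b], each root is an affine function with nonzero slope,
    hence without zeros at small nonzero parameters. *)
Lemma near_regular x : \forall m \near \oo, regular_pt Rs (x + m.+1%:R^-1 *: b).
Proof.
suff H (s : seq 'rV[R]_N) : {subset s <= Rs} -> \forall m \near \oo,
    forall a, a \in s -> dot a (x + m.+1%:R^-1 *: b) != 0.
  exact: H.
elim: s => [|a s IH] sR; first exact: nearW.
have {}IH : \forall m \near \oo, forall c, c \in s -> dot c (x + m.+1%:R^-1 *: b) != 0.
  by apply: IH => c cs; apply: sR; rewrite in_cons cs orbT.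
have ab : dot a b != 0 by apply: regb; apply: sR; rewrite mem_head.
have Ha : \forall m \near \oo, dot a (x + m.+1%:R^-1 *: b) != 0.
  have [ax|ax] := eqVneq (dot a x) 0.
    apply: nearW => m; by rewrite dotDr ax add0r dotZr mulf_neq0 // invr_neq0.
  have e0 : 0 < `|dot a x| / `|dot a b| by rewrite divr_gt0 ?normr_gt0.
  near=> m; rewrite dotDr dotZr addr_eq0; apply/negP => /eqP E.
  have : m.+1%:R^-1 < `|dot a x| / `|dot a b|.
    by near: m; exact: (near_infty_natSinv_lt (PosNum e0)).
  rewrite E normrN normrM mulfK ?normr_eq0 // ger0_norm ?invr_ge0 //.
  by rewrite ltxx.
near=> m; move=> c; rewrite in_cons => /orP[/eqP ->|cs].
  by near: m.
by move: c cs; near: m.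
Unshelve. all: by end_near. Qed.

(** The formula of a Dunkl operator is meaningful off the reflecting hyperplanes; this extends
    identities between polynomials across them. *)
Lemma polyf_regular_eq p q : polyf p -> polyf q ->
  (forall x, regular_pt Rs x -> p x = q x) -> p = q.
Proof.
move=> pp pq pqE; apply/funext => x.
have cx : cvgrow (fun m : nat => x + m.+1%:R^-1 *: b) x.
  rewrite -[X in cvgrow _ X]addr0; apply: cvgrowD; first exact: cvgrow_cst.
  rewrite -[X in cvgrow _ X](scale0r b); apply: cvgrowZ; last exact: cvgrow_cst.
  exact: cvg_harmonic.
have cp := polyf_seqcont pp cx; have cq := polyf_seqcont pq cx.
have cq' : p (x + m.+1%:R^-1 *: b) @[m --> \oo] --> q x.
  apply: cvg_trans cq; apply: near_eq_cvg; near=> m; apply: esym; apply: pqE.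
  by near: m; exact: near_regular.
exact: (cvg_unique (@norm_hausdorff _ R) cp cq').
Unshelve. all: by end_near. Qed.

End RootSystem.

(** * Divided differences of polynomials along a root *)

Section DividedDifference.
Context {R : realType} {N : nat}.

Lemma coord_refl (a x : 'rV[R]_N) i : dot a a = 2 ->
  refl a x 0 i = x 0 i - dot a x * a 0 i.
Proof. by move=> a2; rewrite /refl a2 !mxE; field. Qed.

(** With s the reflection, divisibility by <a,x> passes to products since pq - (pq) o s = (p - p o
    s) q + (p o s) (q - q o s). *)
Lemma divdiff (a : 'rV[R]_N) p : dot a a = 2 -> polyf p ->
  exists q, polyf q /\ forall x, p x - p (refl a x) = dot a x * q x.
Proof.
move=> a2; elim=> [c|i|{}p q pp [p' [pp' ep]] pq [q' [pq' eq]]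
    |{}p q pp [p' [pp' ep]] pq [q' [pq' eq]]].
- by exists (fun=> 0); split => [|x]; [exact: polyf_cst|rewrite subrr mulr0].
- exists (fun=> a 0 i); split => [|x]; first exact: polyf_cst.
  by rewrite coord_refl //; ring.
- exists (fun x => p' x + q' x); split => [|x]; first exact: polyfD.
  by rewrite mulrDr -ep -eq; ring.
- exists (fun x => p' x * q x + p (refl a x) * q' x); split => [|x].
    by apply: polyfD; apply: polyfM => //; exact: polyf_refl.
  by rewrite mulrDr mulrA -ep mulrCA -eq; ring.
Qed.

(* The value is arbitrary (but polynomial) when [a] is not a root. *)
Definition dd (a : 'rV[R]_N) (p : 'rV[R]_N -> R) : 'rV[R]_N -> R :=
  xget (fun=> 0) [set q | polyf q /\
    (dot a a = 2 -> polyf p -> forall x, p x - p (refl a x) = dot a x * q x)].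

Lemma ddP a p : polyf (dd a p) /\
  (dot a a = 2 -> polyf p -> forall x, p x - p (refl a x) = dot a x * dd a p x).
Proof.
rewrite /dd; case: xgetP => [q _ //|no].
have [[a2 pp]|h] := pselect (dot a a = 2 /\ polyf p); last first.
  by case: (no (fun=> 0)); split => [|a2 pp]; [exact: polyf_cst|case: h].
by have [q [pq e]] := divdiff a2 pp; case: (no q).
Qed.

Lemma polyf_dd a p : polyf (dd a p). Proof. by case: (ddP a p). Qed.

Lemma ddE a p x : dot a a = 2 -> polyf p -> p x - p (refl a x) = dot a x * dd a p x.
Proof. by case: (ddP a p) => _ h a2 pp; exact: h. Qed.

End DividedDifference.

(** * Dunkl operators and the Dunkl Laplacian on polynomials *)

Section DunklOperators.
Context {R : realType} {N : nat} (Rs : seq 'rV[R]_N) (b : 'rV[R]_N).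
Context (k : 'rV[R]_N -> R).
Context (rootRs : root_system Rs) (regb : regular_for Rs b) (multk : multiplicity Rs k).
Local Notation Rp := (pos_sub Rs b).
Implicit Types (p q : 'rV[R]_N -> R) (i j : 'I_N).

(** A version of [dunkl] that maps polynomials to polynomials. Both agree at regular points; on a
    hyperplane the quotient in [dunkl] is 0 by the convention for division by zero, instead of the
    value of the divided difference. *)
Definition dT i p : 'rV[R]_N -> R := fun x =>
  pd i p x + \sum_(a <- Rp) k a * a 0 i * dd a p x.

Lemma dunklE i p x : dunkl Rp k i p x =
  pd i p x + \sum_(a <- Rp) k a * a 0 i * ((p x - p (refl a x)) / dot a x).
Proof. by []. Qed.

Lemma polyf_dT i p : polyf p -> polyf (dT i p).
Proof.
move=> pp; apply: polyfD; first exact: polyf_pd.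
by apply: polyf_sum => a; apply: polyfZ; exact: polyf_dd.
Qed.

Lemma dT_regular i p x : polyf p -> regular_pt Rs x -> dT i p x = dunkl Rp k i p x.
Proof.
move=> pp rx; rewrite /dT /dunkl; congr (_ + _).
rewrite big_seq [RHS]big_seq; apply: eq_bigr => a aR; congr (_ * _).
rewrite ddE //; last exact: (pos_norm rootRs aR).
by rewrite mulrAC divff ?mul1r // rx // (pos_root aR).
Qed.

Lemma dT_eq i p q : polyf p -> polyf q ->
  (forall x, regular_pt Rs x -> dunkl Rp k i p x = q x) -> dT i p = q.
Proof.
move=> pp pq e; apply: (polyf_regular_eq regb (polyf_dT i pp) pq) => x rx.
by rewrite dT_regular // e.
Qed.

Lemma dT_lin i c p q : polyf p -> polyf q ->
  dT i (fun x => c * p x + q x) = fun x => c * dT i p x + dT i q x.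
Proof.
move=> pp pq; apply: dT_eq => [||x rx].
- by apply: polyfD => //; exact: polyfZ.
- by apply: polyfD; [apply: polyfZ|]; exact: polyf_dT.
rewrite !dT_regular // /dunkl -!/(pd i _ x) pd_lin // mulrDr mulr_sumr addrACA.
rewrite -big_split /=; congr (_ + _); apply: eq_bigr => a _; ring.
Qed.

Lemma dTD i p q : polyf p -> polyf q ->
  dT i (fun x => p x + q x) = fun x => dT i p x + dT i q x.
Proof.
move=> pp pq; have := dT_lin i 1 pp pq.
rewrite (_ : (fun x => 1 * p x + q x) = fun x => p x + q x); last first.
  by apply/funext => x; rewrite mul1r.
by move=> ->; apply/funext => x; rewrite mul1r.
Qed.

Lemma dT_cst i c : dT i (fun=> c) = fun=> 0.
Proof.
apply: dT_eq => [||x rx]; try exact: polyf_cst.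
rewrite /dunkl -/(pd i _ x) (dirder_pd (dirder_cst _ _)) add0r big1 // => a _.
by rewrite subrr mul0r mulr0.
Qed.

Lemma dTZ i c p : polyf p -> dT i (fun x => c * p x) = fun x => c * dT i p x.
Proof.
move=> pp; have := dT_lin i c pp (polyf_cst 0).
rewrite (_ : (fun x => c * p x + 0) = fun x => c * p x); last first.
  by apply/funext => x; rewrite addr0.
by move=> ->; rewrite dT_cst; apply/funext => x; rewrite addr0.
Qed.

Lemma dT_sum i (J : Type) (r : seq J) (f : J -> 'rV[R]_N -> R) :
  (forall a, polyf (f a)) ->
  dT i (fun x => \sum_(a <- r) f a x) = fun x => \sum_(a <- r) dT i (f a) x.
Proof.
move=> pf; elim: r => [|a r IH].
  under eq_fun do rewrite big_nil; rewrite dT_cst.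
  by apply/funext => x; rewrite big_nil.
under eq_fun do rewrite big_cons; rewrite dTD // ?IH; last exact: polyf_sum.
by apply/funext => x; rewrite big_cons.
Qed.

Lemma dT_coordM i j p : polyf p -> dT i (fun x => x 0 j * p x) =
  fun x => x 0 j * dT i p x + (j == i)%:R * p x +
    \sum_(a <- Rp) k a * a 0 i * a 0 j * p (refl a x).
Proof.
move=> pp; apply: dT_eq => [||x rx].
- by apply: polyfM => //; exact: polyf_coord.
- apply: polyfD; first apply: polyfD.
  + by apply: polyfM; [exact: polyf_coord|exact: polyf_dT].
  + exact: polyfZ.
  + by apply: polyf_sum => a; apply: polyfZ; exact: polyf_refl.
rewrite dT_regular // /dunkl -!/(pd i _ x) pd_coordM //.
rewrite mulrDr mulr_sumr [X in X + _]addrC -!addrA; congr (_ + _).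
rewrite [RHS]addrCA; congr (_ + _); rewrite -big_split /= big_seq [RHS]big_seq.
apply: eq_bigr => a aR; rewrite coord_refl; last exact: (pos_norm rootRs aR).
by field; exact: rx (pos_root aR).
Qed.

(** |x|^2 is reflection invariant, so it factors out of the difference terms and only the Leibniz
    rule remains. *)
Lemma dT_sqnM i p : polyf p ->
  dT i (fun x => sqn x * p x) = fun x => sqn x * dT i p x + 2 * x 0 i * p x.
Proof.
move=> pp; apply: dT_eq => [||x rx].
- by apply: polyfM => //; exact: polyf_sqn.
- apply: polyfD; first by apply: polyfM; [exact: polyf_sqn|exact: polyf_dT].
  by apply: polyfM => //; apply: polyfZ; exact: polyf_coord.
rewrite dT_regular // /dunkl -!/(pd i _ x).
rewrite (dirder_pd (dirderM (dirder_sqn i) (dirder_poly i pp))).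
rewrite mulrDr mulr_sumr -addrA [RHS]addrC; congr (_ + (_ + _)).
rewrite big_seq [RHS]big_seq; apply: eq_bigr => a aR.
by rewrite sqn_refl ?(pos_norm rootRs aR) //; ring.
Qed.

Lemma k_refl a c : a \in Rs -> c \in Rs -> k (refl a c) = k c.
Proof.
move=> aR cR; case: multk => _ kW.
exact: (kW (refl a \o id) c (W_step aR (W_id Rs)) cR).
Qed.

Lemma k_opp c : c \in Rs -> k (- c) = k c.
Proof. by move=> cR; rewrite -(reflN (root_norm rootRs cR)) k_refl. Qed.

Lemma pd_refl a i p x : dot a a = 2 -> polyf p ->
  pd i (fun x => p (refl a x)) x = pd i p (refl a x) - a 0 i * \sum_j a 0 j * pd j p (refl a x).
Proof.
move=> a2; elim=> [c|l|{}p q pp IHp pq IHq|{}p q pp IHp pq IHq].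
- rewrite !(dirder_pd (dirder_cst _ _)) big1 ?mulr0 ?subr0 // => j _.
  by rewrite (dirder_pd (dirder_cst _ _)) mulr0.
- have E : (fun x => refl a x 0 l) = fun x => x 0 l + (- a 0 l) * dot a x.
    by apply/funext => y; rewrite coord_refl //; ring.
  rewrite E (dirder_pd (dirderD (dirder_coord i l) (dirderZ (- a 0 l) (dirder_dot i a)))).
  rewrite (dirder_pd (dirder_coord i l)) (bigD1 l) //= big1 => [|j jl].
    by rewrite (dirder_pd (dirder_coord l l)) eqxx /=; ring.
  by rewrite (dirder_pd (dirder_coord j l)) eq_sym (negbTE jl) mulr0.
- have E j : pd j (fun x => p x + q x) = fun x => pd j p x + pd j q x.
    by apply: dirder_pd; apply: dirderD; exact: dirder_poly.
  rewrite (dirder_pd (dirderD (dirder_poly i (polyf_refl a pp))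
    (dirder_poly i (polyf_refl a pq)))) IHp IHq E.
  under [in RHS]eq_bigr do rewrite E mulrDr.
  by rewrite big_split /=; ring.
- have E j : pd j (fun x => p x * q x) = fun x => pd j p x * q x + p x * pd j q x.
    by apply: dirder_pd; apply: dirderM; exact: dirder_poly.
  rewrite (dirder_pd (dirderM (dirder_poly i (polyf_refl a pp))
    (dirder_poly i (polyf_refl a pq)))) IHp IHq E.
  set y := refl a x.
  have -> : \sum_j a 0 j * pd j (fun x => p x * q x) y =
     (\sum_j a 0 j * pd j p y) * q y + p y * \sum_j a 0 j * pd j q y.
    rewrite mulr_suml mulr_sumr -big_split /=; apply: eq_bigr => j _.
    by rewrite E; ring.
  by ring.
Qed.

Lemma refl_conj a c (x : 'rV[R]_N) : dot a a = 2 -> dot c c = 2 ->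
  refl a (refl c x) = refl (refl a c) (refl a x).
Proof.
move=> a2 c2; have c2' : dot (refl a c) (refl a c) = 2 by rewrite dot_refl.
rewrite [refl c x in LHS]/refl c2 [in RHS]/refl c2' dot_refl //.
by rewrite -scaleNr addrC refl_linear scaleNr addrC.
Qed.

(** The case xi = a of the equivariance T_xi (p o s) = (T_(s xi) p) o s, where s is the reflection
    in [a] and s a = - a. *)
Lemma dT_root_refl a p x : a \in Rs -> polyf p ->
  \sum_i a 0 i * dT i (fun y => p (refl a y)) x =
  - \sum_i a 0 i * dT i p (refl a x).
Proof.
move=> aR pp; have a2 := root_norm rootRs aR.
pose F x := \sum_i a 0 i * dT i (fun y => p (refl a y)) x.
pose G x := -1 * \sum_i a 0 i * dT i p (refl a x).
suff : F = G by move/(congr1 (fun f => f x)); rewrite /F /G mulN1r.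
apply: (polyf_regular_eq regb).
- by apply: polyf_sum => i; apply: polyfZ; apply: polyf_dT; exact: polyf_refl.
- apply: polyfZ; apply: polyf_sum => i; apply: polyfZ.
  by apply: polyf_refl; exact: polyf_dT.
move=> {}x rx; rewrite /F /G.
have rx' := regular_pt_refl rootRs aR rx.
have pr := polyf_refl a pp.
under eq_bigr => i _ do rewrite (dT_regular i pr rx) dunklE (pd_refl i x a2 pp).
under [in RHS]eq_bigr => i _ do rewrite (dT_regular i pp rx') dunklE.
pose g c := k c * dot c a * ((p (refl a x) - p (refl c (refl a x))) / dot c (refl a x)).
have E1 : \sum_i a 0 i * \sum_(c <- Rp) k c * c 0 i *
     ((p (refl a x) - p (refl c (refl a x))) / dot c (refl a x)) = \sum_(c <- Rp) g c.
  under eq_bigr do rewrite mulr_sumr.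
  rewrite exchange_big /=; apply: eq_bigr => c _.
  rewrite /g /dot mulr_sumr mulr_suml; apply: eq_bigr => i _; ring.
have E2 : \sum_i a 0 i * \sum_(c <- Rp) k c * c 0 i *
     ((p (refl a x) - p (refl a (refl c x))) / dot c x) = - \sum_(c <- Rp) g c.
  (* Evenness of [g]: replacing c by - c changes two signs, which cancel, and leaves the reflection
     itself unchanged. *)
  rewrite -(sum_pos_refl rootRs regb aR); last first.
    move=> c cR; rewrite /g k_opp // !dotNl invrN !mulrN !mulNr opprK.
    by congr (_ * ((_ - p _) / _)); rewrite /refl !dotNl !dotNr opprK scalerN !mulrN !mulNr scaleNr opprK.
  under eq_bigr do rewrite mulr_sumr.
  rewrite exchange_big /= -sumrN big_seq [RHS]big_seq; apply: eq_bigr => c cR.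
  have cR' := pos_root cR; have c2 := root_norm rootRs cR'.
  rewrite /g k_refl // -refl_conj // (dot_refl c x a2).
  have -> : dot (refl a c) a = - dot c a.
    by rewrite -(dot_refl c a a2) (reflN a2) dotNr opprK.
  rewrite !mulrN !mulNr opprK /dot mulr_sumr mulr_suml; apply: eq_bigr => i _; ring.
set D := \sum_j a 0 j * pd j p (refl a x).
have -> : \sum_i a 0 i * (pd i p (refl a x) - a 0 i * D +
   \sum_(c <- Rp) k c * c 0 i * ((p (refl a x) - p (refl a (refl c x))) / dot c x)) =
   D - dot a a * D + - \sum_(c <- Rp) g c.
  under eq_bigr do rewrite mulrDr mulrBr.
  rewrite big_split /= E2 sumrB; congr (_ - _ + _).
  by rewrite /dot mulr_suml; apply: eq_bigr => i _; rewrite mulrA.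
under [in RHS]eq_bigr do rewrite mulrDr.
by rewrite big_split /= E1 -/D a2; ring.
Qed.

Definition dLap p : 'rV[R]_N -> R := fun x => \sum_i dT i (dT i p) x.

Lemma polyf_dLap p : polyf p -> polyf (dLap p).
Proof. by move=> pp; apply: polyf_sum => i; do 2! apply: polyf_dT. Qed.

Lemma dLap_lin c p q : polyf p -> polyf q ->
  dLap (fun x => c * p x + q x) = fun x => c * dLap p x + dLap q x.
Proof.
move=> pp pq; apply/funext => x; rewrite /dLap mulr_sumr -big_split /=.
by apply: eq_bigr => i _; rewrite dT_lin // dT_lin //; exact: polyf_dT.
Qed.

(** Each of the two applications of T_i leaves a sum of reflection terms, and by [dT_root_refl]
    these sums [S1] and [S2] are opposite. What survives is T_j p, once from each application. *)
Lemma dLap_coordM j p : polyf p ->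
  dLap (fun x => x 0 j * p x) = fun x => x 0 j * dLap p x + 2 * dT j p x.
Proof.
move=> pp; apply/funext => x.
pose Lp := \sum_i dT i (dT i p) x.
rewrite {1}/dLap -[dLap p x]/Lp.
have pTp i := polyf_dT i pp.
have pr a := polyf_refl a pp.
have E i : dT i (dT i (fun x => x 0 j * p x)) x =
    x 0 j * dT i (dT i p) x + (j == i)%:R * dT i p x +
    \sum_(a <- Rp) k a * a 0 i * a 0 j * dT i p (refl a x)
    + (j == i)%:R * dT i p x +
    \sum_(a <- Rp) k a * a 0 i * a 0 j * dT i (fun y => p (refl a y)) x.
  rewrite dT_coordM // dTD; first last.
  - by apply: polyf_sum => a; exact: polyfZ.
  - apply: polyfD; last exact: polyfZ.
    by apply: polyfM => //; exact: polyf_coord.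
  rewrite dTD; first last.
  - exact: polyfZ.
  - by apply: polyfM => //; exact: polyf_coord.
  rewrite dT_coordM // dTZ // dT_sum; last by move=> a; exact: polyfZ.
  by congr (_ + _); apply: eq_bigr => a _; rewrite dTZ.
under eq_bigr do rewrite E.
rewrite !big_split /=.
have dE : \sum_i (j == i)%:R * dT i p x = dT j p x.
  rewrite (bigD1 j) //= eqxx mul1r big1 ?addr0 // => i ij.
  by rewrite eq_sym (negbTE ij) mul0r.
rewrite dE.
have S1 : \sum_i \sum_(a <- Rp) k a * a 0 i * a 0 j * dT i p (refl a x) =
    \sum_(a <- Rp) k a * a 0 j * \sum_i a 0 i * dT i p (refl a x).
  rewrite exchange_big /=; apply: eq_bigr => a _; rewrite mulr_sumr.
  by apply: eq_bigr => i _; ring.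
have S2 : \sum_i \sum_(a <- Rp) k a * a 0 i * a 0 j * dT i (fun y => p (refl a y)) x =
    - \sum_(a <- Rp) k a * a 0 j * \sum_i a 0 i * dT i p (refl a x).
  rewrite exchange_big /= -sumrN big_seq [RHS]big_seq; apply: eq_bigr => a aR.
  rewrite -mulrN -dT_root_refl ?(pos_root aR) // mulr_sumr.
  by apply: eq_bigr => i _; ring.
by rewrite S1 S2 -mulr_sumr /Lp; ring.
Qed.

End DunklOperators.

(** * Continuity of real powers up to the origin *)

Section PowerContinuity.
Context {R : realType}.

(** Three cases: k = 0, where the power is constantly 1 even at 0; l > 0, by differentiability; l =
    0 < k, where the limit at 0 is taken from the right and zero values of [u] are treated apart. *)
Lemma powR_cvg_seq (k : R) (u : nat -> R) (l : R) : 0 <= k ->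
  (forall m, 0 <= u m) -> 0 <= l -> u m @[m --> \oo] --> l ->
  u m `^ k @[m --> \oo] --> l `^ k.
Proof.
rewrite le_eqVlt => /predU1P[<-|k0] u0 l0 ul.
  by under eq_fun do rewrite powRr0; rewrite powRr0; exact: cvg_cst.
move: l0; rewrite le_eqVlt => /predU1P[l0|l0]; last first.
  have cl : {for l, continuous (@powR R ^~ k)}.
    apply: differentiable_continuous; apply/derivable1_diffP.
    by apply: derivable_powR; rewrite in_itv /= l0.
  exact: (cvg_comp u (fun z => z `^ k) ul cl).
rewrite -l0 powR0 ?gt_eqF //; apply/cvgrPdist_lt => e e0.
have /cvgrPdist_lt /(_ e e0) [d /= d0 hd] := powR_cvg0 k0.
move: ul => /cvgrPdist_lt /(_ d d0); rewrite -l0; apply: filterS => m um.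
have := u0 m; rewrite le_eqVlt => /predU1P[<-|um0].
  by rewrite powR0 ?gt_eqF // subrr normr0.
exact: hd.
Qed.

End PowerContinuity.

(** * Growth below every Gaussian rate *)

Section SubGaussian.
Context {R : realType} {N : nat}.
Implicit Types (p f g : 'rV[R]_N -> R).

(** Quantifying over all rates makes the class stable under products, since [eta] can be split in
    two halves. *)
Definition sg f := forall eta : R, 0 < eta ->
  exists c, forall x, `|f x| <= c * expR (eta * sqn x).

Lemma sg_cst c : sg (fun=> c).
Proof.
move=> eta e0; exists `|c| => x; rewrite ler_peMr //.
by rewrite -expR0 ler_expR mulr_ge0 ?sqn_ge0 // ltW.
Qed.

Lemma sgM f g : sg f -> sg g -> sg (fun x => f x * g x).
Proof.
move=> sf sg_ eta e0; have e20 : 0 < eta / 2 by rewrite divr_gt0.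
have [c hc] := sf _ e20; have [c' hc'] := sg_ _ e20.
exists (c * c') => x; rewrite normrM.
have -> : expR (eta * sqn x) = expR (eta / 2 * sqn x) * expR (eta / 2 * sqn x).
  by rewrite -expRD; congr expR; field.
by rewrite mulrACA ler_pM.
Qed.

Lemma sgD f g : sg f -> sg g -> sg (fun x => f x + g x).
Proof.
move=> sf sg_ eta e0; have [c hc] := sf _ e0; have [c' hc'] := sg_ _ e0.
by exists (c + c') => x; rewrite (le_trans (ler_normD _ _)) // mulrDl lerD.
Qed.

Lemma sg_coord i : sg (fun x => x 0 i).
Proof.
move=> eta e0; exists (1 + eta^-1) => x.
have h1 : x 0 i ^+ 2 <= sqn x.
  rewrite /sqn /dot (bigD1 i) //= expr2 lerDl sumr_ge0 // => j _.
  by rewrite -expr2 sqr_ge0.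
have h2 : `|x 0 i| <= 1 + sqn x.
  have : `|x 0 i| ^+ 2 <= sqn x by rewrite real_normK ?num_real.
  have := normr_ge0 (x 0 i); nra.
have h3 : 1 + eta * sqn x <= expR (eta * sqn x) by exact: expR_ge1Dx.
have h4 : 1 <= expR (eta * sqn x).
  by rewrite -expR0 ler_expR mulr_ge0 ?sqn_ge0 // ltW.
apply: le_trans h2 _; rewrite mulrDl mul1r lerD // mulrC ler_pdivlMr //.
by rewrite mulrC; lra.
Qed.

Lemma polyf_sg p : polyf p -> sg p.
Proof.
elim=> [c|i|{}p q _ IHp _ IHq|{}p q _ IHp _ IHq].
- exact: sg_cst.
- exact: sg_coord.
- exact: sgD.
- exact: sgM.
Qed.

Lemma nice_mul_bounded f (r : 'rV[R]_N -> R) B : nice f -> seqcont r ->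
  (forall x, `|r x| <= B) -> nice (fun x => f x * r x).
Proof.
move=> [cf [c [d [d0 fb]]]] cr rB; split; first exact: seqcontM.
exists (c * B), d; split => // x; rewrite normrM mulrAC ler_pM //.
Qed.

End SubGaussian.

(** * Integration by parts against the Dunkl Gaussian, and its total mass *)

Section DunklGaussian.
Context {R : realType} {N : nat} (Rs : seq 'rV[R]_N) (b : 'rV[R]_N).
Context (k : 'rV[R]_N -> R) (t : R).
Context (rootRs : root_system Rs) (regb : regular_for Rs b) (multk : multiplicity Rs k).
Context (t0 : 0 < t).
Local Notation Rp := (pos_sub Rs b).
Implicit Types (p q : 'rV[R]_N -> R) (i j : 'I_N) (x : 'rV[R]_N) (e : R).

Lemma k_ge0 a : a \in Rp -> 0 <= k a.
Proof. by move/pos_root; case: multk => h _; exact: h. Qed.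

(* A smooth reflection-invariant approximation of the weight [wk]. *)
Definition weps e x : R := \prod_(a <- Rp) (dot a x ^+ 2 + e) `^ (k a).

Lemma weps0 x : weps 0 x = wk Rp k x.
Proof.
apply: eq_bigr => a _; rewrite addr0 powRrM.
by rewrite (powR_mulrn 2 (normr_ge0 (dot a x))) real_normK ?num_real.
Qed.

Lemma arg_ge0 e a x : 0 <= e -> 0 <= dot a x ^+ 2 + e.
Proof. by move=> e0; rewrite addr_ge0 ?sqr_ge0. Qed.

Lemma arg_gt0 e a x : 0 < e -> 0 < dot a x ^+ 2 + e.
Proof. by move=> e0; rewrite ltr_wpDl ?sqr_ge0. Qed.

Lemma weps_ge0 e x : 0 <= weps e x.
Proof. by apply: prodr_ge0 => a _; exact: powR_ge0. Qed.

Lemma cvg_prod_seq_in (r : seq 'rV[R]_N) (f : 'rV[R]_N -> nat -> R) (l : 'rV[R]_N -> R) :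
  (forall a, a \in r -> f a m @[m --> \oo] --> l a) ->
  \prod_(a <- r) f a m @[m --> \oo] --> \prod_(a <- r) l a.
Proof.
elim: r => [|a r IH] fl.
  by under eq_fun do rewrite big_nil; rewrite big_nil; exact: cvg_cst.
under eq_fun do rewrite big_cons; rewrite big_cons.
apply: cvgM; first by apply: fl; rewrite mem_head.
by apply: IH => c cr; apply: fl; rewrite in_cons cr orbT.
Qed.

Lemma weps_cvg (e : nat -> R) e' (u : nat -> 'rV[R]_N) x : (forall m, 0 <= e m) ->
  0 <= e' -> e m @[m --> \oo] --> e' -> cvgrow u x ->
  weps (e m) (u m) @[m --> \oo] --> weps e' x.
Proof.
move=> e0 e'0 ee ux; apply: cvg_prod_seq_in => a aR; apply: powR_cvg_seq.
- exact: k_ge0.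
- by move=> m; exact: arg_ge0.
- exact: arg_ge0.
- apply: cvgD => //; rewrite expr2; under eq_fun do rewrite expr2.
  by apply: cvgM; exact: seqcont_dot.
Qed.

Lemma weps_le eta : 0 < eta -> exists c, forall e x, 0 <= e <= 1 ->
  weps e x <= c * expR (eta * sqn x).
Proof.
move=> eta0.
have gE : 0 <= gam Rp k by rewrite /gam big_seq sumr_ge0 // => a /k_ge0.
(* From ln (h v) < h v follows ln v <= h v - ln h. With v = 2 |x|^2 + 1 the product acquires the
   rate 2 gam h, which this choice keeps below [eta]; the 1 keeps the denominator positive when gam
   = 0. *)
pose h := eta / (2 * gam Rp k + 1).
have h0 : 0 < h by rewrite divr_gt0 // ltr_wpDl // mulr_ge0.
exists (expR (gam Rp k * (h - ln h))) => e x /andP[e0 e1].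
rewrite -expRD.
apply: (@le_trans _ _ (expR (\sum_(a <- Rp) k a * (h - ln h + h * 2 * sqn x)))).
  rewrite expR_sum /weps big_seq [X in _ <= X]big_seq; apply: ler_prod => a aR.
  rewrite powR_ge0 /=.
  apply: (@le_trans _ _ ((2 * sqn x + 1) `^ k a)).
    apply: ge0_ler_powR; rewrite ?k_ge0 ?nnegrE ?arg_ge0 //.
      by rewrite addr_ge0 // mulr_ge0 // sqn_ge0.
    by rewrite lerD // CauchySchwarz2 // (pos_norm rootRs aR).
  have v0 : 0 < 2 * sqn x + 1 by rewrite ltr_wpDl // mulr_ge0 // sqn_ge0.
  rewrite /powR gt_eqF // ler_expR ler_wpM2l ?k_ge0 //.
  have : ln (h * (2 * sqn x + 1)) < h * (2 * sqn x + 1).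
    by apply: ln_sublinear; rewrite mulr_gt0.
  rewrite lnM ?posrE //; lra.
have hE : 2 * gam Rp k * h <= eta.
  rewrite /h mulrA ler_pdivrMr; last by rewrite ltr_wpDl // mulr_ge0.
  by rewrite mulrC ler_wpM2l ?(ltW eta0) //; lra.
rewrite ler_expR -mulr_suml -/(gam Rp k).
have := ler_wpM2r (sqn_ge0 x) hE; lra.
Qed.

Definition gwt e x : R := expR (- sqn x / (4 * t)) * weps e x.

Lemma gwt_gb p : polyf p -> exists c d, 0 < d /\ forall e, 0 <= e <= 1 ->
  gb c d (fun x => p x * gwt e x).
Proof.
(* The Gaussian has rate 4d. The polynomial and the weight spend d each and one more d is given
   away, leaving rate d, uniformly in [e]. *)
move=> pp; pose d := (16 * t)^-1.
have d0 : 0 < d by rewrite invr_gt0 mulr_gt0.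
have [c hc] := polyf_sg pp d0; have [c' hc'] := weps_le d0.
exists (c * c'), d; split => // e e01 x.
rewrite /gwt !normrM (ger0_norm (expR_ge0 _)) (ger0_norm (weps_ge0 _ _)).
have E : expR (- (d * sqn x)) =
    expR (- sqn x / (4 * t)) * expR (d * sqn x) * (expR (d * sqn x) * expR (d * sqn x)).
  by rewrite -!expRD; congr expR; rewrite /d; field; rewrite gt_eqF.
have cs0 : 0 <= c by have := le_trans (normr_ge0 _) (hc x); rewrite pmulr_lge0 ?expR_gt0.
have cs'0 : 0 <= c'.
  by have := le_trans (weps_ge0 e x) (hc' _ _ e01); rewrite pmulr_lge0 ?expR_gt0.
have one : 1 <= expR (d * sqn x) by rewrite -expR0 ler_expR mulr_ge0 ?sqn_ge0 // ltW.
rewrite E mulrCA.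
rewrite [X in _ <= X](_ : _ = expR (- sqn x / (4 * t)) *
  (c * expR (d * sqn x) * (c' * expR (d * sqn x))) * expR (d * sqn x)); last by ring.
apply: (@le_trans _ _ (expR (- sqn x / (4 * t)) *
  (c * expR (d * sqn x) * (c' * expR (d * sqn x))))).
  by rewrite ler_wpM2l ?expR_ge0 // ler_pM ?weps_ge0 // hc'.
by rewrite ler_peMr // mulr_ge0 ?expR_ge0 // !mulr_ge0 ?expR_ge0.
Qed.

Lemma gwt_cvg (e : nat -> R) e' (u : nat -> 'rV[R]_N) x : (forall m, 0 <= e m) ->
  0 <= e' -> e m @[m --> \oo] --> e' -> cvgrow u x ->
  gwt (e m) (u m) @[m --> \oo] --> gwt e' x.
Proof.
move=> e0 e'0 ee ux; apply: cvgM; last exact: weps_cvg.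
apply: (@seqcont_comp1 _ _ expR (fun x => - sqn x / (4 * t)) (@continuous_expR R)) ux.
by move=> v y vy; apply: cvgMl; apply: cvgN; exact: seqcont_sqn.
Qed.

Lemma seqcont_gwt e : 0 <= e -> seqcont (gwt e).
Proof. by move=> e0 u x ux; apply: gwt_cvg => //; exact: cvg_cst. Qed.

Lemma nice_gwt e p : 0 <= e <= 1 -> polyf p -> nice (fun x => p x * gwt e x).
Proof.
move=> e01 pp; split.
  by apply: seqcontM; [exact: polyf_seqcont|apply: seqcont_gwt; case/andP: e01].
by have [c [d [d0 h]]] := gwt_gb pp; exists c, d; split => //; exact: h.
Qed.

(** For e > 0 the weight is the exponential of a smooth function, and the product over roots becomes
    a sum, to which [sum_pos_refl] and the sum rule for derivatives apply. *)
Lemma gwt_exp e x : 0 < e ->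
  gwt e x = expR (- sqn x / (4 * t) + \sum_(a <- Rp) k a * ln (dot a x ^+ 2 + e)).
Proof.
move=> e0; rewrite /gwt expRD expR_sum; congr (_ * _); apply: eq_bigr => a _.
by rewrite /powR gt_eqF // arg_gt0.
Qed.

Lemma gwt_refl e a x : 0 < e -> a \in Rp -> gwt e (refl a x) = gwt e x.
Proof.
move=> e0 aR; have aR' := pos_root aR; have a2 := pos_norm rootRs aR.
rewrite !gwt_exp // sqn_refl //; congr (expR (_ + _)).
pose g c := k c * ln (dot c x ^+ 2 + e).
rewrite -(sum_pos_refl (g := g) rootRs regb aR'); last first.
  by move=> c cR; rewrite /g (k_opp rootRs multk) // dotNl sqrrN.
rewrite big_seq [RHS]big_seq; apply: eq_bigr => c cR; rewrite /g.
rewrite (k_refl multk) ?(pos_root cR) //.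
by rewrite -(dot_refl c (refl a x) a2) (reflK a2).
Qed.

(** Half of the derivative of ln (u^2 + e) at u = <a,x>: for e > 0 a bounded, odd substitute for
    1/<a,x>. *)
Definition ratio e a x : R := dot a x / (dot a x ^+ 2 + e).

Lemma dirder_gwt i e p : 0 < e -> polyf p ->
  dirder i (fun x => p x * gwt e x) (fun x =>
    pd i p x * gwt e x + (- (2 * t)^-1) * (x 0 i * p x * gwt e x)
    + \sum_(a <- Rp) 2 * k a * a 0 i * (p x * gwt e x * ratio e a x)).
Proof.
move=> e0 pp.
have dl a : dirder i (fun x => ln (dot a x ^+ 2 + e))
    (fun x => (dot a x ^+ 2 + e)^-1 * (2%:R * dot a x ^+ 1 * a 0 i + 0)).
  apply: (dirder_comp (phi := @ln R) (phi' := fun z => z^-1)).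
    by move=> x; apply: is_derive1_ln; exact: arg_gt0.
  apply: dirderD; last exact: dirder_cst.
  exact: (dirder_X 2 (dirder_dot i a)).
have dE := dirderD (dirderZ (- (4 * t)^-1) (dirder_sqn i))
  (dirder_sum Rp (fun a => dirderZ (k a) (dl a))).
have := dirderM (dirder_poly i pp) (dirder_expR dE).
have gE : (fun x => expR (- (4 * t)^-1 * sqn x + \sum_(a <- Rp) k a * ln (dot a x ^+ 2 + e)))
    = gwt e.
  by apply/funext => x; rewrite gwt_exp // [- sqn x / _]mulNr [sqn x / _]mulrC mulNr.
have -> : (fun x => p x * expR (- (4 * t)^-1 * sqn x +
    \sum_(a <- Rp) k a * ln (dot a x ^+ 2 + e))) = fun x => p x * gwt e x.
  by rewrite -gE.
congr dirder; apply/funext => x.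
have -> : expR (- (4 * t)^-1 * sqn x + \sum_(a <- Rp) k a * ln (dot a x ^+ 2 + e)) = gwt e x.
  by rewrite -gE.
rewrite -addrA; congr (_ + _); rewrite !mulrDr; congr (_ + _).
  by field; rewrite gt_eqF.
rewrite !mulr_sumr; apply: eq_bigr => a _; rewrite /ratio addr0 expr1.
move: (_^-1) => z; ring.
Qed.

Lemma ratio_le e a x : 0 < e <= 1 -> `|ratio e a x| <= e^-1.
Proof.
move=> /andP[e0 e1]; have v0 := arg_gt0 a x e0.
rewrite /ratio normrM normfV (gtr0_norm v0) ler_pdivrMr // mulrC ler_pdivlMr //.
have := normr_ge0 (dot a x).
have : `|dot a x| ^+ 2 = dot a x ^+ 2 by rewrite real_normK ?num_real.
nra.
Qed.

Lemma seqcont_ratio e a : 0 < e -> seqcont (ratio e a).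
Proof.
move=> e0 u x ux; apply: cvgM; first exact: seqcont_dot.
apply: cvgV; first by rewrite gt_eqF // arg_gt0.
apply: cvgD; last exact: cvg_cst.
rewrite expr2; under eq_fun do rewrite expr2.
by apply: cvgM; exact: seqcont_dot.
Qed.

Lemma nice_ratio e a p : 0 < e <= 1 -> polyf p ->
  nice (fun x => p x * gwt e x * ratio e a x).
Proof.
move=> e01 pp; have /andP[e0 e1] := e01; apply: (@nice_mul_bounded _ _ _ _ e^-1).
- by apply: nice_gwt => //; rewrite ltW.
- exact: seqcont_ratio.
- by move=> x; exact: ratio_le.
Qed.

(** Under the reflection the weight is invariant and [ratio] changes sign, so adding the reflected
    form of the integral replaces 2 p by p - p o s, which is divisible by <a,x>. *)
Lemma iint_ratio e a p : 0 < e <= 1 -> a \in Rp -> polyf p ->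
  2 * iint (fun x => p x * gwt e x * ratio e a x) =
  iint (fun x => dot a x * dd a p x * gwt e x * ratio e a x).
Proof.
move=> e01 aR pp; have /andP[e0 e1] := e01; have a2 := pos_norm rootRs aR.
have np := nice_ratio a e01 pp; have nps := nice_ratio a e01 (polyf_refl a pp).
have dN x : dot a (refl a x) = - dot a x.
  by rewrite -(dot_refl a x a2) (reflN a2) dotNl opprK.
have E : iint (fun x => p x * gwt e x * ratio e a x) =
    -1 * iint (fun x => p (refl a x) * gwt e x * ratio e a x).
  rewrite -iintZ // -(iint_refl a2 np); congr iint; apply/funext => x.
  by rewrite gwt_refl // /ratio dN sqrrN; ring.
rewrite mulr_natl mulr2n {2}E -iintZ // -iintD //; last exact: niceZ.
congr iint; apply/funext => x; rewrite -(ddE x a2 pp); ring.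
Qed.

Lemma by_parts_eps i e p : 0 < e <= 1 -> polyf p ->
  iint (fun x => pd i p x * gwt e x)
  + (- (2 * t)^-1) * iint (fun x => x 0 i * p x * gwt e x)
  + \sum_(a <- Rp) a 0 i * iint (fun x => k a * dot a x * dd a p x * gwt e x * ratio e a x) = 0.
Proof.
move=> e01 pp; have /andP[e0 e1] := e01.
have e01' : 0 <= e <= 1 by rewrite ltW.
have n1 : nice (fun x => pd i p x * gwt e x) by apply: nice_gwt => //; exact: polyf_pd.
have n2 : nice (fun x => x 0 i * p x * gwt e x).
  by apply: nice_gwt => //; apply: polyfM => //; exact: polyf_coord.
have n3 a : nice (fun x => 2 * k a * a 0 i * (p x * gwt e x * ratio e a x)).
  by apply: niceZ; exact: nice_ratio.
have n4 : nice (fun x => - (2 * t)^-1 * (x 0 i * p x * gwt e x)) by exact: niceZ.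
have n5 := nice_sum Rp n3.
have := iint_derive (nice_gwt e01' pp) (niceD (niceD n1 n4) n5) (dirder_gwt i e0 pp).
rewrite iintD //; last exact: niceD.
rewrite iintD // iintZ // iint_sum // => h; rewrite -[RHS]h; congr (_ + _).
rewrite big_seq [RHS]big_seq; apply: eq_bigr => a aR.
have nr : nice (fun x => dot a x * dd a p x * gwt e x * ratio e a x).
  by apply: nice_ratio => //; apply: polyfM; [exact: polyf_dot|exact: polyf_dd].
rewrite iintZ; last exact: nice_ratio.
have -> : (fun x => k a * dot a x * dd a p x * gwt e x * ratio e a x) =
   fun x => k a * (dot a x * dd a p x * gwt e x * ratio e a x).
  by apply/funext => x; rewrite !mulrA.
rewrite iintZ // -iint_ratio //; ring.
Qed.

Lemma iint_gwt_cvg p : polyf p ->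
  iint (fun x => p x * gwt m.+1%:R^-1 x) @[m --> \oo] --> iint (fun x => p x * gwt 0 x).
Proof.
move=> pp; have [c [d [d0 h]]] := gwt_gb pp.
have e01 (m : nat) : 0 <= (m.+1%:R^-1 : R) <= 1.
  by rewrite invr_ge0 ler0n invf_le1 ?ler1n // ltr0n.
apply: (iint_dominated (c := c) d0).
- by move=> m; have [] := nice_gwt (e01 m) pp.
- by move=> m; exact: h.
- move=> x; apply: cvgMr; apply: gwt_cvg => //; last exact: cvgrow_cst.
  exact: cvg_harmonic.
Qed.

(** The product of <a,x> and [ratio] lies in [0,1], so the domination is uniform in e. The factor
    [k a] stays under the integral for the sake of pointwise convergence where <a,x> = 0: there
    either k a = 0 or the limit weight vanishes. *)
Lemma iint_ratio_cvg a p : a \in Rp -> polyf p ->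
  iint (fun x => k a * dot a x * p x * gwt m.+1%:R^-1 x * ratio m.+1%:R^-1 a x)
    @[m --> \oo] --> iint (fun x => k a * (p x * gwt 0 x)).
Proof.
move=> aR pp.
have e01 (m : nat) : 0 < (m.+1%:R^-1 : R) <= 1.
  by rewrite invr_gt0 ltr0n invf_le1 ?ler1n // ltr0n.
have [c [d [d0 h]]] := gwt_gb (polyfZ (k a) pp).
have pk : polyf (fun x => k a * dot a x * p x).
  by apply: polyfM => //; apply: polyfZ; exact: polyf_dot.
apply: (iint_dominated (c := c) d0).
- by move=> m; have [] := nice_ratio a (e01 m) pk.
- move=> m x; have /andP[e0 e1] := e01 m.
  apply: le_trans (h m.+1%:R^-1 _ x); last by rewrite ltW.
  rewrite (_ : _ * _ = k a * p x * gwt m.+1%:R^-1 x * (dot a x * ratio m.+1%:R^-1 a x)).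
    rewrite [X in X <= _]normrM ler_piMr //.
    rewrite /ratio mulrA -expr2 ger0_norm.
      by rewrite ler_pdivrMr ?arg_gt0 // mul1r lerDl ltW.
    by rewrite divr_ge0 ?sqr_ge0 // ltW // arg_gt0.
  by ring.
- move=> x.
  have [ax|ax] := eqVneq (dot a x) 0.
    have -> : k a * (p x * gwt 0 x) = 0.
      have [->|ka] := eqVneq (k a) 0; first by rewrite mul0r.
      rewrite /gwt /weps (_ : \prod_(c <- Rp) _ = 0) ?mulr0 //.
      rewrite (big_rem a) //= ax expr0n /= addr0 powR0 ?mul0r //.
    under eq_fun do rewrite ax mulr0 !mul0r.
    exact: cvg_cst.
  have -> : k a * (p x * gwt 0 x) = k a * dot a x * p x * gwt 0 x * ratio 0 a x.
    by rewrite /ratio addr0; field.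
  apply: cvgM.
    apply: cvgMr; apply: gwt_cvg => //; last exact: cvgrow_cst.
    exact: cvg_harmonic.
  apply: cvgMr; apply: cvgV; first by rewrite addr0 sqrf_eq0.
  by apply: cvgD; [exact: cvg_cst|exact: cvg_harmonic].
Qed.

Lemma nice_gwt0 p : polyf p -> nice (fun x => p x * gwt 0 x).
Proof. by apply: nice_gwt; rewrite lexx ler01. Qed.

Lemma iint_by_parts i p : polyf p ->
  iint (fun x => dT Rs b k i p x * gwt 0 x) = (2 * t)^-1 * iint (fun x => x 0 i * p x * gwt 0 x).
Proof.
move=> pp.
have px : polyf (fun x => x 0 i * p x) by apply: polyfM => //; exact: polyf_coord.
have ppd := polyf_pd i pp.
have H : iint (fun x => pd i p x * gwt 0 x)
  + (- (2 * t)^-1) * iint (fun x => x 0 i * p x * gwt 0 x)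
  + \sum_(a <- Rp) a 0 i * iint (fun x => k a * (dd a p x * gwt 0 x)) = 0.
  have sum_cvg (r : seq 'rV[R]_N) : {subset r <= Rp} ->
      \sum_(a <- r) a 0 i * iint (fun x => k a * dot a x * dd a p x *
         gwt m.+1%:R^-1 x * ratio m.+1%:R^-1 a x) @[m --> \oo] -->
      \sum_(a <- r) a 0 i * iint (fun x => k a * (dd a p x * gwt 0 x)).
    elim: r => [|a r IH] rR.
      by under eq_fun do rewrite big_nil; rewrite big_nil; exact: cvg_cst.
    under eq_fun do rewrite big_cons; rewrite big_cons.
    apply: cvgD; last by apply: IH => c cr; apply: rR; rewrite in_cons cr orbT.
    apply: cvgMr; apply: iint_ratio_cvg; last exact: polyf_dd.
    by apply: rR; rewrite mem_head.
  have c2 : - (2 * t)^-1 * iint (fun x => x 0 i * p x * gwt m.+1%:R^-1 x) @[m --> \oo] -->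
      - (2 * t)^-1 * iint (fun x => x 0 i * p x * gwt 0 x).
    by apply: cvgMr; exact: iint_gwt_cvg.
  have e01 (m : nat) : 0 < (m.+1%:R^-1 : R) <= 1.
    by rewrite invr_gt0 ltr0n invf_le1 ?ler1n // ltr0n.
  have c1 := iint_gwt_cvg ppd; have c3 := sum_cvg Rp (fun a h => h).
  move: c1 c2 c3; set lA := iint _; set lB := - _ * _; set lC := \sum_(a <- Rp) _.
  set A := fun m : nat => iint _; set B := fun m : nat => - _ * _.
  set C := fun m : nat => \sum_(a <- Rp) _ => c1 c2 c3.
  have cF : A m + B m + C m @[m --> \oo] --> lA + lB + lC.
    by apply: cvgD => //; exact: cvgD.
  have F0 : (fun m => A m + B m + C m) = fun=> 0.
    by apply/funext => m; exact: (by_parts_eps i (e01 m) pp).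
  rewrite F0 in cF.
  exact: (cvg_unique (@norm_hausdorff _ R) cF (cvg_cst 0)).
have E : (fun x => dT Rs b k i p x * gwt 0 x) = fun x => pd i p x * gwt 0 x +
    \sum_(a <- Rp) a 0 i * (k a * (dd a p x * gwt 0 x)).
  apply/funext => x; rewrite /dT mulrDl mulr_suml; congr (_ + _).
  by apply: eq_bigr => a _; ring.
have na a : nice (fun x => k a * (dd a p x * gwt 0 x)).
  by apply: niceZ; apply: nice_gwt0; exact: polyf_dd.
rewrite E iintD; first last.
- by apply: nice_sum => a; exact: niceZ.
- exact: nice_gwt0.
rewrite iint_sum; last by move=> a; exact: niceZ.
under eq_bigr do rewrite (iintZ _ (na _)).
move: H; set S := \sum_(a <- Rp) _; lra.
Qed.

Local Notation gi := (gauss_int Rp k t).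

Lemma gauss_intE f : gi f = ck Rp k / ((4 * t) `^ (gam Rp k + N%:R / 2)) *
  iint (fun x => f x * gwt 0 x).
Proof.
rewrite /gauss_int; congr (_ * _); congr iint; apply/funext => x.
by rewrite /gwt weps0 mulrA.
Qed.

Lemma gauss_int_lin c p q : polyf p -> polyf q ->
  gi (fun x => c * p x + q x) = c * gi p + gi q.
Proof.
move=> pp pq; rewrite !gauss_intE mulrCA -mulrDr; congr (_ * _).
rewrite -iintZ; last exact: nice_gwt0.
rewrite -iintD; [|by apply: niceZ; exact: nice_gwt0|exact: nice_gwt0].
by congr iint; apply/funext => x; rewrite mulrDl mulrA.
Qed.

Lemma gauss_int_dT i p : polyf p ->
  gi (dT Rs b k i p) = (2 * t)^-1 * gi (fun x => x 0 i * p x).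
Proof. by move=> pp; rewrite !gauss_intE iint_by_parts // mulrCA. Qed.

(** The dilation by the square root of 4t has Jacobian (4t)^(N/2), and the weight is homogeneous of
    degree 2 gam; together they give the exponent in the normalization. *)
Lemma gauss_int1 : gi (fun=> 1) = 1.
Proof.
rewrite gauss_intE; under eq_fun do rewrite mul1r.
have t40 : 0 < 4 * t by rewrite mulr_gt0.
pose s := Num.sqrt (4 * t).
have s0 : 0 < s by rewrite sqrtr_gt0.
have s2 : s ^+ 2 = 4 * t by rewrite sqr_sqrtr // ltW.
have n0 : nice (gwt 0).
  have := nice_gwt0 (polyf_cst 1); congr nice; apply/funext => x; exact: mul1r.
rewrite -(iint_scale s0 n0).
have psum (r : seq 'rV[R]_N) :
    (4 * t) `^ (\sum_(a <- r) k a) = \prod_(a <- r) (4 * t) `^ k a.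
  elim: r => [|a r IH]; first by rewrite !big_nil powRr0.
  by rewrite !big_cons powRD ?IH // (gt_eqF t40) implybT.
have gE x : gwt 0 (s *: x) = (4 * t) `^ gam Rp k * (expR (- sqn x) * wk Rp k x).
  rewrite /gwt sqnZ s2 mulrCA; congr (_ * _).
    by congr expR; field; rewrite gt_eqF.
  rewrite -weps0 /weps /gam psum -big_split /=.
  rewrite big_seq [RHS]big_seq; apply: eq_bigr => a aR.
  by rewrite !addr0 dotZr exprMn s2 (powRM _ (ltW t40) (sqr_ge0 _)).
have n1 : nice (fun x => expR (- sqn x) * wk Rp k x).
  have := niceZ ((4 * t) `^ gam Rp k)^-1 (nice_scale s0 n0).
  congr nice; apply/funext => x.
  by rewrite gE mulKf // gt_eqF // powR_gt0.
have I0 : 0 < iint (fun x => expR (- sqn x) * wk Rp k x).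
  (* The weight is positive at the regular vector [b], so the integral inverted in [ck] is not 0. *)
  apply: (iint_gt0 (x := b) n1).
    by move=> y; rewrite mulr_ge0 ?expR_ge0 // -weps0 weps_ge0.
  rewrite mulr_gt0 ?expR_gt0 // /wk big_seq prodr_gt0 // => a aR.
  by rewrite powR_gt0 // normr_gt0 regb // (pos_root aR).
under eq_fun do rewrite gE.
rewrite iintZ // /ck powRD; last by rewrite (gt_eqF t40) implybT.
have -> : (4 * t) `^ (N%:R / 2) = s ^+ N.
  by rewrite [N%:R / 2]mulrC powRrM powR12_sqrt ?(ltW t40) // powR_mulrn ?(ltW s0).
have g0 : (4 * t) `^ gam Rp k != 0 by rewrite gt_eqF // powR_gt0.
have sN : s ^+ N != 0 by rewrite expf_neq0 // gt_eqF.
move: I0 => /lt0r_neq0; set I := iint _ => I0.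
by field; rewrite I0 g0 sN.
Qed.

End DunklGaussian.

(** * Exponentials of operators that lower the degree by two *)

Section ExponentialOperator.
Context {R : realType} {N : nat}.
Local Notation F := ('rV[R]_N -> R).

(** The exponential of - t D, exact as soon as M exceeds the degree of [p]. One truncation for all
    degrees involved keeps it linear; D is abstract so as to cover both the classical and the Dunkl
    Laplacian. *)
Definition expo (D : F -> F) (t : R) (M : nat) (p : F) : F := fun x =>
  \sum_(j < M) (- t) ^+ j / j`!%:R * iter j D p x.

Context (D : F -> F) (t : R).
Context (Dpoly : forall p, polyf p -> polyf (D p)).
Context (Dlin : forall c p q, polyf p -> polyf q ->
  D (fun x => c * p x + q x) = fun x => c * D p x + D q x).
Context (Dhomog : forall l p, homog l.+2 p -> homog l (D p)).
Context (Dlow : forall l p, (l < 2)%N -> homog l p -> D p = fun=> 0).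

Lemma polyf_iter j p : polyf p -> polyf (iter j D p).
Proof. by move=> pp; elim: j => //= j; exact: Dpoly. Qed.

Lemma iter_lin j c p q : polyf p -> polyf q ->
  iter j D (fun x => c * p x + q x) = fun x => c * iter j D p x + iter j D q x.
Proof.
move=> pp pq; elim: j => //= j ->.
by rewrite Dlin //; exact: polyf_iter.
Qed.

Lemma polyf_expo M p : polyf p -> polyf (expo D t M p).
Proof. by move=> pp; apply: polyf_sum => j; apply: polyfZ; exact: polyf_iter. Qed.

Lemma expo_lin M c p q : polyf p -> polyf q ->
  expo D t M (fun x => c * p x + q x) = fun x => c * expo D t M p x + expo D t M q x.
Proof.
move=> pp pq; apply/funext => x; rewrite /expo mulr_sumr -big_split /=.
by apply: eq_bigr => j _; rewrite iter_lin //; ring.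
Qed.

Lemma iter_high j l p : homog l p -> (l < j)%N -> iter j D p = fun=> 0.
Proof.
elim: j l p => // j IH l p hp lj; rewrite iterSr.
have D0 i : iter i D (fun=> 0) = fun=> 0.
  by elim: i => //= i ->; apply: (@Dlow 0) => //; exact: homog0.
case: l hp lj => [|[|l]] hp lj.
- by rewrite (Dlow _ hp) // D0.
- by rewrite (Dlow _ hp) // D0.
- by apply: (IH l); [exact: Dhomog|exact: ltnW].
Qed.

Lemma expo_cst M c : expo D t M.+1 (fun=> c) = fun=> c.
Proof.
have hc : homog 0 (fun _ : 'rV[R]_N => c).
  have := homogZ c (homog_mono (R := R) ([ffun=> 0%N] : mi N)).
  by rewrite mabs0 mono0; congr homog; apply/funext => x; rewrite mulr1.
apply/funext => x; rewrite /expo big_ord_recl /= expr0 fact0 divr1 mul1r big1 ?addr0 //.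
by move=> j _; rewrite -iterS (iter_high hc) ?mulr0.
Qed.

Context (T : F -> F) (i : 'I_N).
Context (Tpoly : forall p, polyf p -> polyf (T p)).
Context (Thomog : forall l p, homog l p -> homog l.-1 (T p)).
Context (DT : forall p, polyf p -> D (T p) = T (D p)).
Context (DX : forall p, polyf p ->
  D (fun x => x 0 i * p x) = fun x => x 0 i * D p x + 2 * T p x).

Lemma iter_comm j p : polyf p -> iter j D (T p) = T (iter j D p).
Proof.
move=> pp; elim: j => //= j ->; apply: DT; exact: polyf_iter.
Qed.

(** T commutes with D, so the commutator [D, x_i] = 2 T passes through powers of D as through those
    of a variable under a derivation. *)
Lemma iter_X j p : polyf p -> iter j.+1 D (fun x => x 0 i * p x) =
  fun x => 2 * j.+1%:R * iter j D (T p) x + x 0 i * iter j.+1 D p x.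
Proof.
move=> pp; elim: j => [|j IH].
  by rewrite /= DX //; apply/funext => x; rewrite addrC mulr1.
rewrite iterS IH Dlin; first last.
- by apply: polyfM; [exact: polyf_coord|exact: polyf_iter].
- by apply: polyf_iter; exact: Tpoly.
rewrite DX; last exact: polyf_iter.
rewrite -(iter_comm j.+1 pp) -!iterS; apply/funext => x.
by rewrite -[j.+2%:R]natr1; ring.
Qed.

Lemma expo_X M l p : homog l p -> (l < M)%N ->
  expo D t M.+1 (fun x => x 0 i * p x) =
  fun x => x 0 i * expo D t M.+1 p x - 2 * t * expo D t M.+1 (T p) x.
Proof.
move=> hp lM; have pp := homog_polyf hp.
(* The commutator shifts the summation index by one, so the last term of the sum for T p has no
   partner; it vanishes because l < M. *)
have z : iter M D (T p) = fun=> 0.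
  by apply: (iter_high (Thomog hp)); exact: leq_ltn_trans (leq_pred l) lM.
apply/funext => x; rewrite /expo big_ord_recl [in X in _ * X - _]big_ord_recl.
rewrite [in X in _ - _ * X]big_ord_recr /= z mulr0 addr0.
rewrite mulrDr -addrA; congr (_ + _); first by rewrite mulrCA.
rewrite !mulr_sumr -sumrB; apply: eq_bigr => j _.
rewrite /bump /= add1n -iterS iter_X // exprS factS natrM.
have j0 : j.+1%:R != 0 :> R by rewrite pnatr_eq0.
have f0 : j`!%:R != 0 :> R by rewrite pnatr_eq0 -lt0n fact_gt0.
rewrite -iterS; move: (iter j D (T p) x) (iter j.+1 D p x) => u v.
move: (j.+1%:R : R) (j`!%:R : R) j0 f0 => J J' j0 f0.
by field; rewrite j0 f0.
Qed.

End ExponentialOperator.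

(** * Hermite polynomials as images of monomials under the classical heat operator *)

Section HermitePolynomials.
Context {R : realType} (t : R).

Definition a1 l : R :=
  if odd l then 0 else l`!%:R / (l./2)`!%:R * (- t) ^+ l./2.

Lemma a1_rec l : a1 l.+2 = - 2 * t * l.+1%:R * a1 l.
Proof.
rewrite /a1 /= negbK; case: (boolP (odd l)) => ol; first by rewrite mulr0.
rewrite !factS !natrM exprS.
have f0 : (l./2)`!%:R != 0 :> R by rewrite pnatr_eq0 -lt0n fact_gt0.
have l0 : (l./2).+1%:R != 0 :> R by rewrite pnatr_eq0.
have -> : l.+2%:R = 2 * (l./2).+1%:R :> R.
  rewrite -natrM; congr (_%:R); rewrite mulnS mul2n -[LHS]odd_double_half /= negbK.
  by rewrite (negbTE ol) /= add0n doubleS.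
move: ((l./2).+1%:R : R) ((l./2)`!%:R : R) l0 f0 => J J' l0 f0.
by field; rewrite l0 f0.
Qed.

Definition hcoef n m : R := 'C(n, m)%:R * a1 (n - m).

Lemma hcoef_rec0 n : hcoef n.+1 0 = - 2 * t * n%:R * hcoef n.-1 0.
Proof.
rewrite /hcoef !bin0 !mul1r !subn0; case: n => [|n]; last exact: a1_rec.
by rewrite /a1 /= mulr0 mul0r.
Qed.

(** Pascal's rule yields the first term; the second follows from [a1_rec] and the absorption of a
    factor into the binomial coefficient. *)
Lemma hcoef_recS n m : hcoef n.+1 m.+1 = hcoef n m - 2 * t * n%:R * hcoef n.-1 m.+1.
Proof.
rewrite /hcoef subSS binS natrD mulrDl addrC; congr (_ + _).
have [mn|nm] := leqP n m.
  rewrite bin_small ?ltnS // (@bin_small n.-1) ?mul0r ?mulr0 ?oppr0 //.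
  by rewrite ltnS (leq_trans (leq_pred n)).
case: n nm => // n; rewrite ltnS leq_eqVlt => /predU1P[->|mn].
  by rewrite subSnn /a1 /= mulr0 bin_small // mul0r mulr0 oppr0.
have E : (n.+1 - m)%N = (n - m.+1).+2 by rewrite subSn ?(ltnW mn) // -(subnSK mn).
rewrite /= E a1_rec.
have B : (n - m.+1).+1%:R * 'C(n.+1, m.+1)%:R = n.+1%:R * 'C(n, m.+1)%:R :> R.
  rewrite -!natrM; congr (_%:R); have := mul_bin_down n.+1 m.+1.
  by rewrite subSS /= => ->; rewrite subnSK.
rewrite (_ : 'C(n.+1, m.+1)%:R * _ =
   - 2 * t * a1 (n - m.+1) * ((n - m.+1).+1%:R * 'C(n.+1, m.+1)%:R)); last by ring.
by rewrite B; ring.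
Qed.

(** The one-variable heat polynomial exp(- t d^2/dz^2) z^n, a rescaled Hermite polynomial. *)
Definition h1 n (z : R) := \sum_(m < n.+1) hcoef n m * z ^+ m.

Lemma h1_widen B n z : (n < B)%N -> h1 n z = \sum_(m < B) hcoef n m * z ^+ m.
Proof.
move=> nB; rewrite /h1 (big_ord_widen B (fun m => hcoef n m * z ^+ m)) //.
rewrite [RHS](bigID (fun m : 'I_B => m < n.+1)%N) /= [X in _ + X]big1 ?addr0 //.
by move=> m; rewrite -leqNgt => nm; rewrite /hcoef bin_small // !mul0r.
Qed.

Lemma h1_rec n z : h1 n.+1 z = z * h1 n z - 2 * t * n%:R * h1 n.-1 z.
Proof.
rewrite (@h1_widen n.+2 n.-1); last by rewrite ltnS (leq_trans (leq_pred n)).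
rewrite /h1 (big_ord_recl n.+1) [X in _ = _ - _ * X](big_ord_recl n.+1) /= !expr0.
rewrite !mulr1 hcoef_rec0.
rewrite (_ : \sum_(i < n.+1) hcoef n.+1 (bump 0 i) * z ^+ bump 0 i =
  z * (\sum_(i < n.+1) hcoef n i * z ^+ i)
  - 2 * t * n%:R * \sum_(i < n.+1) hcoef n.-1 (bump 0 i) * z ^+ bump 0 i); first by ring.
rewrite !mulr_sumr -sumrB; apply: eq_bigr => m _; rewrite /bump /= add1n hcoef_recS.
by rewrite exprS; ring.
Qed.

Context {N : nat}.

Definition hermite (nu : mi N) (x : 'rV[R]_N) : R :=
  \sum_(m : {ffun 'I_N -> 'I_(mabs nu).+1} | [forall i, (m i <= nu i)%N])
     (\prod_(i < N) 'C(nu i, m i))%:R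
       * acoef [ffun i => (nu i - m i)%N] t * mono (mi_of m) x.

Lemma acoef_prod (l : mi N) : acoef l t = \prod_(i < N) a1 (l i).
Proof.
rewrite /acoef; case: ifP => [/forallP el|/negbT].
  have E i : a1 (l i) = (l i)`!%:R / ((l i)./2)`!%:R * (- t) ^+ (l i)./2.
    by rewrite /a1 (negbTE (el i)).
  under [RHS]eq_bigr do rewrite E.
  rewrite big_split /= big_split /= prodfV !natr_prod; congr (_ * _).
  rewrite prodrXr; congr (_ ^+ _); rewrite /mabs.
  have os : ~~ odd (\sum_(i < N) l i).
    by rewrite (big_morph odd oddD (erefl _)) big1 // => i _; exact/negbTE.
  apply: double_inj; rewrite (even_halfK os) -muln2 big_distrl /=.
  by apply: eq_bigr => i _; rewrite muln2 even_halfK.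
rewrite negb_forall => /existsP[i]; rewrite negbK => oi.
by rewrite (bigD1 i) //= /a1 oi mul0r.
Qed.

(** Binomials and [acoef] factor over the coordinates, and the vanishing of binomials lets the
    constraint m <= nu be dropped, so a product of sums can be expanded. *)
Lemma hermite_prod nu x : hermite nu x = \prod_(i < N) h1 (nu i) (x 0 i).
Proof.
transitivity (\prod_(i < N) \sum_(m < (mabs nu).+1) hcoef (nu i) m * x 0 i ^+ m).
  rewrite bigA_distr_bigA /= /hermite [RHS](bigID (fun m : {ffun 'I_N -> 'I_(mabs nu).+1} =>
    [forall i, (m i <= nu i)%N])) /= [X in _ = _ + X]big1 ?addr0 => [|m].
    apply: eq_bigr => m _; rewrite acoef_prod /mono natr_prod -!big_split /=.
    by apply: eq_bigr => i _; rewrite !ffunE.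
  rewrite negb_forall => /existsP[i]; rewrite -ltnNge => mi.
  by rewrite (bigD1 i) //= /hcoef bin_small // !mul0r.
by apply: eq_bigr => i _; rewrite -h1_widen // ltnS mabs_ge.
Qed.

Lemma hermite_rec i nu x : hermite (mincr i nu) x =
  x 0 i * hermite nu x - 2 * t * ((nu i)%:R * hermite (mdecr i nu) x).
Proof.
rewrite !hermite_prod (bigD1 i) //= (bigD1 (F := fun j => h1 (nu j) (x 0 j)) i) //=.
rewrite (bigD1 (F := fun j => h1 (mdecr i nu j) (x 0 j)) i) //=.
rewrite !ffunE eqxx addn1 subn1 h1_rec.
have -> : \prod_(j < N | j != i) h1 (mincr i nu j) (x 0 j) =
    \prod_(j < N | j != i) h1 (nu j) (x 0 j).
  by apply: eq_bigr => j /negbTE ji; rewrite ffunE ji addn0.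
have -> : \prod_(j < N | j != i) h1 (mdecr i nu j) (x 0 j) =
    \prod_(j < N | j != i) h1 (nu j) (x 0 j).
  by apply: eq_bigr => j /negbTE ji; rewrite ffunE ji subn0.
by ring.
Qed.

Definition Lap0 (p : 'rV[R]_N -> R) : 'rV[R]_N -> R := fun x => \sum_i pd i (pd i p) x.

Lemma polyf_Lap0 p : polyf p -> polyf (Lap0 p).
Proof. by move=> pp; apply: polyf_sum => i; do 2! apply: polyf_pd. Qed.

Lemma Lap0_lin c p q : polyf p -> polyf q ->
  Lap0 (fun x => c * p x + q x) = fun x => c * Lap0 p x + Lap0 q x.
Proof.
move=> pp pq; apply/funext => x; rewrite /Lap0 mulr_sumr -big_split /=.
by apply: eq_bigr => i _; rewrite pd_lin // pd_lin //; exact: polyf_pd.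
Qed.

Lemma Lap0_homog l p : homog l.+2 p -> homog l (Lap0 p).
Proof. by move=> hp; apply: homog_sum => i; do 2! apply: homog_pd. Qed.

Lemma pd0 i : pd i (fun _ : 'rV[R]_N => 0) = fun=> 0.
Proof. exact: homog_pd0 (homog0 0). Qed.

Lemma Lap0_low l p : (l < 2)%N -> homog l p -> Lap0 p = fun=> 0.
Proof.
move=> l2 hp; apply/funext => x; rewrite /Lap0 big1 // => i _.
case: l hp l2 => [|[|//]] hp _; first by rewrite (homog_pd0 i hp) pd0.
by rewrite (homog_pd0 i (homog_pd i hp)).
Qed.

Lemma homog_pd_pred i l (p : 'rV[R]_N -> R) : homog l p -> homog l.-1 (pd i p).
Proof.
case: l => [hp|l hp]; last exact: homog_pd.
by rewrite (homog_pd0 i hp); exact: homog0.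
Qed.

Lemma Lap0_pd i p : polyf p -> Lap0 (pd i p) = pd i (Lap0 p).
Proof.
move=> pp; rewrite [in RHS]/Lap0 pd_sum; last by move=> j; do 2! apply: polyf_pd.
apply/funext => x; apply: eq_bigr => j _.
by rewrite (pd_comm j i pp) (pd_comm j i (polyf_pd j pp)).
Qed.

Lemma Lap0_coordM j p : polyf p ->
  Lap0 (fun x => x 0 j * p x) = fun x => x 0 j * Lap0 p x + 2 * pd j p x.
Proof.
move=> pp; apply/funext => x; rewrite {1}/Lap0.
have E i : pd i (pd i (fun x => x 0 j * p x)) x =
    x 0 j * pd i (pd i p) x + 2 * (j == i)%:R * pd i p x.
  rewrite pd_coordM // pd_lin //; last first.
    by apply: polyfM; [exact: polyf_coord|exact: polyf_pd].
  rewrite pd_coordM; last exact: polyf_pd.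
  by move: (pd i p x) (pd i (pd i p) x) => u v; ring.
under eq_bigr do rewrite E.
rewrite big_split /= -mulr_sumr; congr (_ + _).
rewrite (bigD1 j) //= eqxx mulr1 big1 ?addr0 // => i ij.
by rewrite eq_sym (negbTE ij) mulr0 mul0r.
Qed.

(** [expo_X] for the classical Laplacian and [hermite_rec] are the same recurrence, so the two sides
    agree by induction on the degree. *)
Lemma expo_mono M nu : (mabs nu <= M)%N -> expo Lap0 t M.+1 (mono nu) = hermite nu.
Proof.
move: {2}(mabs nu).+1 (ltnSn (mabs nu)) => n.
elim: n nu => // n IH nu; rewrite ltnS => nun nuM.
have [n0|n0] := eqVneq (mabs nu) 0%N.
  rewrite (mabs_eq0 n0) mono0.
  rewrite (expo_cst t Lap0_homog Lap0_low); apply/funext => x.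
  rewrite hermite_prod big1 // => i _; rewrite ffunE /h1 big_ord1 /hcoef /a1 /=.
  by rewrite ?bin0 ?expr0 ?fact0 ?divr1 ?mulr1 ?mul1r ?mulr1.
have [i nui] : exists i, (0 < nu i)%N.
  apply/existsP; rewrite -[X in is_true X]negbK negb_exists; apply/negP => /forallP h.
  move/eqP: n0; apply; rewrite /mabs big1 // => i _.
  by have := h i; rewrite -eqn0Ngt => /eqP.
set mu := mdecr i nu.
have nuE : nu = mincr i mu by rewrite mdecrK.
have muN : mabs nu = (mabs mu).+1 by rewrite nuE mabs_incr.
have -> : mono nu = fun x : 'rV[R]_N => x 0 i * mono mu x.
  by apply/funext => x; rewrite nuE mono_incr.
rewrite (expo_X t polyf_Lap0 Lap0_lin Lap0_homog Lap0_low (T := pd i) (i := i)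
  (polyf_pd i) (@homog_pd_pred i) (Lap0_pd i) (Lap0_coordM i) (homog_mono mu)); last first.
  by rewrite -muN.
rewrite IH; [|by rewrite -muN|by rewrite ltnW // -muN].
apply/funext => x; rewrite [in RHS]nuE hermite_rec; congr (_ - _ * _).
rewrite pd_mono; have [->|mui] := eqVneq (mu i) 0%N.
  rewrite mul0r; rewrite (_ : (fun x => _) = fun=> 0); last first.
    by apply/funext => y; rewrite mul0r.
  by rewrite (expo_cst t Lap0_homog Lap0_low).
have pm := polyf_mono (R := R) (mdecr i mu).
have E : (fun x => (mu i)%:R * mono (mdecr i mu) x) =
    fun x : 'rV[R]_N => (mu i)%:R * mono (mdecr i mu) x + 0.
  by apply/funext => y; rewrite addr0.
have mm : mabs mu = (mabs (mdecr i mu)).+1 by rewrite -(mabs_incr i) mdecrK ?lt0n.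
rewrite E (expo_lin t polyf_Lap0 Lap0_lin _ _ pm (polyf_cst 0)).
rewrite (expo_cst t Lap0_homog Lap0_low) addr0 IH //.
  by rewrite (leq_trans _ nun) // muN mm leqnSn.
by rewrite (leq_trans _ nuM) // muN mm ltnW // leqnSn.
Qed.

End HermitePolynomials.

(** * Coefficient comparison for power series with a Gaussian factor *)

Section SeriesCoefficients.
Context {R : realType}.
Implicit Types (a d : nat -> R) (c : R) (p : {poly R}) (s : R).

Lemma horner_bounded p : exists B, forall s, `|s| <= 1 -> `|p.[s]| <= B.
Proof.
exists (\sum_(i < size p) `|p`_i|) => s s1; rewrite horner_coef.
apply: le_trans (ler_norm_sum _ _ _) _; apply: ler_sum => i _.
by rewrite normrM normrX ler_piMr // exprn_ile1.
Qed.

Lemma coef_bigO M p C dl : 0 < dl ->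
  (forall s, 0 < `|s| <= dl -> `|p.[s]| <= C * `|s| ^+ M) ->
  forall n, (n < M)%N -> p`_n = 0.
Proof.
elim: M p C dl => // M IH p; elim/poly_ind: p => [|q c _] C dl dl0 hp n nM.
  by rewrite coef0.
have [B hB] := horner_bounded q.
have c0 : c = 0.
  apply/eqP; rewrite -normr_le0; apply/ler_addgt0Pr => e e0; rewrite add0r.
  have C0 : 0 <= `|C| + `|B| by rewrite addr_ge0.
  (* Since s <= 1, both the bound on p(s) and the product q(s) s are at most a constant times s,
     which the last entry of the minimum keeps below [e]. *)
  pose s := Num.min (Num.min dl 1) (e / (`|C| + `|B| + 1)).
  have s0 : 0 < s by rewrite !lt_min dl0 ltr01 divr_gt0 // ltr_wpDl.
  have sdl : s <= dl by rewrite !ge_min lexx.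
  have s1 : s <= 1 by rewrite !ge_min lexx orbT.
  have se : s <= e / (`|C| + `|B| + 1) by rewrite ge_min lexx orbT.
  have ns : `|s| = s by rewrite gtr0_norm.
  have := hp s; rewrite ns s0 sdl => /(_ isT); rewrite hornerMXaddC => h1.
  have h2 : `|q.[s] * s| <= `|B| * s.
    rewrite normrM ns ler_wpM2r ?(ltW s0) // (le_trans _ (ler_norm B)) // hB //.
    by rewrite ns.
  have h3 : C * s ^+ M.+1 <= `|C| * s.
    rewrite exprS mulrA (le_trans (ler_norm _)) // normrM normrX ns normrM ns.
    by rewrite ler_piMr ?mulr_ge0 ?(ltW s0) // exprn_ile1 ?(ltW s0).
  have h4 : `|c| <= (`|C| + `|B|) * s.
    rewrite (_ : c = q.[s] * s + c - q.[s] * s); last by rewrite addrC addKr.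
    rewrite (le_trans (ler_normB _ _)) // mulrDl lerD //; exact: le_trans h1 h3.
  apply: le_trans h4 _; apply: le_trans (_ : (`|C| + `|B| + 1) * s <= _).
    by rewrite ler_wpM2r ?(ltW s0) // lerDl.
  by rewrite mulrC -ler_pdivlMr // ltr_wpDl.
rewrite c0 addr0 coefMX; case: n nM => // n nM /=.
apply: (IH q C dl dl0) => // s /andP[s0 sdl].
have := hp s; rewrite s0 sdl => /(_ isT); rewrite c0 addr0 hornerMX normrM exprSr mulrA.
by rewrite ler_pM2r.
Qed.

Lemma partial_sum_bigO a s0 B s M K : 0 < s0 -> (forall n, `|a n| * s0 ^+ n <= B) ->
  `|s| <= s0 / 2 ->
  `|\sum_(0 <= n < M + K) a n * s ^+ n - \sum_(0 <= n < M) a n * s ^+ n|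
    <= 2 * B / s0 ^+ M * `|s| ^+ M.
Proof.
move=> s00 hB ss.
have B0 : 0 <= B by apply: le_trans (hB 0%N); rewrite mulr_ge0 // exprn_ge0 // ltW.
pose r := `|s| / s0.
have r0 : 0 <= r by rewrite divr_ge0 // ltW.
have r2 : r <= 2^-1 by rewrite ler_pdivrMr // mulrC.
have term n : `|a n * s ^+ n| <= B * r ^+ n.
  rewrite normrM normrX expr_div_n mulrA ler_pdivlMr ?exprn_gt0 //.
  by rewrite mulrAC ler_wpM2r // exprn_ge0.
have -> : 2 * B / s0 ^+ M * `|s| ^+ M = B * r ^+ M * 2.
  by rewrite expr_div_n; field; rewrite expf_neq0 // gt_eqF.
(* The bound is sharpened by the part of the geometric series not yet summed, so that induction on K
   closes. *)
suff H : `|\sum_(0 <= n < M + K) a n * s ^+ n - \sum_(0 <= n < M) a n * s ^+ n|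
    <= B * r ^+ M * (2 - 2^-1 ^+ K * 2).
  apply: le_trans H _; rewrite ler_wpM2l ?mulr_ge0 ?exprn_ge0 //.
  by rewrite lerBlDr lerDl mulr_ge0 // exprn_ge0.
elim: K => [|K IH]; first by rewrite addn0 subrr normr0 expr0 mul1r subrr mulr0.
rewrite addnS big_nat_recr //= addrAC.
apply: le_trans (ler_normD _ _) _; apply: le_trans (lerD IH (term _)) _.
rewrite exprD mulrA -mulrDr ler_wpM2l ?mulr_ge0 ?exprn_ge0 //.
have : r ^+ K <= 2^-1 ^+ K by rewrite lerXn2r // nnegrE.
rewrite exprS; set u := 2^-1 ^+ K; lra.
Qed.

Lemma cvg_terms_bounded a s0 : cvgn (series (fun n => a n * s0 ^+ n)) ->
  exists B, forall n, `|a n| * `|s0| ^+ n <= B.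
Proof.
move=> cs0; have := cvg_seq_bounded (cvgP _ (cvg_series_cvg_0 cs0)).
move=> [B0 [_ hB]]; exists (B0 + 1) => n.
have := hB (B0 + 1); rewrite ltrDl ltr01 => /(_ isT n I) /=.
by rewrite normrM normrX.
Qed.

Lemma bounded_terms_cvg a s0 B s : 0 < s0 -> (forall n, `|a n| * s0 ^+ n <= B) ->
  `|s| <= s0 / 2 -> cvgn (series (fun n => a n * s ^+ n)).
Proof.
move=> s00 hB ss; apply: normed_cvg.
have B0 : 0 <= B by apply: le_trans (hB 0%N); rewrite mulr_ge0 // exprn_ge0 // ltW.
apply: (@series_le_cvg _ _ (geometric B 2^-1)).
- by move=> n; exact: normr_ge0.
- by move=> n; rewrite /geometric /= mulr_ge0 // exprn_ge0.
- move=> n; rewrite /geometric /= normrM normrX.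
  have : `|s| ^+ n <= (s0 / 2) ^+ n by rewrite lerXn2r // nnegrE // divr_ge0 // ltW.
  move=> /(ler_wpM2l (normr_ge0 (a n))) /le_trans; apply.
  by rewrite exprMn mulrA ler_wpM2r // exprn_ge0.
- by apply: is_cvg_geometric_series; rewrite ger0_norm // invf_lt1 // ltr1n.
Qed.

(** An asymptotic expansion at 0 to any order, obtained by letting the number of terms in
    [partial_sum_bigO] tend to infinity. *)
Lemma series_bigO a (f : R -> R) s0 s1 B : 0 < s0 -> 0 < s1 ->
  (forall n, `|a n| * s0 ^+ n <= B) ->
  (forall s, 0 < `|s| <= s1 -> series (fun n => a n * s ^+ n) @ \oo --> f s) ->
  forall M, exists C dl, 0 < dl /\ forall s, 0 < `|s| <= dl ->
    `|f s - (\poly_(n < M) a n).[s]| <= C * `|s| ^+ M.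
Proof.
move=> s00 s10 hB fs M.
exists (2 * B / s0 ^+ M), (Num.min (s0 / 2) s1); split.
  by rewrite lt_min divr_gt0.
move=> s /andP[sp]; rewrite le_min => /andP[ss ss1].
have cf := fs s; rewrite sp ss1 in cf; have {}cf := cf isT.
have E : (\poly_(n < M) a n).[s] = \sum_(0 <= n < M) a n * s ^+ n.
  by rewrite horner_poly big_mkord.
rewrite E.
have cn : `|series (fun n => a n * s ^+ n) n - \sum_(0 <= n < M) a n * s ^+ n|
    @[n --> \oo] --> `|f s - \sum_(0 <= n < M) a n * s ^+ n|.
  by apply: cvg_norm; apply: cvgB => //; exact: cvg_cst.
apply: (ler_cvg_to cn (cvg_cst (2 * B / s0 ^+ M * `|s| ^+ M))).
near=> n; have Mn : (M <= n)%N by near: n; exact: nbhs_infty_ge.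
by rewrite /series /= -(subnKC Mn); exact: partial_sum_bigO.
Unshelve. all: by end_near. Qed.

(* The coefficients of the power series of [expR (- c * s ^+ 2)]. *)
Definition ecoef (c : R) n : R :=
  if odd n then 0 else (- c) ^+ n./2 / (n./2)`!%:R.

Lemma ecoef_poly c M s : (\poly_(n < M.*2) ecoef c n).[s] =
  (\poly_(n < M) (n`!%:R)^-1).[- c * s ^+ 2].
Proof.
rewrite !horner_poly; elim: M => [|M IH]; first by rewrite !big_ord0.
rewrite doubleS !big_ord_recr /= IH -addrA; congr (_ + _).
rewrite /ecoef /= odd_double /= mul0r addr0 doubleK exprMn -exprM -mul2n.
by rewrite mulrAC mulrC mulrA.
Qed.

(** Substitute u = - c s^2 in the expansion of exp u; for |s| <= 1 the crude estimate |u| <= |c| |s|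
    already gives order M. *)
Lemma expR_bigO c M : exists C dl, 0 < dl /\ forall s, 0 < `|s| <= dl ->
  `|expR (- c * s ^+ 2) - (\poly_(n < M.*2) ecoef c n).[s]| <= C * `|s| ^+ M.
Proof.
pose a n : R := (n`!%:R)^-1.
have sE s : series (fun n => a n * s ^+ n) = series (exp_coeff s).
  by congr series; apply/funext => n; rewrite /a /exp_coeff /= mulrC.
have cs s : series (fun n => a n * s ^+ n) @ \oo --> expR s.
  by rewrite sE; exact: is_cvg_series_exp_coeff.
have aB n : `|a n| * 1 ^+ n <= 1.
  rewrite expr1n mulr1 ger0_norm ?invr_ge0 // invf_le1 ?ltr0n ?fact_gt0 //.
  by rewrite ler1n fact_gt0.
have [C [dl [dl0 h]]] := series_bigO ltr01 ltr01 aB (fun s _ => cs s) M.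
exists (`|C| * `|c| ^+ M), (Num.min 1 (dl / (`|c| + 1))).
have c1 : 0 < `|c| + 1 by rewrite ltr_wpDl.
split; first by rewrite lt_min ltr01 divr_gt0.
move=> s /andP[s0]; rewrite le_min => /andP[s1 sdl]; rewrite ecoef_poly.
have ns2 : `|- c * s ^+ 2| <= `|c| * `|s|.
  rewrite normrM normrN normrX expr2 mulrA ler_piMr // mulr_ge0 //.
(* For c = 0 the substituted point is 0, which the expansion of exp excludes. *)
have [c0|c0] := eqVneq c 0.
  rewrite c0 oppr0 mul0r expR0 horner_poly normr0 /a.
  case: M h => [|M] h.
    rewrite big_ord0 subr0 normr1 !expr0 !mulr1.
    have := h (Num.min 1 dl); rewrite horner_poly big_ord0 subr0 expr0 mulr1.
    have m0 : 0 < Num.min 1 dl by rewrite lt_min ltr01.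
    rewrite (gtr0_norm m0) m0 ge_min lexx orbT => /(_ isT) h1.
    apply: le_trans (ler_norm _); apply: le_trans h1.
    by rewrite ger0_norm ?expR_ge0 // (le_trans _ (expR_ge1Dx _)) // lerDl ltW.
  rewrite big_ord_recl /= expr0 fact0 invr1 mulr1 big1 => [|j _]; last first.
    by rewrite expr0n /= mulr0.
  by rewrite addr0 subrr normr0 expr0n /= mulr0 mul0r.
have u0 : 0 < `|- c * s ^+ 2|.
  by rewrite normr_gt0 mulf_neq0 ?oppr_eq0 ?expf_neq0 // -normr_gt0.
have := h (- c * s ^+ 2); rewrite u0 /=.
have -> : `|- c * s ^+ 2| <= dl.
  apply: le_trans ns2 _; apply: le_trans (_ : (`|c| + 1) * `|s| <= _).
    by rewrite ler_wpM2r // lerDl.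
  by rewrite mulrC -ler_pdivlMr.
move=> /(_ isT) h1; apply: le_trans h1 _.
apply: le_trans (_ : `|C| * `|- c * s ^+ 2| ^+ M <= _).
  by rewrite ler_wpM2r ?exprn_ge0 // ler_norm.
rewrite -mulrA ler_wpM2l // -exprMn lerXn2r ?nnegrE ?mulr_ge0 //.
Qed.

Lemma bigO_mul M (f g : R -> R) (p q : {poly R}) :
  (exists C dl, 0 < dl /\ forall s, 0 < `|s| <= dl -> `|f s - p.[s]| <= C * `|s| ^+ M) ->
  (exists C dl, 0 < dl /\ forall s, 0 < `|s| <= dl -> `|g s - q.[s]| <= C * `|s| ^+ M) ->
  exists C dl, 0 < dl /\ forall s, 0 < `|s| <= dl ->
    `|f s * g s - (p * q).[s]| <= C * `|s| ^+ M.
Proof.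
move=> [C [d1 [d10 h1]]] [C' [d2 [d20 h2]]].
have [B hB] := horner_bounded p; have [B' hB'] := horner_bounded q.
exists (`|C| * (`|B'| + `|C'|) + `|B| * `|C'|), (Num.min 1 (Num.min d1 d2)).
split; first by rewrite !lt_min ltr01 d10.
move=> s /andP[s0]; rewrite !le_min => /and3P[s1 sd1 sd2].
have {}h1 : `|f s - p.[s]| <= `|C| * `|s| ^+ M.
  by apply: le_trans (h1 s _) _; rewrite ?s0 // ler_wpM2r ?exprn_ge0 // ler_norm.
have {}h2 : `|g s - q.[s]| <= `|C'| * `|s| ^+ M.
  by apply: le_trans (h2 s _) _; rewrite ?s0 // ler_wpM2r ?exprn_ge0 // ler_norm.
have sM : `|s| ^+ M <= 1 by rewrite exprn_ile1.
have hg : `|g s| <= `|B'| + `|C'|.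
  rewrite (_ : g s = q.[s] + (g s - q.[s])); last by rewrite addrC subrK.
  apply: le_trans (ler_normD _ _) _; rewrite lerD //.
    exact: le_trans (hB' _ s1) (ler_norm _).
  by apply: le_trans h2 _; rewrite ler_piMr.
have hp : `|p.[s]| <= `|B| by exact: le_trans (hB _ s1) (ler_norm _).
rewrite hornerM (_ : _ - _ = (f s - p.[s]) * g s + p.[s] * (g s - q.[s])); last by ring.
apply: le_trans (ler_normD _ _) _; rewrite !normrM mulrDl lerD //.
  by rewrite mulrAC ler_pM.
by rewrite -mulrA ler_pM.
Qed.

(** Convergence of the series of [d] is not among the hypotheses. Once it holds at one nonzero
    point, both sides have asymptotic expansions at 0 to every order, and these determine the
    coefficients. *)
Lemma coef_cauchy (a d : nat -> R) (c : R) :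
  (forall s, series (fun n => a n * s ^+ n) @ \oo -->
     expR (- c * s ^+ 2) * limn (series (fun n => d n * s ^+ n))) ->
  d 0%N = 1 ->
  forall n, a n = \sum_(i < n.+1) ecoef c i * d (n - i)%N.
Proof.
move=> ha d0 n.
have a0 : a 0%N = 1.
  have E (w : nat -> R) : series (fun n => w n * 0 ^+ n) @ \oo --> w 0%N.
    rewrite -(cvg_shiftS (series _)).
    under eq_fun => m.
      rewrite /series /= big_nat_recl //= expr0 mulr1 big1 ?addr0; first over.
      by move=> i _; rewrite exprS mul0r mulr0.
    exact: cvg_cst.
  have := ha 0; rewrite (cvg_lim (@norm_hausdorff _ R) (E d)) d0 expr0n /= mulr0 expR0 mulr1.
  by move=> h; exact: (cvg_unique (@norm_hausdorff _ R) (E a) h).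
have [B aB] := cvg_terms_bounded (cvgP _ (ha 1)); rewrite normr1 in aB.
have fa := series_bigO ltr01 ltr01 aB (fun s _ => ha s).
(* If the series diverged at every nonzero point, [limn] would take its default value 0, the series
   of [a] would have sum 0 near 0, and a_0 would be 0, whereas evaluation at s = 0 gave a_0 = 1. *)
have [s0 s00 cs0] : exists2 s0, s0 != 0 & cvgn (series (fun n => d n * s0 ^+ n)).
  apply: contrapT => no.
  have f0 s : 0 < `|s| <= 1 -> series (fun n => a n * s ^+ n) @ \oo --> (0 : R).
    move=> /andP[s0 _]; have := ha s; rewrite [X in _ * X]dvgP ?mulr0 //.
    by move=> cs; apply: no; exists s; rewrite -?normr_gt0.
  have [C [dl [dl0 h]]] := series_bigO ltr01 ltr01 aB f0 1%N.
  have := @coef_bigO 1 (\poly_(n < 1) a n) C dl dl0.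
  move=> /(_ _ 0%N isT); rewrite coef_poly /= a0 => H.
  have /eqP : (1 : R) = 0.
    by apply: H => s /h; rewrite sub0r normrN.
  by rewrite oner_eq0.
have [B' dB] := cvg_terms_bounded cs0.
have s0p : 0 < `|s0| by rewrite normr_gt0.
have s02 : 0 < `|s0| / 2 by rewrite divr_gt0.
have fd := series_bigO s0p s02 dB (fun s hs =>
  bounded_terms_cvg s0p dB (elimTF andP hs).2 : _ --> limn _).
have [C [dl [dl0 h]]] := bigO_mul (expR_bigO c n.+1) (fd n.+1).
have [C' [dl' [dl'0 h']]] := fa n.+1.
pose p := \poly_(i < n.+1) a i -
  (\poly_(i < n.+1.*2) ecoef c i) * (\poly_(i < n.+1) d i).
have /(_ n (ltnSn n)) : forall m, (m < n.+1)%N -> p`_m = 0.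
  apply: (@coef_bigO n.+1 p (C + C') (Num.min dl dl')); first by rewrite lt_min dl0.
  move=> s /andP[sp]; rewrite le_min => /andP[sdl sdl'].
  have hs := h s; rewrite sp sdl in hs; have {}hs := hs isT.
  have hs' := h' s; rewrite sp sdl' in hs'; have {}hs' := hs' isT.
  rewrite /p hornerD hornerN mulrDl.
  set E := expR _ * _ in hs hs'.
  rewrite (_ : _ - _ = (E - ((\poly_(i < n.+1.*2) ecoef c i) * (\poly_(i < n.+1) d i)).[s])
     - (E - (\poly_(i < n.+1) a i).[s])); last by ring.
  by apply: le_trans (ler_normB _ _) _; rewrite lerD.
rewrite /p coefB coef_poly ltnSn coefM => /eqP; rewrite subr_eq0 => /eqP ->.
apply: eq_bigr => i _; rewrite !coef_poly.
have in1 : (i < n.+1)%N := ltn_ord i.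
have in2 : (i < n.+1.*2)%N by rewrite -addnn (leq_trans in1) ?leq_addr.
by rewrite in2 ltnS leq_subr.
Qed.

End SeriesCoefficients.

(** * Transfer of commutation and homogeneity through the intertwiner *)

Section Intertwiner.
Context {R : realType} {N : nat} (Rs : seq 'rV[R]_N) (b : 'rV[R]_N).
Context (k : 'rV[R]_N -> R) (V : ('rV[R]_N -> R) -> ('rV[R]_N -> R)) (t : R).
Context (rootRs : root_system Rs) (regb : regular_for Rs b) (multk : multiplicity Rs k).
Context (hV : intertwiner Rs (pos_sub Rs b) k V) (t0 : 0 < t).
Local Notation Rp := (pos_sub Rs b).
Local Notation T := (dT Rs b k).
Local Notation D := (dLap Rs b k).
Local Notation L := (gauss_int Rp k t).
Implicit Types (p q f : 'rV[R]_N -> R) (i j : 'I_N) (m nu rho : mi N).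

Lemma V_lin c p q : polyf p -> polyf q ->
  V (fun x => c * p x + q x) = fun x => c * V p x + V q x.
Proof. by move=> pp pq; case: hV => -[h _] _ _ _ _; apply: h; exact: polyf_is_poly. Qed.

Lemma V_inj p q : polyf p -> polyf q -> V p = V q -> p = q.
Proof. by move=> pp pq; case: hV => -[_ h] _ _ _ _; apply: h; exact: polyf_is_poly. Qed.

Lemma V_homog n p : homog n p -> homog n (V p).
Proof. by case: hV => _ h _ _ _; exact: h. Qed.

Lemma V_homog_surj n q : homog n q -> exists p, homog n p /\ V p = q.
Proof. by case: hV => _ _ h _ _; exact: h. Qed.

Lemma V1 : V (fun=> 1) = fun=> 1.
Proof. by case: hV. Qed.

Lemma V0 : V (fun=> 0) = fun=> 0.
Proof.
have := V_lin (-1) (polyf_cst 0) (polyf_cst 0).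
rewrite (_ : (fun x => -1 * 0 + 0) = fun=> 0); last by apply/funext => x; rewrite mulr0 addr0.
by move=> ->; apply/funext => x; rewrite mulN1r addNr.
Qed.

Lemma V_sum (J : Type) (r : seq J) (c : J -> R) (f : J -> 'rV[R]_N -> R) :
  (forall a, polyf (f a)) ->
  V (fun x => \sum_(a <- r) c a * f a x) = fun x => \sum_(a <- r) c a * V (f a) x.
Proof.
move=> pf; elim: r => [|a r IH].
  rewrite (_ : (fun x => _) = fun=> 0); last by apply/funext => x; rewrite big_nil.
  by rewrite V0; apply/funext => x; rewrite big_nil.
rewrite (_ : (fun x => _) = fun x => c a * f a x + \sum_(e <- r) c e * f e x); last first.
  by apply/funext => x; rewrite big_cons.
rewrite V_lin // ?IH; first by apply/funext => x; rewrite big_cons.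
by apply: polyf_sum => e; exact: polyfZ.
Qed.

Lemma polyf_moment m : polyf (moment V m).
Proof. exact: homog_polyf (V_homog (homog_mono m)). Qed.

Lemma polyf_V p : polyf p -> polyf (V p).
Proof.
move=> /polyf_monos[s ->]; rewrite V_sum; last by move=> z; exact: polyf_mono.
by apply: polyf_sum => z; apply: polyfZ; exact: polyf_moment.
Qed.

Lemma V_surj q : polyf q -> exists p, polyf p /\ V p = q.
Proof.
move=> /polyf_monos[s ->]; elim: s => [|z s [p [pp E]]].
  exists (fun=> 0); split; first exact: polyf_cst.
  by rewrite V0; apply/funext => x; rewrite big_nil.
have [p' [hp' E']] := V_homog_surj (homog_mono (R := R) z.2).
have pp' := homog_polyf hp'.
exists (fun x => z.1 * p' x + p x); split; first by apply: polyfD => //; exact: polyfZ.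
by rewrite V_lin // E E'; apply/funext => x; rewrite big_cons.
Qed.

Lemma T_V i p : polyf p -> T i (V p) = V (pd i p).
Proof.
move=> pp; apply: (dT_eq rootRs regb); [exact: polyf_V|by apply: polyf_V; exact: polyf_pd|].
by move=> x rx; case: hV => _ _ _ _ h; apply: h => //; exact: polyf_is_poly.
Qed.

(** V is onto the polynomials, so commutativity is inherited from the partial derivatives. *)
Lemma T_comm i j p : polyf p -> T i (T j p) = T j (T i p).
Proof.
move=> /V_surj[q [pq <-]]; rewrite (T_V j pq) (T_V i pq).
by rewrite (T_V i (polyf_pd j pq)) (T_V j (polyf_pd i pq)) (pd_comm i j pq).
Qed.

Lemma T_homog i l p : homog l p -> homog l.-1 (T i p).
Proof.
move=> /V_homog_surj[q [hq <-]]; rewrite T_V; last exact: homog_polyf hq.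
by apply: V_homog; exact: homog_pd_pred.
Qed.

Lemma T_homog0 i p : homog 0 p -> T i p = fun=> 0.
Proof. by move=> /homog0_cst ->; exact: (dT_cst k rootRs regb). Qed.

(** Pulled back by V, the hypothesis says that all partial derivatives vanish, and Euler's identity
    then kills a form of positive degree. *)
Lemma T_kernel n p : homog n.+1 p -> (forall i, T i p = fun=> 0) -> p = fun=> 0.
Proof.
move=> /V_homog_surj[q [hq <-]] h; have pq := homog_polyf hq.
suff -> : q = fun=> 0 by exact: V0.
have dq i : pd i q = fun=> 0.
  apply: V_inj; [exact: polyf_pd|exact: polyf_cst|].
  by rewrite -T_V // h V0.
apply/funext => x; have := homog_euler x hq.
rewrite big1 => [/esym/eqP|i _]; last by rewrite dq mulr0.
by rewrite mulf_eq0 pnatr_eq0 => /eqP.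
Qed.

Lemma polyf_D p : polyf p -> polyf (D p).
Proof. exact: polyf_dLap. Qed.

Lemma D_lin c p q : polyf p -> polyf q ->
  D (fun x => c * p x + q x) = fun x => c * D p x + D q x.
Proof. exact: (dLap_lin k rootRs regb). Qed.

Lemma D_homog l p : homog l.+2 p -> homog l (D p).
Proof.
move=> hp; apply: homog_sum => i.
exact: (T_homog i (T_homog i hp)).
Qed.

Lemma D_low l p : (l < 2)%N -> homog l p -> D p = fun=> 0.
Proof.
move=> l2 hp; apply/funext => x; rewrite /dLap big1 // => i _.
have h0 : homog 0 (T i p) by case: l hp l2 => [|[|//]] hp _; exact: (T_homog i hp).
by rewrite (T_homog0 i h0).
Qed.

Lemma D_T i p : polyf p -> D (T i p) = T i (D p).
Proof.
move=> pp; rewrite [in RHS]/dLap (dT_sum k rootRs regb); last first.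
  by move=> j; do 2! apply: polyf_dT.
apply/funext => x; apply: eq_bigr => j _.
by rewrite (T_comm j i pp) (T_comm j i (polyf_dT _ _ _ j pp)).
Qed.

Lemma D_V p : polyf p -> D (V p) = V (Lap0 p).
Proof.
move=> pp; apply/funext => x; rewrite /dLap /Lap0.
under eq_bigr => i _ do rewrite (T_V i pp) (T_V i (polyf_pd i pp)).
have -> : (fun x => \sum_i pd i (pd i p) x) = fun x => \sum_i 1 * pd i (pd i p) x.
  by apply/funext => y; apply: eq_bigr => i _; rewrite mul1r.
rewrite V_sum; last by move=> i; do 2! apply: polyf_pd.
by apply: eq_bigr => i _; rewrite mul1r.
Qed.

Lemma iter_D_V n p : polyf p -> iter n D (V p) = V (iter n Lap0 p).
Proof.
move=> pp; elim: n => //= n ->; rewrite D_V //.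
by apply: (polyf_iter (@polyf_Lap0 R N)).
Qed.

(** * The Dunkl heat operator and its expectation under the Gaussian *)

Local Notation A M := (expo D t M.+1).

Lemma polyf_A M p : polyf p -> polyf (A M p).
Proof. by move=> pp; apply: polyf_expo => //; exact: polyf_D. Qed.

Lemma A_lin M c p q : polyf p -> polyf q ->
  A M (fun x => c * p x + q x) = fun x => c * A M p x + A M q x.
Proof. exact: (expo_lin t polyf_D D_lin). Qed.

Lemma A_X M i l p : homog l p -> (l < M)%N -> A M (fun x => x 0 i * p x) =
  fun x => x 0 i * A M p x - 2 * t * A M (T i p) x.
Proof.
apply: (expo_X t polyf_D D_lin D_homog D_low (T := T i)).
- by move=> q; exact: polyf_dT.
- by move=> l' q; exact: T_homog.
- by move=> q; exact: D_T.
- by move=> q; exact: (dLap_coordM rootRs regb multk).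
Qed.

Lemma A_T M i p : polyf p -> A M (T i p) = T i (A M p).
Proof.
move=> pp; rewrite [in RHS]/expo (dT_sum k rootRs regb); last first.
  by move=> j; apply: polyfZ; apply: polyf_iter => //; exact: polyf_D.
apply/funext => x; apply: eq_bigr => j _.
rewrite (dTZ k rootRs regb); last by apply: polyf_iter => //; exact: polyf_D.
by rewrite (iter_comm polyf_D (D_T i)).
Qed.

Lemma appell_V nu : appell V nu t = V (hermite t nu).
Proof.
pose P (z : {ffun 'I_N -> 'I_(mabs nu).+1}) := [forall i, (z i <= nu i)%N].
pose c (z : {ffun 'I_N -> 'I_(mabs nu).+1}) : R := (P z)%:R *
  ((\prod_(i < N) 'C(nu i, z i))%:R * acoef [ffun i => (nu i - z i)%N] t).
have -> : hermite t nu = fun x => \sum_(z <- index_enum _) c z * mono (mi_of z) x.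
  apply/funext => x; rewrite /hermite big_mkcond; apply: eq_bigr => z _.
  by rewrite /c /P; case: ifP; rewrite ?mul1r ?mul0r.
rewrite V_sum; last by move=> z; exact: polyf_mono.
apply/funext => x; rewrite /appell big_mkcond; apply: eq_bigr => z _.
by rewrite /c /P; case: ifP; rewrite ?mul1r ?mul0r.
Qed.

(** V intertwines the classical with the Dunkl Laplacian, hence also their exponentials, so this is
    the image of [expo_mono] under V. *)
Lemma appell_A M nu : (mabs nu <= M)%N -> appell V nu t = A M (moment V nu).
Proof.
move=> nuM; rewrite appell_V -(expo_mono t nuM) /expo V_sum; last first.
  by move=> j; apply: polyf_iter; [exact: polyf_Lap0|exact: polyf_mono].
apply/funext => x; apply: eq_bigr => j _.
by rewrite /moment iter_D_V //; exact: polyf_mono.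
Qed.

Lemma L_lin c p q : polyf p -> polyf q -> L (fun x => c * p x + q x) = c * L p + L q.
Proof. exact: (gauss_int_lin b rootRs multk t0). Qed.

Lemma L0 : L (fun=> 0) = 0.
Proof.
have := L_lin (-1) (polyf_cst 0) (polyf_cst 0).
rewrite (_ : (fun x => -1 * 0 + 0) = fun=> 0); last by apply/funext => x; rewrite mulr0 addr0.
lra.
Qed.

Lemma L_sum (J : Type) (r : seq J) (c : J -> R) (f : J -> 'rV[R]_N -> R) :
  (forall a, polyf (f a)) ->
  L (fun x => \sum_(a <- r) c a * f a x) = \sum_(a <- r) c a * L (f a).
Proof.
move=> pf; elim: r => [|a r IH].
  rewrite (_ : (fun x => _) = fun=> 0); last by apply/funext => x; rewrite big_nil.
  by rewrite L0 big_nil.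
rewrite (_ : (fun x => _) = fun x => c a * f a x + \sum_(e <- r) c e * f e x); last first.
  by apply/funext => x; rewrite big_cons.
rewrite L_lin // ?IH ?big_cons //.
by apply: polyf_sum => e; exact: polyfZ.
Qed.

Lemma homog_at0 n p : homog n.+1 p -> p 0 = 0.
Proof. by move=> hp; rewrite -[X in p X](scale0r 0) (homogZs _ _ hp) expr0n mul0r. Qed.

(** By Euler's identity a form of positive degree is a combination of products x_i p, and L (A (x_i
    p)) = L (x_i A p) - 2t L (T_i A p) = 0 because T_i commutes with A. *)
Lemma L_A M l q : homog l q -> (l <= M)%N -> L (A M q) = q 0.
Proof.
case: l => [hq _|l hq lM].
  rewrite (homog0_cst hq) (expo_cst t D_homog D_low); move: (q 0) => c.
  have := L_lin c (polyf_cst 1) (polyf_cst 0).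
  by rewrite L0 (gauss_int1 rootRs regb multk t0) mulr1 !addr0.
have key i p : homog l p -> L (A M (fun x => x 0 i * p x)) = 0.
  move=> hp; have pp := homog_polyf hp; rewrite (A_X i hp lM).
  have -> : (fun x : 'rV[R]_N => x 0 i * A M p x - 2 * t * A M (T i p) x) =
      fun x => (- (2 * t)) * A M (T i p) x + x 0 i * A M p x.
    by apply/funext => x; rewrite addrC mulNr.
  have pA := polyf_A M pp.
  rewrite L_lin; first last.
  - by apply: polyfM => //; exact: polyf_coord.
  - by apply: polyf_A; exact: polyf_dT.
  rewrite A_T // (gauss_int_dT rootRs regb multk t0) //.
  by rewrite mulNr mulrA divff ?mul1r ?addNr // gt_eqF // mulr_gt0.
rewrite (homog_at0 hq).
have pq := homog_polyf hq.
have px i : polyf (fun x : 'rV[R]_N => x 0 i * pd i q x).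
  by apply: polyfM; [exact: polyf_coord|exact: polyf_pd].
have qE : q = fun x : 'rV[R]_N => \sum_(i < N) l.+1%:R^-1 * (x 0 i * pd i q x).
  by apply/funext => x; rewrite -mulr_sumr (homog_euler x hq) mulKf.
have AS : forall r : seq 'I_N, A M (fun x : 'rV[R]_N => \sum_(i <- r) l.+1%:R^-1 * (x 0 i * pd i q x)) =
    fun x => \sum_(i <- r) l.+1%:R^-1 * A M (fun x => x 0 i * pd i q x) x.
  elim=> [|i r IH].
    rewrite (_ : (fun x => _) = fun=> 0); last by apply/funext => x; rewrite big_nil.
    by rewrite (expo_cst t D_homog D_low); apply/funext => x; rewrite big_nil.
  rewrite (_ : (fun x : 'rV[R]_N => \sum_(j <- i :: r) _) = fun x => l.+1%:R^-1 * (x 0 i * pd i q x) +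
      \sum_(j <- r) l.+1%:R^-1 * (x 0 j * pd j q x)); last first.
    by apply/funext => x; rewrite big_cons.
  rewrite A_lin // ?IH; first by apply/funext => x; rewrite big_cons.
  by apply: polyf_sum => j; exact: polyfZ.
rewrite qE AS L_sum; last by move=> i; exact: polyf_A.
by rewrite big1 // => i _; rewrite key ?mulr0 //; exact: homog_pd.
Qed.

(** Multiplication by one coordinate turns A applied to degree l into A applied to degrees l - 1 and
    l + 1, so a monomial [m] reaches only degrees at distance at most |m| from l. [ok] collects the
    degrees on which the functional vanishes: those below |nu| for cocharacters, the positive ones
    for characters. *)
Lemma mono_A_vanish (Lam : ('rV[R]_N -> R) -> R) (ok : nat -> Prop) M :
  (forall c p q, polyf p -> polyf q ->
     Lam (fun x => c * p x + q x) = c * Lam p + Lam q) ->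
  (forall l q, homog l q -> ok l -> (l <= M)%N -> Lam (A M q) = 0) ->
  forall m l q, homog l q ->
    (forall j : nat, (l <= j + mabs m)%N -> (j <= l + mabs m)%N -> ok j) ->
    (l + mabs m <= M)%N -> Lam (fun x => mono m x * A M q x) = 0.
Proof.
move=> Llin LA; elim/(@mi_ind N) => [|i m IH] l q hq okl lM.
  rewrite mono0; have -> : (fun x => 1 * A M q x) = A M q.
    by apply/funext => x; rewrite mul1r.
  have lM' : (l <= M)%N by exact: leq_trans (leq_addr _ _) lM.
  have okl' : ok l by apply: okl; exact: leq_addr.
  exact: (LA l q hq okl' lM').
rewrite mabs_incr in okl lM.
have lM' : (l < M)%N by rewrite (leq_trans _ lM) // addnS ltnS leq_addr.
have pq := homog_polyf hq; have hT := T_homog i hq; have hX := homog_coordM i hq.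
have -> : (fun x => mono (mincr i m) x * A M q x) = fun x =>
    2 * t * (mono m x * A M (T i q) x) + mono m x * A M (fun x => x 0 i * q x) x.
  by apply/funext => x; rewrite (A_X i hq lM') mono_incr; ring.
rewrite Llin; first last.
- apply: polyfM; [exact: polyf_mono|apply: polyf_A].
  exact: homog_polyf hX.
- apply: polyfM; [exact: polyf_mono|apply: polyf_A].
  exact: homog_polyf hT.
rewrite (IH l.-1) //; first last.
- by rewrite (leq_trans _ lM) // addnS ltnW // ltnS leq_add2r leq_pred.
- move=> j h1 h2; apply: okl.
    by rewrite addnS; case: (l) h1 => //= n; rewrite ltnS.
  by rewrite (leq_trans h2) // leq_add ?leq_pred // leqnSn.
rewrite (IH l.+1) ?mulr0 ?addr0 //; last by rewrite addSn -addnS.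
move=> j h1 h2; apply: okl; last by rewrite addnS -addSn.
by rewrite addnS (leq_trans (leqnSn l)) // (leq_trans h1).
Qed.

Lemma moment_free n (c : mi N -> R) :
  (forall x, \sum_(m <- mis n) c m * moment V m x = 0) ->
  forall m, m \in mis n -> c m = 0.
Proof.
move=> c0; apply: mono_free => x.
suff E : (fun x => \sum_(m <- mis n) c m * @mono R N m x) = fun=> 0.
  by have := congr1 (fun f => f x) E.
apply: V_inj; [|exact: polyf_cst|].
  by apply: polyf_sum => m; apply: polyfZ; exact: polyf_mono.
rewrite V0 V_sum; last by move=> m; exact: polyf_mono.
by apply/funext => y; exact: c0.
Qed.

(** * Homogeneous components of the generating function of the cocharacters *)

(** Forms of degree n in x with polynomial coefficients in y. The moment functions serve as basis
    because the cocharacters are coefficients in that basis; integration in y then acts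
    coefficientwise. *)
Definition sep n (f : 'rV[R]_N -> 'rV[R]_N -> R) := exists g : mi N -> 'rV[R]_N -> R,
  (forall m, polyf (g m)) /\
  forall x y, f x y = \sum_(m <- mis n) g m y * moment V m x.

Lemma sep_mul n p g : homog n p -> polyf g -> sep n (fun x y => p x * g y).
Proof.
move=> /V_homog_surj[q [/homogE[c ->] <-]] pg.
exists (fun m y => c m * g y); split => [m|x y]; first exact: polyfZ.
rewrite V_sum; last by move=> m; exact: polyf_mono.
by rewrite mulr_suml; apply: eq_bigr => m _; rewrite mulrAC.
Qed.

Lemma sep_sum n (J : eqType) (r : seq J) (f : J -> 'rV[R]_N -> 'rV[R]_N -> R) :
  (forall a, a \in r -> sep n (f a)) -> sep n (fun x y => \sum_(a <- r) f a x y).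
Proof.
elim: r => [|a r IH] sf.
  exists (fun _ _ => 0); split => [m|x y]; first exact: polyf_cst.
  by rewrite big_nil big1 // => m _; rewrite mul0r.
have [g [pg gE]] := sf a (mem_head _ _).
have [g' [pg' g'E]] := IH (fun c cr => sf c (mem_behead (s := a :: r) cr)).
exists (fun m y => g m y + g' m y); split => [m|x y]; first exact: polyfD.
by rewrite big_cons gE g'E -big_split /=; apply: eq_bigr => m _; rewrite mulrDl.
Qed.

Definition kt (y : 'rV[R]_N) n : 'rV[R]_N -> R := fun x => kernel_term V x y n.

Lemma ktE y n x : kt y n x =
  \sum_(m <- mis n) (mono m y / (mfact m)%:R) * moment V m x.
Proof.
rewrite /kt /kernel_term.
rewrite (big_mis n (fun m => moment V m x * mono m y / (mfact m)%:R)).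
by apply: eq_bigr => m _; rewrite -mulrA mulrC.
Qed.

Lemma kt_homog y n : homog n (kt y n).
Proof.
apply: (@homog_eq _ _ _ (fun x => \sum_(m <- mis n) (mono m y / (mfact m)%:R) * moment V m x)).
  apply: homog_sum_in => m mn; apply: homogZ; apply: V_homog.
  exact: homog_monoP.
by apply/funext => x; rewrite ktE.
Qed.

Lemma mis0 (F : mi N -> R) : \sum_(m <- mis 0) F m = F [ffun=> 0%N].
Proof.
rewrite (bigD1_seq [ffun=> 0%N]) ?mis_uniq ?mem_mis ?mabs0 //= big1_seq ?addr0 //.
by move=> m /andP[m0]; rewrite mem_mis => /eqP/mabs_eq0 E; rewrite E eqxx in m0.
Qed.

Lemma kt0 y : kt y 0 = fun=> 1.
Proof.
apply/funext => x; rewrite ktE mis0 /moment mono0 V1 /mfact big1 ?divr1 ?mulr1 //.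
by move=> i _; rewrite ffunE.
Qed.

(** The homogeneous part of the eigenvalue equation T_i K(., y) = y_i K(., y): through V it becomes
    termwise differentiation of the exponential series. *)
Lemma T_kt i y n : T i (kt y n.+1) = fun x => y 0 i * kt y n x.
Proof.
have -> : kt y n.+1 = fun x =>
    \sum_(m <- mis n.+1) (mono m y / (mfact m)%:R) * moment V m x.
  by apply/funext => x; rewrite ktE.
rewrite (dT_sum k rootRs regb); last by move=> m; apply: polyfZ; exact: polyf_moment.
have E m x : T i (fun x => mono m y / (mfact m)%:R * moment V m x) x =
    mono m y / (mfact m)%:R * ((m i)%:R * moment V (mdecr i m) x).
  rewrite (dTZ k rootRs regb); last exact: polyf_moment.
  rewrite /moment (T_V i (polyf_mono m)) pd_mono.
  have := V_lin (m i)%:R (polyf_mono (R := R) (mdecr i m)) (polyf_cst 0).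
  rewrite V0 (_ : (fun x => _ + 0) = fun x => (m i)%:R * mono (mdecr i m) x).
    by move=> ->; rewrite addr0.
  by apply/funext => z; rewrite addr0.
apply/funext => x; under eq_bigr do rewrite E.
rewrite (bigID (fun m : mi N => 0 < m i)%N) /= [X in _ + X]big1 ?addr0; last first.
  by move=> m; rewrite -eqn0Ngt => /eqP ->; rewrite mul0r mulr0.
rewrite mis_incr ktE mulr_sumr; apply: eq_bigr => m _.
rewrite mincrK mono_incr mfact_incr ffunE eqxx addn1 natrM.
have m1 : (m i).+1%:R != 0 :> R by rewrite pnatr_eq0.
have m2 : (mfact m)%:R != 0 :> R.
  by rewrite pnatr_eq0 -lt0n prodn_gt0 // => j; exact: fact_gt0.
move: ((m i).+1%:R : R) ((mfact m)%:R : R) m1 m2 => u v m1 m2.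
by field; rewrite m1 m2.
Qed.

(** The homogeneous component of degree n of exp(- |x|^2 / 4t). *)
Definition ef n : 'rV[R]_N -> R := fun x => ecoef (sqn x / (4 * t)) n.

Lemma ef_rec n x : ef n.+2 x = (- (4 * t * (n./2).+1%:R)^-1) * (sqn x * ef n x).
Proof.
rewrite /ef /ecoef /= negbK; case: ifP => _; first by rewrite !mulr0.
rewrite exprS factS natrM.
have h1 : (n./2).+1%:R != 0 :> R by rewrite pnatr_eq0.
have h2 : (n./2)`!%:R != 0 :> R by rewrite pnatr_eq0 -lt0n fact_gt0.
have h3 : t != 0 by rewrite gt_eqF.
move: ((- (sqn x / (4 * t))) ^+ n./2) => w.
move: ((n./2).+1%:R : R) ((n./2)`!%:R : R) h1 h2 => u v h1 h2.
by field; rewrite h1 h2 h3.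
Qed.

Lemma ef_homog n l p : homog l p -> homog (n + l) (fun x => ef n x * p x).
Proof.
move=> hp; move: {2}n.+1 (ltnSn n) => B; elim: B n => // B IH [|[|n]] nB.
- apply: (homog_eq hp); apply/funext => x.
  by rewrite /ef /ecoef /= expr0 divr1 mul1r.
- by apply: (homog_eq (homog0 _)); apply/funext => x; rewrite /ef /ecoef /= mul0r.
have := homogZ (- (4 * t * (n./2).+1%:R)^-1) (homog_sqnM (IH n (ltnW nB))).
by congr homog; apply/funext => x; rewrite ef_rec; ring.
Qed.

(** The component of index n - 2, set to 0 for n < 2, where truncated subtraction would return
    [ef 0]. *)
Definition ef2 n : 'rV[R]_N -> R := if n is n'.+2 then ef n' else fun=> 0.

(** The homogeneous form of the Leibniz rule for exp(- |x|^2 / 4t), which is radial and so creates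
    no difference terms. The induction goes in steps of two, through [ef_rec] and [dT_sqnM]. *)
Lemma T_ef i n p l : homog l p -> T i (fun x => ef n x * p x) =
  fun x => ef n x * T i p x - (2 * t)^-1 * x 0 i * (ef2 n x * p x).
Proof.
move=> hp; have pp := homog_polyf hp.
move: {2}n.+1 (ltnSn n) => B; elim: B n => // B IH [|[|n]] nB.
- rewrite (_ : (fun x => ef 0 x * p x) = p); last first.
    by apply/funext => x; rewrite /ef /ecoef /= expr0 divr1 mul1r.
  by apply/funext => x; rewrite /ef /ecoef /= expr0 divr1 mul1r mul0r mulr0 subr0.
- rewrite (_ : (fun x => ef 1 x * p x) = fun=> 0); last first.
    by apply/funext => x; rewrite /ef /ecoef /= mul0r.
  rewrite (dT_cst k rootRs regb).
  by apply/funext => x; rewrite /ef /ecoef /= !mul0r mulr0 subr0.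
have pe : polyf (fun x => ef n x * p x) by exact: homog_polyf (ef_homog n hp).
have -> : (fun x => ef n.+2 x * p x) =
    fun x => (- (4 * t * (n./2).+1%:R)^-1) * (sqn x * (ef n x * p x)).
  by apply/funext => x; rewrite ef_rec; ring.
rewrite (dTZ k rootRs regb); last by apply: polyfM => //; exact: polyf_sqn.
rewrite (dT_sqnM k rootRs regb) // (IH n (ltnW nB)).
apply/funext => x; rewrite ef_rec -[ef2 n.+2]/(ef n).
have h3 : t != 0 by rewrite gt_eqF.
case: n nB {pe} => [|[|n]] nB; rewrite /ef2.
- by rewrite /=; move: (T i p x) (p x) (ef 0 x) => w v e; field.
- by rewrite /=; move: (T i p x) (p x) (ef 1 x) => w v e; field.
rewrite (ef_rec n) /=.
have h1 : (n./2).+1%:R != 0 :> R by rewrite pnatr_eq0.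
have h2 : (n./2).+1%:R + 1 != 0 :> R by rewrite natr1 pnatr_eq0.
rewrite -[(n./2).+2%:R]natr1; move: ((n./2).+1%:R : R) h1 h2 (T i p x) => u h1 h2 w.
by field; rewrite h1 h2 h3.
Qed.

Definition GG n (x y : 'rV[R]_N) : R :=
  \sum_(a < n.+1) ef a x * kt ((2 * t)^-1 *: y) (n - a) x.

Definition GGp n x y : R := if n is n'.+1 then GG n' x y else 0.

Lemma GG_sep n : sep n (GG n).
Proof.
apply: sep_sum => a _.
pose f (m : mi N) (x y : 'rV[R]_N) : R :=
  (ef a x * moment V m x) * (mono m ((2 * t)^-1 *: y) / (mfact m)%:R).
have E x y : ef a x * kt ((2 * t)^-1 *: y) (n - a)%N x =
    \sum_(m <- mis (n - a)%N) f m x y.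
  by rewrite ktE mulr_sumr; apply: eq_bigr => m _; rewrite /f; ring.
rewrite (_ : (fun x y => _) = fun x y => \sum_(m <- mis (n - a)%N) f m x y); last first.
  by apply/funext => x; apply/funext => y; exact: E.
apply: sep_sum => m mn; apply: sep_mul.
  rewrite -{1}(subnKC (ltn_ord a : a <= n)%N); apply: ef_homog; apply: V_homog.
  exact: homog_monoP.
apply: (polyf_eq (polyfZ ((mfact m)%:R^-1) (polyf_scale _ (polyf_mono m)))).
by apply/funext => y; rewrite mulrC.
Qed.

Lemma GG_polyf n x : polyf (GG n x).
Proof.
have [g [pg gE]] := GG_sep n.
apply: (polyf_eq (polyf_sum (mis n) predT (fun m => polyfZ (moment V m x) (pg m)))).
by apply/funext => y; rewrite gE; apply: eq_bigr => m _; rewrite mulrC.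
Qed.

Lemma GGp_polyf n x : polyf (GGp n x).
Proof. by case: n => [|n]; [exact: polyf_cst|exact: GG_polyf]. Qed.

Lemma GG0 x y : GG 0 x y = 1.
Proof.
by rewrite /GG big_ord1 kt0 /ef /ecoef /= expr0 divr1 mulr1.
Qed.

Lemma T_GG i n y : T i (fun x => GG n.+1 x y) =
  fun x => (2 * t)^-1 * (y 0 i * GG n x y - x 0 i * GGp n x y).
Proof.
set y' := (2 * t)^-1 *: y.
have pk a l : polyf (fun x => ef a x * kt y' l x).
  exact: homog_polyf (ef_homog a (kt_homog y' l)).
have -> : (fun x => GG n.+1 x y) = fun x => \sum_(a < n.+2) ef a x * kt y' (n.+1 - a) x.
  by [].
rewrite (dT_sum k rootRs regb) //.
apply/funext => x.
have -> : \sum_(a < n.+2) T i (fun x => ef a x * kt y' (n.+1 - a) x) x =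
    \sum_(a < n.+2) ef a x * T i (kt y' (n.+1 - a)) x -
    (2 * t)^-1 * x 0 i * \sum_(a < n.+2) ef2 a x * kt y' (n.+1 - a) x.
  rewrite mulr_sumr -sumrB; apply: eq_bigr => a _.
  by rewrite (T_ef i a (kt_homog y' _)).
have -> : \sum_(a < n.+2) ef a x * T i (kt y' (n.+1 - a)) x = y' 0 i * GG n x y.
  rewrite big_ord_recr /= subnn (T_homog0 i (kt_homog y' 0)) mulr0 addr0.
  rewrite /GG mulr_sumr; apply: eq_bigr => a _.
  by rewrite subSn ?(ltn_ord a : a <= n)%N // T_kt mulrCA.
have -> : \sum_(a < n.+2) ef2 a x * kt y' (n.+1 - a) x = GGp n x y.
  rewrite big_ord_recl /= mul0r add0r; case: n => [|n] /=.
    by rewrite big_ord1 /= mul0r.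
  rewrite big_ord_recl /= mul0r add0r.
  by apply: eq_bigr => a _; rewrite /bump /= !add1n !subSS.
rewrite /y' mxE; ring.
Qed.

(** Apply T_i in x for degree n+1. The contributions of A (y_i q) against G_n and of A q against x_i
    G_(n-1) cancel, both living on l + 1 = n, while A (T_i q) against G_n gives T_i of the
    right-hand side. *)
Lemma L_A_GG M n l q x : homog l q -> (l + n <= M)%N ->
  L (fun y => A M q y * GG n x y) = (l == n)%:R * q x.
Proof.
elim/ltn_ind: n l q x => -[_|n IH] l q x hq lM.
  have -> : (fun y => A M q y * GG 0 x y) = A M q.
    by apply/funext => y; rewrite GG0 mulr1.
  rewrite addn0 in lM; rewrite (L_A hq lM); case: l hq {lM} => [|l] hq.
    by rewrite mul1r (homog0_cst hq).
  by rewrite (homog_at0 hq) mul0r.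
have pA := polyf_A M (homog_polyf hq).
have [g [pg gE]] := GG_sep n.+1.
pose c m := L (fun y => A M q y * g m y).
have pc m : polyf (fun y => A M q y * g m y) by exact: polyfM.
pose Phi x := L (fun y => A M q y * GG n.+1 x y).
have PhiE : Phi = fun x => \sum_(m <- mis n.+1) c m * moment V m x.
  apply/funext => z; rewrite /Phi /c.
  under [RHS]eq_bigr do rewrite mulrC.
  rewrite -L_sum //; congr L; apply/funext => y; rewrite gE mulr_sumr.
  by apply: eq_bigr => m _; rewrite mulrA mulrC.
have hPhi : homog n.+1 Phi.
  rewrite PhiE; apply: homog_sum_in => m mn; apply: homogZ; apply: V_homog.
  exact: homog_monoP.
have hq' : homog n.+1 (fun z => (l == n.+1)%:R * q z).
  have [<-|_] := eqVneq l n.+1; first exact: homogZ.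
  by apply: (homog_eq (homog0 _)); apply/funext => z; rewrite mul0r.
suff : (fun z => -1 * ((l == n.+1)%:R * q z) + Phi z) = fun=> 0.
  by move/(congr1 (fun f => f x)); rewrite mulN1r addrC => /subr0_eq.
apply: (T_kernel (n := n)); first exact: homog_lin.
move=> i; rewrite (dT_lin k rootRs regb); [|exact: homog_polyf hq'|exact: homog_polyf hPhi].
have lM1 : (l < M)%N by rewrite (leq_trans _ lM) // addnS ltnS leq_addr.
have TPhi z : T i Phi z = L (fun y => A M q y *
    ((2 * t)^-1 * (y 0 i * GG n z y - z 0 i * GGp n z y))).
  rewrite PhiE (dT_sum k rootRs regb); last by move=> m; apply: polyfZ; exact: polyf_moment.
  under eq_bigr => m _ do rewrite (dTZ k rootRs regb i (c m) (polyf_moment m)) mulrC.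
  rewrite -L_sum //; congr L; apply/funext => y.
  have := congr1 (fun f => f z) (T_GG i n y) => /= <-.
  have -> : (fun x => GG n.+1 x y) = fun x => \sum_(m <- mis n.+1) g m y * moment V m x.
    by apply/funext => u; rewrite gE.
  rewrite (dT_sum k rootRs regb); last by move=> m; apply: polyfZ; exact: polyf_moment.
  rewrite mulr_sumr; apply: eq_bigr => m _.
  by rewrite (dTZ k rootRs regb i _ (polyf_moment m)); ring.
have hT := T_homog i hq; have hX := homog_coordM i hq.
have AT := polyf_A M (homog_polyf hT); have AX := polyf_A M (homog_polyf hX).
have IHp z : L (fun y => A M q y * GGp n z y) = (l.+1 == n)%:R * q z.
  case: n IH lM {hq' hPhi PhiE Phi TPhi g pg gE c pc} => [|n] IH lM.
    rewrite mul0r -[RHS]L0; congr L; apply/funext => y.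
    by rewrite mulr0.
  rewrite /GGp eqSS; apply: (IH n (ltnW (ltnSn n.+1)) l q z hq).
  by rewrite (leq_trans _ lM) // leq_add2l -addn2 leq_addr.
apply/funext => z; rewrite TPhi.
have -> : (fun y => A M q y * ((2 * t)^-1 * (y 0 i * GG n z y - z 0 i * GGp n z y))) =
   fun y => 1 * (A M (T i q) y * GG n z y) + ((2 * t)^-1 * (A M (fun x => x 0 i * q x) y * GG n z y)
     + (- ((2 * t)^-1 * z 0 i)) * (A M q y * GGp n z y)).
  apply/funext => y; rewrite (A_X i hq lM1).
  by field; rewrite gt_eqF.
have p1 : polyf (fun y => A M (T i q) y * GG n z y) by apply: polyfM => //; exact: GG_polyf.
have p2 : polyf (fun y => A M (fun x => x 0 i * q x) y * GG n z y).
  by apply: polyfM => //; exact: GG_polyf.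
have p3 : polyf (fun y => A M q y * GGp n z y) by apply: polyfM => //; exact: GGp_polyf.
have p3' := polyfZ (- ((2 * t)^-1 * z 0 i)) p3.
rewrite L_lin //; last by apply: polyfD => //; exact: polyfZ.
rewrite L_lin //.
have := L_lin (- ((2 * t)^-1 * z 0 i)) p3 (polyf_cst 0).
rewrite L0 addr0 (_ : (fun x => _ + 0) = fun y =>
  (- ((2 * t)^-1 * z 0 i)) * (A M q y * GGp n z y)); last first.
  by apply/funext => y; rewrite addr0.
move=> ->; rewrite IHp (IH n (ltnSn n) l.+1 _ _ hX); last by rewrite addSn -addnS.
rewrite (IH n (ltnSn n) l.-1 _ _ hT); last first.
  by rewrite (leq_trans _ lM) // leq_add ?leq_pred.
have TZ : T i (fun z => (l == n.+1)%:R * q z) z = (l == n.+1)%:R * T i q z.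
  by rewrite (dTZ k rootRs regb i _ (homog_polyf hq)).
(* For l = 0 the two Kronecker symbols can differ, but then T_i q = 0. *)
rewrite TZ; have -> : (l.-1 == n)%:R * T i q z = (l == n.+1)%:R * T i q z.
  case: l hq {lM hq' hT hX AT AX IHp IH lM1 TZ PhiE hPhi TPhi Phi c pc pA p1 p2 p3 p3'} => [|l] hq.
    by rewrite (T_homog0 i hq) !mulr0.
  by rewrite eqSS.
by ring.
Qed.

(** * Polynomiality of the cocharacters, biorthogonality and vanishing *)

Context (S : mi N -> 'rV[R]_N -> R) (specS : cochar_spec V t S).

Lemma cochar_GG n x y :
  \sum_(m <- mis n) (S m y / (mfact m)%:R) * moment V m x = GG n x y.
Proof.
pose y' := (2 * t)^-1 *: y.
pose a n := \sum_(m <- mis n) (S m y / (mfact m)%:R) * moment V m x.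
have aE s l : \sum_(z : {ffun 'I_N -> 'I_l.+1} | mabs (mi_of z) == l)
    moment V (mi_of z) (s *: x) / (mfact (mi_of z))%:R * S (mi_of z) y = a l * s ^+ l.
  rewrite (big_mis l (fun m => moment V m (s *: x) / (mfact m)%:R * S m y)).
  rewrite /a mulr_suml big_seq [RHS]big_seq; apply: eq_bigr => m ml.
  have hm : homog l (moment V m) := V_homog (homog_monoP ml).
  by rewrite (homogZs s x hm); ring.
have h s : series (fun n => a n * s ^+ n) @ \oo -->
    expR (- (sqn x / (4 * t)) * s ^+ 2) * limn (series (fun n => kt y' n x * s ^+ n)).
  have := @specS (s *: x) y.
  have -> : (fun n => \sum_(z : {ffun 'I_N -> 'I_n.+1} | mabs (mi_of z) == n)
      moment V (mi_of z) (s *: x) / (mfact (mi_of z))%:R * S (mi_of z) y) =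
      fun n => a n * s ^+ n by apply/funext => l; exact: aE.
  rewrite sqnZ (_ : - (s ^+ 2 * sqn x) / (4 * t) = - (sqn x / (4 * t)) * s ^+ 2); last by ring.
  rewrite /dkernel (_ : kernel_term V (s *: x) y' = fun n => kt y' n x * s ^+ n) //.
  by apply/funext => l; rewrite -/(kt y' l (s *: x)) (homogZs s x (kt_homog y' l)) mulrC.
have k0 : kt y' 0 x = 1 by rewrite kt0.
exact: (coef_cauchy h k0 n).
Qed.

Lemma mfact_neq0 m : (mfact m)%:R != 0 :> R.
Proof. by rewrite pnatr_eq0 -lt0n prodn_gt0 // => j; exact: fact_gt0. Qed.

(** The expansion of G_n in moment functions is unique, so up to m! the function [S m] is the
    polynomial coefficient supplied by [GG_sep]. *)
Lemma polyf_cochar m : polyf (S m).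
Proof.
have [g [pg gE]] := GG_sep (mabs m).
apply: (polyf_eq (polyfZ (mfact m)%:R (pg m))); apply/funext => y.
have : S m y / (mfact m)%:R - g m y = 0.
  apply: (moment_free (n := mabs m) (c := fun m => S m y / (mfact m)%:R - g m y)).
    move=> x; under eq_bigr do rewrite mulrBl.
    by rewrite sumrB cochar_GG -gE subrr.
  by rewrite mem_mis.
by move=> /subr0_eq <-; rewrite mulrC divfK // mfact_neq0.
Qed.

Lemma L_A_cochar M l q rho : homog l q -> (l + mabs rho <= M)%N -> forall x,
  \sum_(m <- mis (mabs rho)) (L (fun y => A M q y * S m y) / (mfact m)%:R) * moment V m x
  = (l == mabs rho)%:R * q x.
Proof.
move=> hq lM x; rewrite -(L_A_GG x hq lM).
have pA := polyf_A M (homog_polyf hq).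
transitivity (\sum_(m <- mis (mabs rho)) (moment V m x / (mfact m)%:R) *
    L (fun y => A M q y * S m y)).
  by apply: eq_bigr => m _; ring.
rewrite -L_sum; last by move=> m; apply: polyfM => //; exact: polyf_cochar.
congr L; apply/funext => y; rewrite -cochar_GG mulr_sumr.
by apply: eq_bigr => m _; ring.
Qed.

Lemma appell_cochar nu rho : L (fun y => appell V nu t y * S rho y) =
  if nu == rho then (mfact nu)%:R else 0.
Proof.
pose M := (mabs nu + mabs rho)%N.
rewrite (appell_A (leq_addr (mabs rho) (mabs nu)) : _ = A M (moment V nu)).
have hq : homog (mabs nu) (moment V nu) by exact: V_homog (homog_mono nu).
have E := L_A_cochar hq (leqnn M).
have := moment_free (n := mabs rho) (c := fun m =>
   L (fun y => A M (moment V nu) y * S m y) / (mfact m)%:R - (m == nu)%:R).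
move=> /(_ _ rho); rewrite mem_mis eqxx => /(_ _ isT) H.
have : L (fun y => A M (moment V nu) y * S rho y) / (mfact rho)%:R - (rho == nu)%:R = 0.
  apply: H => x; under eq_bigr do rewrite mulrBl.
  rewrite sumrB E; apply/eqP; rewrite subr_eq0; apply/eqP.
  have [nr|nr] := eqVneq (mabs nu) (mabs rho).
    rewrite (bigD1_seq nu) ?mis_uniq ?mem_mis ?nr //= eqxx !mul1r big1 ?addr0 //.
    by move=> m /negbTE ->; rewrite mul0r.
  rewrite mul0r big1_seq // => m /andP[_]; rewrite mem_mis => /eqP mr.
  by rewrite (_ : (m == nu) = false) ?mul0r //; apply: contra_neqF nr => /eqP <-.
move=> /subr0_eq h; rewrite -[LHS](divfK (mfact_neq0 rho)) h eq_sym.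
by case: eqVneq => [->|_]; rewrite ?mul1r ?mul0r.
Qed.

Lemma poly_lt_vanish d (Lam : ('rV[R]_N -> R) -> R) p :
  (forall (J : Type) (r : seq J) (c : J -> R) (f : J -> 'rV[R]_N -> R),
     (forall a, polyf (f a)) ->
     Lam (fun x => \sum_(a <- r) c a * f a x) = \sum_(a <- r) c a * Lam (f a)) ->
  (forall m, (mabs m < d)%N -> Lam (mono m) = 0) -> poly_lt d p -> Lam p = 0.
Proof.
move=> Lsum L0m [c ->].
pose c' (z : {ffun 'I_N -> 'I_d}) : R := (mabs (mi_of z) < d)%N%:R * c (mi_of z).
have -> : (fun x => \sum_(z : {ffun 'I_N -> 'I_d} | (mabs (mi_of z) < d)%N)
      c (mi_of z) * mono (mi_of z) x) =
    fun x => \sum_(z <- index_enum {ffun 'I_N -> 'I_d}) c' z * mono (mi_of z) x.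
  apply/funext => x; rewrite big_mkcond; apply: eq_bigr => z _.
  by rewrite /c'; case: ifP; rewrite ?mul1r ?mul0r.
rewrite Lsum; last by move=> z; exact: polyf_mono.
rewrite big1 // => z _; rewrite /c'; case: (boolP (_ < _)%N) => zd; last by rewrite /= !mul0r.
by rewrite L0m // mulr0.
Qed.

Lemma L_mul_sum q : polyf q -> forall (J : Type) (r : seq J) (c : J -> R)
   (f : J -> 'rV[R]_N -> R), (forall a, polyf (f a)) ->
  L (fun y => (\sum_(a <- r) c a * f a y) * q y) =
  \sum_(a <- r) c a * L (fun y => f a y * q y).
Proof.
move=> pq J r c f pf; rewrite -L_sum; last by move=> a; exact: polyfM.
congr L; apply/funext => y; rewrite mulr_suml.
by apply: eq_bigr => a _; rewrite mulrA.
Qed.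

Lemma cochar_low nu p : poly_lt (mabs nu) p -> L (fun y => p y * S nu y) = 0.
Proof.
have pS := polyf_cochar nu.
apply: (@poly_lt_vanish (mabs nu) (fun f => L (fun y => f y * S nu y))) => [|m mnu].
  exact: L_mul_sum.
(* [L_A_cochar] will be applied in degrees l < |nu| and needs l + |nu| <= M. *)
pose M := (mabs nu + mabs nu)%N.
pose Lam f := L (fun y => f y * S nu y).
have Llin c f g : polyf f -> polyf g -> Lam (fun x => c * f x + g x) = c * Lam f + Lam g.
  move=> pf pg; rewrite /Lam -L_lin; [|exact: polyfM|exact: polyfM].
  by congr L; apply/funext => y; rewrite mulrDl mulrA.
have h1 : homog 0 (fun _ : 'rV[R]_N => 1).
  by have := homog_mono (R := R) ([ffun=> 0%N] : mi N); rewrite mabs0 mono0.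
have := mono_A_vanish (Lam := Lam) (ok := fun l => (l < mabs nu)%N) (M := M) Llin.
move=> /(_ _ m 0%N (fun=> 1) h1).
(* As A 1 = 1, the monomial equals itself times A 1, and pushing it through A reaches only degrees
   at most |m| < |nu|. *)
rewrite (_ : (fun x => mono m x * A M (fun=> 1) x) = mono m); last first.
  by apply/funext => x; rewrite (expo_cst t D_homog D_low) mulr1.
apply; last 2 first.
- by move=> j _ jm; exact: leq_ltn_trans jm mnu.
- by rewrite add0n /M (leq_trans (ltnW mnu)) // leq_addr.
move=> l q hq lnu _.
have lM : (l + mabs nu <= M)%N by rewrite leq_add2r ltnW.
have := moment_free (n := mabs nu) (c := fun m' => L (fun y => A M q y * S m' y) / (mfact m')%:R).
move=> /(_ _ nu); rewrite mem_mis eqxx => /(_ _ isT) H.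
have /eqP : L (fun y => A M q y * S nu y) / (mfact nu)%:R = 0.
  by apply: H => x; rewrite (L_A_cochar hq lM) (ltn_eqF lnu) mul0r.
by rewrite mulf_eq0 invr_eq0 (negbTE (mfact_neq0 nu)) orbF => /eqP.
Qed.

Lemma appell_low nu p : poly_lt (mabs nu) p -> L (fun y => p y * appell V nu t y) = 0.
Proof.
pose M := (mabs nu + mabs nu)%N.
rewrite (appell_A (leq_addr (mabs nu) (mabs nu)) : _ = A M (moment V nu)).
have hq : homog (mabs nu) (moment V nu) by exact: V_homog (homog_mono nu).
have pA := polyf_A M (homog_polyf hq).
apply: (@poly_lt_vanish (mabs nu) (fun f => L (fun y => f y * A M (moment V nu) y))) => [|m mnu].
  exact: L_mul_sum.
(* Starting from degree |nu|, all degrees reached are at least |nu| - |m| > 0, where [L_A] evaluates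
   a form of positive degree at the origin. *)
apply: (mono_A_vanish (ok := fun l => (0 < l)%N) L_lin _ hq).
- move=> l q hl l0 lM; rewrite (L_A hl lM).
  by case: l l0 hl {lM} => // l _; exact: homog_at0.
- by move=> j h _; rewrite lt0n; apply: contraTneq mnu => j0; rewrite -leqNgt; rewrite j0 add0n in h.
- by rewrite /M leq_add2l ltnW.
Qed.

End Intertwiner.

Theorem theorem4p5 (R : realType) (N : nat) (Rs : seq 'rV[R]_N) (b : 'rV[R]_N)
    (k : 'rV[R]_N -> R) (V : ('rV[R]_N -> R) -> ('rV[R]_N -> R))
    (t : R) (S : mi N -> 'rV[R]_N -> R) :
  root_system Rs -> regular_for Rs b -> multiplicity Rs k ->
  intertwiner Rs (pos_sub Rs b) k V ->
  0 < t -> cochar_spec V t S ->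
  (forall nu rho : mi N,
     gauss_int (pos_sub Rs b) k t (fun y => appell V nu t y * S rho y)
       = (if nu == rho then (mfact nu)%:R else 0)) /\
  (forall (nu : mi N) (p : 'rV[R]_N -> R), poly_lt (mabs nu) p ->
     gauss_int (pos_sub Rs b) k t (fun y => p y * S nu y) = 0 /\
     gauss_int (pos_sub Rs b) k t (fun y => p y * appell V nu t y) = 0).
Proof.
move=> rootRs regb multk hV t0 specS; split=> [nu rho|nu p lp].
  exact: (appell_cochar rootRs regb multk hV t0 specS).
split; first exact: (cochar_low rootRs regb multk hV t0 specS lp).
exact: (appell_low rootRs regb multk hV t0 lp).
Qed.
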